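(* Let $\{\mathcal C_\alpha\}_{\alpha\in I}$, $\{\mathcal D_\beta\}_{\beta\in J}$ be finite families of unitary fusion categories and $\mathcal M$ an indecomposable finitely semisimple unitary $\{\mathcal C_\alpha\}|\{\mathcal D_\beta\}$ multimodule category. For any $\mathbf s,\mathbf r\in\mathbb Z_{\ge0}^{|I|}$ and $\mathbf m,\mathbf n\in\mathbb Z_{\ge0}^{|J|}$, the tube space $\mathbf T^{\mathbf s,\mathbf s;\mathbf m,\mathbf m}$ is an algebra, and the tube space $\mathbf T^{\mathbf s,\mathbf r;\mathbf m,\mathbf n}$ is a $\mathbf T^{\mathbf s,\mathbf s;\mathbf m,\mathbf m}|\mathbf T^{\mathbf r,\mathbf r;\mathbf n,\mathbf n}$ bimodule. The pair $(\mathbf T^{\mathbf s,\mathbf r;\mathbf m,\mathbf n},\mathbf T^{\mathbf r,\mathbf s;\mathbf n,\mathbf m})$ forms a Morita context in the sense that $$\mathbf T^{\mathbf s,\mathbf r;\mathbf m,\mathbf n}\otimes_{\mathbf T^{\mathbf r,\mathbf r;\mathbf n,\mathbf n}}\mathbf T^{\mathbf r,\mathbf s;\mathbf n,\mathbf m}\simeq\mathbf T^{\mathbf s,\mathbf s;\mathbf m,\mathbf m},\qquad \mathbf T^{\mathbf r,\mathbf s;\mathbf n,\mathbf m}\otimes_{\mathbf T^{\mathbf s,\mathbf s;\mathbf m,\mathbf m}}\mathbf T^{\mathbf s,\mathbf r;\mathbf m,\mathbf n}\simeq\mathbf T^{\mathbf r,\mathbf r;\mathbf n,\mathbf n}$$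 as bimodules. Therefore the algebras $\mathbf T^{\mathbf s,\mathbf s;\mathbf m,\mathbf m}$ are Morita equivalent for all $\mathbf s\in\mathbb Z_{\ge0}^{|I|}$, $\mathbf m\in\mathbb Z_{\ge0}^{|J|}$.
   Context: A multimodule category has pairwise coherently commuting left actions of all $\mathcal C_\alpha$ and right actions of all $\mathcal D_\beta$; equivalently it is a bimodule category over $\mathcal C=\boxtimes_\alpha\mathcal C_\alpha$ and $\mathcal D=\boxtimes_\beta\mathcal D_\beta$. Associators are suppressed; $\mathrm{Irr}$ denotes representatives of simple objects. Tube spaces. A label $\mathbf c$ of type $\mathbf s$ is a choice, for each $\alpha\in I$, of an ordered tuple $(c_{\alpha,1},\dots,c_{\alpha,s_\alpha})$ in $\mathrm{Irr}(\mathcal C_\alpha)$; it defines the object $c=\boxtimes_\alpha(c_{\alpha,1}\otimes\cdots\otimes c_{\alpha,s_\alpha})\in\mathcal C$ (empty product $=\mathbb 1$). Similarly a label $\mathbf e$ of type $\mathbf m$ defines an object $e\in\mathcal D$. Then $$\mathbf T^{\mathbf s,\mathbf r;\mathbf m,\mathbf n}=\bigoplus\ \mathrm{Hom}_{\mathcal M}(x,a\otimes z\otimes b)\otimes\mathrm{Hom}_{\mathcal C}(a\otimes c',c\otimes\tilde a)\otimes\mathrm{Hom}_{\mathcal D}(e'\otimes b,\tilde b\otimes e)\otimes\mathrm{Hom}_{\mathcal M}(\tilde a\otimes u\otimes\tilde b,w),$$ the sum over $a,\tilde a\in\mathrm{Irr}(\mathcal C)$, $b,\tilde b\in\mathrm{Irr}(\mathcal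 D)$, $x,z,u,w\in\mathrm{Irr}(\mathcal M)$ and labels $\mathbf c$ (exterior, type $\mathbf s$), $\mathbf c'$ (interior, type $\mathbf r$), $\mathbf e$ (exterior, type $\mathbf m$), $\mathbf e'$ (interior, type $\mathbf n$). Graphically this is the space of annular diagrams with a vertical $\mathcal M$-wall, a left arc for each $\mathcal C_\alpha$ with $s_\alpha$ exterior and $r_\alpha$ interior edges attached, and a right arc for each $\mathcal D_\beta$ with $m_\beta$ exterior and $n_\beta$ interior edges attached. $\mathbf T^{\mathbf 0,\mathbf 0;\mathbf 0,\mathbf 0}$ is the multimodule domain wall tube algebra. Gluing. For $T=f\otimes h\otimes q\otimes g\in\mathbf T^{\mathbf s,\mathbf r;\mathbf m,\mathbf n}$ (data $a,\tilde a,b,\tilde b,x,z,u,w,\mathbf c,\mathbf c',\mathbf e,\mathbf e'$) and $T_1=f_1\otimes h_1\otimes q_1\otimes g_1\in\mathbf T^{\mathbf r,\mathbf t;\mathbf n,\mathbf l}$ (data $a_1,\tilde a_1,b_1,\tilde b_1,x_1,z_1,u_1,w_1$, exterior labels $\mathbf c_1,\mathbf e_1$, interior labels $\mathbf c_1',\mathbf e_1'$), the product $TT_1\in\mathbf T^{\mathbf s,\mathbf t;\mathbf m,\mathbf l}$ is zero unless $z=x_1$, $u=w_1$, $\mathbf c'=\mathbf c_1$, $\mathbf e'=\mathbf e_1$, and otherwise is the sum over $k,\tilde k\in\mathrm{Irr}(\mathcal C)$, $j,\tilde j\in\mathrm{Irr}(\mathcal D)$ and dual bases ($\tau_p^*\tau_q=\delta_{pq}\mathrm{id}$)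 $\tau$ of $\mathrm{Hom}(k,a\otimes a_1)$, $\tilde\tau$ of $\mathrm{Hom}(\tilde k,\tilde a\otimes\tilde a_1)$, $\sigma$ of $\mathrm{Hom}(j,b_1\otimes b)$, $\tilde\sigma$ of $\mathrm{Hom}(\tilde j,\tilde b_1\otimes\tilde b)$ of $[(\tau^*\otimes\mathrm{id}\otimes\sigma^* )(\mathrm{id}_a\otimes f_1\otimes\mathrm{id}_b)f]\otimes[(\mathrm{id}_c\otimes\tilde\tau^* )(h\otimes\mathrm{id}_{\tilde a_1})(\mathrm{id}_a\otimes h_1)(\tau\otimes\mathrm{id}_{c_1'})]\otimes[(\tilde\sigma^*\otimes\mathrm{id}_e)(\mathrm{id}_{\tilde b_1}\otimes q)(q_1\otimes\mathrm{id}_b)(\mathrm{id}_{e_1'}\otimes\sigma)]\otimes[g(\mathrm{id}_{\tilde a}\otimes g_1\otimes\mathrm{id}_{\tilde b})(\tilde\tau\otimes\mathrm{id}\otimes\tilde\sigma)]$. This gluing gives the product of $\mathbf T^{\mathbf s,\mathbf s;\mathbf m,\mathbf m}$ (with unit the sum over all $x,u\in\mathrm{Irr}(\mathcal M)$ and all labels of identity elements with $a=\tilde a=\mathbb 1$, $b=\tilde b=\mathbb 1$) and the left and right actions on $\mathbf T^{\mathbf s,\mathbf r;\mathbf m,\mathbf n}$. *)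

(* Defs.v *)
From HB Require Import structures.
From mathcomp Require Import all_boot all_order all_algebra.
From mathcomp Require Import reals complex.

Set Implicit Arguments.
Unset Strict Implicit.
Unset Printing Implicit Defensive.

Import Order.TTheory GRing.Theory Num.Theory.
Local Open Scope ring_scope.

Reserved Notation "g ∘ f" (at level 40, left associativity).
Reserved Notation "F ⟦ f , g ⟧" (at level 9, format "F ⟦ f ,  g ⟧").

Section Tensor.
Variable K : fieldType.

Definition bilin (U V W : lmodType K) (f : U -> V -> W) : Prop :=
  (forall v, linear (f^~ v)) /\ (forall u, linear (f u)).

(* V ⊗ W in coordinates: M stands for the sum of the M i j *: (e_i ⊗ e'_j),
   for the bases e of V and e' of W chosen by [vbasis]. *)
Definition tensor (V W : vectType K) : vectType K :=
  'M[K]_(\dim {:V}, \dim {:W}).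

Definition pure (V W : vectType K) (v : V) (w : W) : tensor V W :=
  \matrix_(i, j) (coord (vbasis {:V}) i v * coord (vbasis {:W}) j w).

(* The linear map on V ⊗ W induced by a bilinear f; see [tlift_pure]. *)
Definition tlift (V W : vectType K) (U : lmodType K) (f : V -> W -> U)
    (t : tensor V W) : U :=
  \sum_i \sum_j t i j *: f (vbasis {:V})`_i (vbasis {:W})`_j.

Lemma pure_bilin V W : bilin (@pure V W).
Proof.
split=> [w|v] a x y; apply/matrixP=> i j; rewrite !mxE linearP /=.
  by rewrite mulrDl mulrA.
by rewrite mulrDr mulrCA.
Qed.

Lemma tlift_linear (V W : vectType K) (U : lmodType K) (f : V -> W -> U) :
  linear (tlift f).
Proof.
move=> a s t; rewrite /tlift scaler_sumr -big_split; apply: eq_bigr => i _ /=.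
rewrite scaler_sumr -big_split; apply: eq_bigr => j _ /=.
by rewrite !mxE scalerDl scalerA.
Qed.

Lemma lin_sum (U V : lmodType K) (f : U -> V) (J : Type) (r : seq J)
    (c : J -> K) (u : J -> U) : linear f ->
  f (\sum_(j <- r) c j *: u j) = \sum_(j <- r) c j *: f (u j).
Proof.
move=> lf; have f0 : f 0 = 0.
  have := lf 1 0 0; rewrite !scale1r !addr0 => /eqP.
  by rewrite -subr_eq0 opprD addrA subrr sub0r oppr_eq0 => /eqP.
by elim: r => [|j r IH]; rewrite ?big_nil ?f0 // !big_cons lf IH.
Qed.

Lemma vbasis_exp (V : vectType K) (v : V) :
  v = \sum_i coord (vbasis {:V}) i v *: (vbasis {:V})`_i.
Proof. exact/coord_vbasis/memvf. Qed.

Lemma tlift_pure (V W : vectType K) (U : lmodType K) (f : V -> W -> U) v w :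
  bilin f -> tlift f (pure v w) = f v w.
Proof.
case=> fl fr; rewrite {2}[v]vbasis_exp (lin_sum _ _ _ (fl w)).
apply: eq_bigr => i _; rewrite {2}[w]vbasis_exp (lin_sum _ _ _ (fr _)).
by rewrite scaler_sumr; apply: eq_bigr => j _; rewrite mxE scalerA.
Qed.

Lemma tensor_exp (V W : vectType K) (t : tensor V W) :
  t = \sum_i \sum_j t i j *: pure (vbasis {:V})`_i (vbasis {:W})`_j.
Proof.
apply/matrixP=> k l; rewrite summxE (bigD1 k) //= summxE (bigD1 l) //=.
have fV := basis_free (vbasisP {:V}); have fW := basis_free (vbasisP {:W}).
rewrite !mxE !coord_free ?size_tuple // !eqxx !mulr1.
rewrite big1 => [|j jl]; last first.
  by rewrite !mxE !coord_free ?size_tuple // (negPf jl) !mulr0.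
rewrite big1 => [|i ik]; first by rewrite !addr0.
rewrite summxE big1 // => j _.
by rewrite !mxE !coord_free ?size_tuple // (negPf ik) mul0r mulr0.
Qed.

Definition tensor4 (V1 V2 V3 V4 : vectType K) : vectType K :=
  tensor V1 (tensor V2 (tensor V3 V4)).

Definition pure4 (V1 V2 V3 V4 : vectType K) (v1 : V1) (v2 : V2) (v3 : V3)
    (v4 : V4) : tensor4 V1 V2 V3 V4 :=
  pure v1 (pure v2 (pure v3 v4)).

Definition tlift4 (V1 V2 V3 V4 : vectType K) (U : lmodType K)
    (f : V1 -> V2 -> V3 -> V4 -> U) : tensor4 V1 V2 V3 V4 -> U :=
  tlift (fun v1 => tlift (fun v2 => tlift (fun v3 v4 => f v1 v2 v3 v4))).

(* V / U, realised on a complement of U. *)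
Definition quotv (V : vectType K) (U : {vspace V}) : vectType K :=
  subvs_of U^C%VS.

Definition quot_pi (V : vectType K) (U : {vspace V}) (v : V) : quotv U :=
  vsproj U^C%VS (daddv_pi U^C U v).

Lemma quot_pi_linear (V : vectType K) (U : {vspace V}) : linear (quot_pi U).
Proof. by move=> a u v; rewrite /quot_pi !linearP. Qed.

Lemma quot_piK (V : vectType K) (U : {vspace V}) (q : quotv U) :
  quot_pi U (vsval q) = q.
Proof.
rewrite /quot_pi daddv_pi_id ?vsvalK ?subvsP //.
by rewrite capvC capv_compl.
Qed.

Lemma quot_pi_eq0 (V : vectType K) (U : {vspace V}) (v : V) :
  quot_pi U v = 0 <-> v \in U.
Proof.
have cap0 : (U^C :&: U = 0)%VS by rewrite capvC capv_compl.
have vD : daddv_pi U^C U v + daddv_pi U U^C v = v.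
  by rewrite daddv_pi_add // addvC addv_complf memvf.
split=> [/(congr1 vsval)|vU].
  by rewrite vsprojK ?memv_pi //= => p0; rewrite -vD p0 add0r memv_pi.
have pU : daddv_pi U^C U v \in (U^C :&: U)%VS.
  by rewrite memv_cap memv_pi /= -(rpredDr _ (memv_pi U U^C v)) vD.
by move: pU; rewrite cap0 memv0 /quot_pi => /eqP->; rewrite linear0.
Qed.

End Tensor.

Section DirectSum.
Variables (K : fieldType) (I : finType) (V : I -> vectType K).

Definition dsum := {dffun forall i, V i}.
HB.instance Definition _ := Choice.on dsum.

Definition dsum_of (f : forall i, V i) : dsum := [ffun i => f i].

Let add (u v : dsum) := dsum_of (fun i => u i + v i).
Let opp (u : dsum) := dsum_of (fun i => - u i).
Let zero := dsum_of (fun i => 0).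
Let scale a (u : dsum) := dsum_of (fun i => a *: u i).

Let addA : associative add.
Proof. by move=> u v w; apply/ffunP=> i; rewrite !ffunE addrA. Qed.
Let addC : commutative add.
Proof. by move=> u v; apply/ffunP=> i; rewrite !ffunE addrC. Qed.
Let add0 : left_id zero add.
Proof. by move=> u; apply/ffunP=> i; rewrite !ffunE add0r. Qed.
Let addN : left_inverse zero opp add.
Proof. by move=> u; apply/ffunP=> i; rewrite !ffunE addNr. Qed.
HB.instance Definition _ := GRing.isZmodule.Build dsum addA addC add0 addN.

Let scaleA a b v : scale a (scale b v) = scale (a * b) v.
Proof. by apply/ffunP=> i; rewrite !ffunE scalerA. Qed.
Let scale1 : left_id 1 scale.
Proof. by move=> u; apply/ffunP=> i; rewrite !ffunE scale1r. Qed.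
Let scaleDr : right_distributive scale +%R.
Proof. by move=> a u v; apply/ffunP=> i; rewrite !ffunE scalerDr. Qed.
Let scaleDl v : {morph scale^~ v : a b / a + b}.
Proof. by move=> a b; apply/ffunP=> i; rewrite !ffunE scalerDl. Qed.
HB.instance Definition _ :=
  GRing.Zmodule_isLmodule.Build K dsum scaleA scale1 scaleDr scaleDl.

Let idx : finType := {i : I & 'I_(\dim {:V i})}.

Fact dsum_vect_iso : Vector.axiom #|idx| dsum.
Proof.
exists (fun u : dsum => \row_k (coord (vbasis {:V (tag (enum_val k : idx))})
                  (tagged (enum_val k : idx)) (u (tag (enum_val k : idx))))).
  by move=> a u v; apply/rowP=> k; rewrite !mxE !ffunE linearP.
exists (fun r : 'rV_#|idx| => dsum_of (fun i => \sum_j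
   r 0 (enum_rank (existT (fun i => 'I_(\dim {:V i})) i j : idx))
   *: (vbasis {:V i})`_j)).
  move=> u; apply/ffunP=> i; rewrite ffunE [RHS]vbasis_exp.
  by apply: eq_bigr => j _; rewrite mxE enum_rankK.
move=> r; apply/rowP=> k; rewrite mxE ffunE -[in RHS](enum_valK k).
case: (enum_val k) => i j /=.
by rewrite coord_sum_free ?(basis_free (vbasisP _)).
Qed.
HB.instance Definition _ := Lmodule_hasFinDim.Build K dsum dsum_vect_iso.

Definition dsum_in (i : I) (v : V i) : dsum :=
  dsum_of (@dfwith I V (fun _ => 0) i v).

End DirectSum.

Section Algebra.
Variable K : fieldType.

(* Operations only; the axioms are [is_alg] and [is_bimod]. *)
Record alg := Alg {
  alg_car :> vectType K;
  amul : alg_car -> alg_car -> alg_car;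
  aone : alg_car }.

Definition is_alg (A : alg) : Prop :=
  [/\ bilin (@amul A), associative (@amul A),
      left_id (aone A) (@amul A) & right_id (aone A) (@amul A)].

Record bimod (A B : alg) := Bimod {
  bim_car :> vectType K;
  bact : A -> bim_car -> bim_car;
  bactr : bim_car -> B -> bim_car }.

Definition is_bimod (A B : alg) (M : bimod A B) : Prop :=
  [/\ bilin (@bact A B M) /\ bilin (@bactr A B M),
      (forall a a' (m : M), bact a (bact a' m) = bact (amul a a') m) /\
      (forall m : M, bact (aone A) m = m),
      (forall (m : M) b b', bactr (bactr m b) b' = bactr m (amul b b')) /\
      (forall m : M, bactr m (aone B) = m)
    & forall a (m : M) b, bactr (bact a m) b = bact a (bactr m b)].

Definition regular (A : alg) : bimod A A := Bimod (@amul A) (@amul A).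

Definition bimod_iso (A B : alg) (M N : bimod A B) : Prop :=
  exists phi : M -> N, [/\ linear phi, bijective phi,
    forall a m, phi (bact a m) = bact a (phi m)
  & forall m b, phi (bactr m b) = bactr (phi m) b].

Section BalancedTensor.
Variables (A B E : alg) (M : bimod A B) (N : bimod B E).

Definition brel (m : M) (b : B) (n : N) : tensor M N :=
  pure (bactr m b) n - pure m (bact b n).

(* The span of all [brel m b n]; see [brel_mem]. *)
Definition bspace : {vspace tensor M N} :=
  (\sum_(i < \dim {:M}) \sum_(j < \dim {:B}) \sum_(k < \dim {:N})
     <[brel (vbasis {:M})`_i (vbasis {:B})`_j (vbasis {:N})`_k]>)%VS.

Definition bpure (m : M) (n : N) : quotv bspace := quot_pi bspace (pure m n).

(* The tensor product of M and N over B; its actions are characterised by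
   [btens_bact] and [btens_bactr]. *)
Definition btens : bimod A E :=
  @Bimod A E (quotv bspace)
    (fun a q => quot_pi bspace
       (tlift (fun m n => pure (bact a m) n) (vsval q)))
    (fun q e => quot_pi bspace
       (tlift (fun m n => pure m (bactr n e)) (vsval q))).

Hypotheses (bM : is_bimod M) (bN : is_bimod N).

Lemma bspaceP (W : lmodType K) (f : tensor M N -> W) : linear f ->
  (forall m b n, f (brel m b n) = 0) -> forall t, t \in bspace -> f t = 0.
Proof.
move=> lf f0 t.
have fD x y : f (x + y) = f x + f y by have := lf 1 x y; rewrite !scale1r.
have f00 : f 0 = 0 by have /eqP := fD 0 0; rewrite addr0 -subr_eq subrr => /eqP.
have fS (J : finType) (U : J -> {vspace tensor M N}) :
    (forall j u, u \in U j -> f u = 0) ->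
    forall u, u \in (\sum_j U j)%VS -> f u = 0.
  move=> fU u /memv_sumP[v vU ->]; elim/big_ind: _ => // [x y fx fy | j _].
    by rewrite fD fx fy addr0.
  exact: fU (vU _ _).
apply: (fS) => i; apply: (fS) => j; apply: (fS) => k u /vlineP[c ->].
by have := lf c (brel (vbasis {:M})`_i (vbasis {:B})`_j (vbasis {:N})`_k) 0;
   rewrite !addr0 f0 f00 scaler0 addr0.
Qed.

Lemma brel_mem m b n : brel m b n \in bspace.
Proof.
case: bM => [[_ [rl rr]] _ _ _]; case: bN => [[[ll lr] _] _ _ _].
have [pl pr] := @pure_bilin K M N.
have relm b' n' : linear (fun m' => brel m' b' n').
  move=> c x y; rewrite /brel rl !(pl, rl) /= scalerBr opprD.
  by rewrite addrACA.
have relb m' n' : linear (fun b' => brel m' b' n').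
  move=> c x y; rewrite /brel rr ll pl pr scalerBr opprD.
  by rewrite addrACA.
have reln m' b' : linear (fun n' => brel m' b' n').
  move=> c x y; rewrite /brel lr !pr scalerBr opprD.
  by rewrite addrACA.
rewrite [m]vbasis_exp (lin_sum _ _ _ (relm _ _)) rpred_sum // => i _.
rewrite rpredZ // [b]vbasis_exp (lin_sum _ _ _ (relb _ _)) rpred_sum // => j _.
rewrite rpredZ // [n]vbasis_exp (lin_sum _ _ _ (reln _ _)) rpred_sum // => k _.
rewrite rpredZ //; apply: subvP (memv_line _).
apply: (subv_trans _ (sumv_sup i _ (subvv _))) => //.
apply: (subv_trans _ (sumv_sup j _ (subvv _))) => //.
exact: (sumv_sup k).
Qed.

Lemma bpure_bal m b n : bpure (bactr m b) n = bpure m (bact b n).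
Proof.
apply/eqP; rewrite -subr_eq0; apply/eqP.
have := quot_pi_linear bspace (-1) (pure m (bact b n)) (pure (bactr m b) n).
rewrite !scaleN1r addrC => <-; apply/quot_pi_eq0.
by rewrite addrC brel_mem.
Qed.

Lemma quot_lift_pi (f : tensor M N -> tensor M N) (t : tensor M N) :
  linear f -> (forall u, u \in bspace -> f u \in bspace) ->
  quot_pi bspace (f (vsval (quot_pi bspace t))) = quot_pi bspace (f t).
Proof.
move=> lf fU; apply/eqP; rewrite -subr_eq0; apply/eqP.
have H := quot_pi_linear bspace (-1).
rewrite addrC -scaleN1r -H -lf; apply/quot_pi_eq0/fU/quot_pi_eq0.
by rewrite H quot_piK scaleN1r addNr.
Qed.

Lemma btens_bact a m n : bact a (bpure m n : btens) = bpure (bact a m) n.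
Proof.
case: bM => [[[ll lr] _] _ _ lc]; have [pl pr] := @pure_bilin K M N.
have bf : bilin (fun (m : M) (n : N) => pure (bact a m) n).
  by split=> [n'|m'] c x y; rewrite ?lr ?pl ?pr.
rewrite /= quot_lift_pi ?tlift_pure //; first exact: tlift_linear.
move=> u; move: u; suff H : forall u, u \in bspace ->
    quot_pi bspace (tlift (fun m n => pure (bact a m) n) u) = 0.
  by move=> u /H/quot_pi_eq0.
apply: bspaceP => [c x y|m' b n'].
  by rewrite tlift_linear quot_pi_linear.
apply/quot_pi_eq0; rewrite /brel -scaleN1r addrC tlift_linear !tlift_pure //.
by rewrite -lc scaleN1r addrC brel_mem.
Qed.

Lemma btens_bactr m n e : bactr (bpure m n : btens) e = bpure m (bactr n e).
Proof.
case: bN => [[_ [rl rr]] _ _ lc]; have [pl pr] := @pure_bilin K M N.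
have bf : bilin (fun (m : M) (n : N) => pure m (bactr n e)).
  by split=> [n'|m'] c x y; rewrite ?rl ?pl ?pr.
rewrite /= quot_lift_pi ?tlift_pure //; first exact: tlift_linear.
move=> u; move: u; suff H : forall u, u \in bspace ->
    quot_pi bspace (tlift (fun m n => pure m (bactr n e)) u) = 0.
  by move=> u /H/quot_pi_eq0.
apply: bspaceP => [c x y|m' b n'].
  by rewrite tlift_linear quot_pi_linear.
apply/quot_pi_eq0; rewrite /brel -scaleN1r addrC tlift_linear !tlift_pure //.
by rewrite lc scaleN1r addrC brel_mem.
Qed.

End BalancedTensor.

(* Left modules, not necessarily finite-dimensional. *)
Record lmodule (A : alg) := LModule {
  lm_car :> lmodType K;
  lact : A -> lm_car -> lm_car;
  lact_bilin : bilin lact;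
  lactA : forall a b v, lact a (lact b v) = lact (amul a b) v;
  lact1 : forall v, lact (aone A) v = v }.

Record lmodhom (A : alg) (V W : lmodule A) := LModHom {
  lmh :> V -> W;
  lmh_linear : linear lmh;
  lmh_lact : forall a v, lmh (lact a v) = lact a (lmh v) }.

Record lmodfunctor (A B : alg) := LModFunctor {
  fun_ob :> lmodule A -> lmodule B;
  fun_hom : forall V W, lmodhom V W -> lmodhom (fun_ob V) (fun_ob W);
  fun_linear : forall V W c (f g h : lmodhom V W),
    (forall v, h v = c *: f v + g v) ->
    forall v, fun_hom h v = c *: fun_hom f v + fun_hom g v;
  fun_id : forall V (f : lmodhom V V), f =1 id -> fun_hom f =1 id;
  fun_comp : forall U V W (f : lmodhom V W) (g : lmodhom U V) (h : lmodhom U W),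
    h =1 f \o g -> fun_hom h =1 fun_hom f \o fun_hom g }.

(* G ∘ F is naturally isomorphic to the identity. *)
Definition retracts (A B : alg) (F : lmodfunctor A B) (G : lmodfunctor B A) :=
  exists eta : forall V, lmodhom (G (F V)) V,
    (forall V, bijective (eta V)) /\
    (forall V W (f : lmodhom V W) v,
       eta W (fun_hom G (fun_hom F f) v) = f (eta V v)).

(* K-linear equivalence of the categories of left modules. *)
Definition morita (A B : alg) : Prop :=
  exists (F : lmodfunctor A B) (G : lmodfunctor B A),
    retracts F G /\ retracts G F.

End Algebra.

Record cstarcat (R : realType) := CstarCat {
  ob :> Type;
  mor : ob -> ob -> vectType R[i];
  idm : forall x, mor x x;
  comp : forall x y z, mor y z -> mor x y -> mor x z;
  dag : forall x y, mor x y -> mor y x;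
  nrm : forall x y, mor x y -> R;
  comp_bilin : forall x y z, bilin (@comp x y z);
  compA : forall w x y z (h : mor y z) (g : mor x y) (f : mor w x),
    comp h (comp g f) = comp (comp h g) f;
  comp1m : forall x y (f : mor x y), comp (idm y) f = f;
  compm1 : forall x y (f : mor x y), comp f (idm x) = f;
  dagK : forall x y (f : mor x y), dag (dag f) = f;
  dag_antilinear : forall x y a (f g : mor x y),
    dag (a *: f + g) = a^* *: dag f + dag g;
  dag_comp : forall x y z (g : mor y z) (f : mor x y),
    dag (comp g f) = comp (dag f) (dag g);
  (* The norm is complete, the morphism spaces being finite-dimensional. *)
  nrm_ge0 : forall x y (f : mor x y), 0 <= nrm f;
  nrm_eq0 : forall x y (f : mor x y), nrm f = 0 -> f = 0;
  nrmD : forall x y (f g : mor x y), nrm (f + g) <= nrm f + nrm g;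
  nrmZ : forall x y a (f : mor x y), (nrm (a *: f))%:C%C = `|a| * (nrm f)%:C%C;
  nrm_comp : forall x y z (g : mor y z) (f : mor x y),
    nrm (comp g f) <= nrm g * nrm f;
  nrm_cstar : forall x y (f : mor x y), nrm (comp (dag f) f) = nrm f ^+ 2;
  dag_pos : forall x y (f : mor x y),
    exists g : mor x x, comp (dag f) f = comp (dag g) g }.

Arguments mor {R c} x y : rename.
Arguments idm {R c} x : rename.
Notation "g ∘ f" := (comp g f) : ring_scope.

Section CstarCat.
Variables (R : realType) (C : cstarcat R).

Definition isom (x y : C) (f : mor x y) (g : mor y x) : Prop :=
  g ∘ f = idm x /\ f ∘ g = idm y.

Definition unitary (x y : C) (u : mor x y) : Prop := isom u (dag u).

Definition simple (x : C) : Prop :=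
  idm x != 0 /\ forall f : mor x x, exists a, f = a *: idm x.

(* y is the orthogonal direct sum of the x p, with inclusions v p; for n = 0
   this says that y is a zero object. *)
Definition is_dirsum n (x : 'I_n -> C) (y : C) (v : forall p, mor (x p) y) :=
  [/\ forall p, dag (v p) ∘ v p = idm (x p),
      forall p q, p != q -> dag (v p) ∘ v q = 0
    & \sum_p v p ∘ dag (v p) = idm y].

Definition is_zero_ob (x : C) : Prop := idm x = 0.

End CstarCat.

(* Finitely semisimple unitary categories, with chosen representatives of the
   simple objects. *)
Record fscat (R : realType) := FsCat {
  fs_cat :> cstarcat R;
  fs_dirsum : forall n (x : 'I_n -> fs_cat), exists y v, @is_dirsum R fs_cat n x y v;
  fs_subob : forall (x : fs_cat) (p : mor x x), p ∘ p = p -> dag p = p ->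
    exists y (v : mor y x), dag v ∘ v = idm y /\ v ∘ dag v = p;
  irr : finType;
  irr_ob : irr -> fs_cat;
  irr_simple : forall i, simple (irr_ob i);
  irr_inj : forall i j (f : mor (irr_ob i) (irr_ob j)) g, isom f g -> i = j;
  irr_full : forall x : fs_cat, simple x ->
    exists i (f : mor (irr_ob i) x) g, isom f g;
  fs_semisimple : forall y : fs_cat,
    exists n (k : 'I_n -> irr) v, @is_dirsum R fs_cat n (irr_ob \o k) y v }.

(* Dual bases tau_p of Hom(k, x) and tau_p^* of Hom(x, k); the tau_p^* need not
   be the adjoints of the tau_p. *)
Record dual_basis (R : realType) (C : fscat R) (k : irr C) (x : C) := DualBasis {
  db_n : nat;
  db_in : 'I_db_n -> mor (irr_ob k) x;
  db_out : 'I_db_n -> mor x (irr_ob k);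
  db_basis : basis_of {:mor (irr_ob k) x} [seq db_in p | p : 'I_db_n];
  db_dual : forall p q, db_out p ∘ db_in q = (p == q)%:R *: idm (irr_ob k) }.

Record bifunctor (R : realType) (C D E : cstarcat R) := Bifunctor {
  bf_ob :> C -> D -> E;
  bf_mor : forall x x' y y', mor x x' -> mor y y' -> mor (bf_ob x y) (bf_ob x' y');
  bf_bilin : forall x x' y y', bilin (@bf_mor x x' y y');
  bf_id : forall x y, bf_mor (idm x) (idm y) = idm (bf_ob x y);
  bf_comp : forall x x' x'' y y' y'' (f' : mor x' x'') (f : mor x x')
      (g' : mor y' y'') (g : mor y y'),
    bf_mor (f' ∘ f) (g' ∘ g) = bf_mor f' g' ∘ bf_mor f g;
  bf_dag : forall x x' y y' (f : mor x x') (g : mor y y'),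
    bf_mor (dag f) (dag g) = dag (bf_mor f g) }.

Notation "F ⟦ f , g ⟧" := (bf_mor F f g) : ring_scope.

Record fuscat (R : realType) := FusCat {
  fu_cat :> fscat R;
  ten : bifunctor fu_cat fu_cat fu_cat;
  one : fu_cat;
  asc : forall x y z, mor (ten (ten x y) z) (ten x (ten y z));
  lun : forall x, mor (ten one x) x;
  run : forall x, mor (ten x one) x;
  asc_unitary : forall x y z, unitary (asc x y z);
  lun_unitary : forall x, unitary (lun x);
  run_unitary : forall x, unitary (run x);
  asc_nat : forall x x' y y' z z' (f : mor x x') (g : mor y y') (h : mor z z'),
    asc x' y' z' ∘ ten⟦ten⟦f, g⟧, h⟧ = ten⟦f, ten⟦g, h⟧⟧ ∘ asc x y z;
  lun_nat : forall x x' (f : mor x x'), lun x' ∘ ten⟦idm one, f⟧ = f ∘ lun x;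
  run_nat : forall x x' (f : mor x x'), run x' ∘ ten⟦f, idm one⟧ = f ∘ run x;
  pentagon : forall w x y z,
    asc w x (ten y z) ∘ asc (ten w x) y z =
    ten⟦idm w, asc x y z⟧ ∘ asc w (ten x y) z ∘ ten⟦asc w x y, idm z⟧;
  triangle : forall x y,
    ten⟦idm x, lun y⟧ ∘ asc x one y = ten⟦run x, idm y⟧;
  one_simple : simple one;
  (* Every x has a left dual y and a right dual z. *)
  rigid : forall x,
    (exists y (ev : mor (ten y x) one) (coev : mor one (ten x y)),
      run x ∘ ten⟦idm x, ev⟧ ∘ asc x y x ∘ ten⟦coev, idm x⟧ ∘ dag (lun x) = idm x /\
      lun y ∘ ten⟦ev, idm y⟧ ∘ dag (asc y x y) ∘ ten⟦idm y, coev⟧ ∘ dag (run y)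
        = idm y) /\
    (exists z (ev : mor (ten x z) one) (coev : mor one (ten z x)),
      run z ∘ ten⟦idm z, ev⟧ ∘ asc z x z ∘ ten⟦coev, idm z⟧ ∘ dag (lun z) = idm z /\
      lun x ∘ ten⟦ev, idm x⟧ ∘ dag (asc x z x) ∘ ten⟦idm x, coev⟧ ∘ dag (run x)
        = idm x);
  (* The unit object is only isomorphic to its representative in [irr]. *)
  irr1 : irr fu_cat;
  irr1_mor : mor one (irr_ob irr1);
  irr1_unitary : unitary irr1_mor }.

Arguments ten {R} f : rename.
Arguments one {R} f : rename.
Arguments asc {R f} x y z : rename.
Arguments lun {R f} x : rename.
Arguments run {R f} x : rename.
Arguments irr1 {R} f : rename.
Arguments irr1_mor {R} f : rename.

(* c_1 ⊗ (c_2 ⊗ ... ⊗ c_s), the unit object if s = 0. *)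
Fixpoint tenseq (R : realType) (C : fuscat R) (s : seq (irr C)) : C :=
  match s with
  | [::] => one C
  | [:: c] => irr_ob c
  | c :: s' => ten C (irr_ob c) (tenseq s')
  end.

Section Multilinear.
Variables (K : fieldType) (I : finType) (V : I -> vectType K) (W : lmodType K).

Definition multilinear (f : (forall i, V i) -> W) : Prop :=
  forall (v : forall i, V i) i a (x y : V i),
    f (dfwith v (a *: x + y)) = a *: f (dfwith v x) + f (dfwith v y).

End Multilinear.

(* C is the Deligne product of the Cs i: a monoidal multilinear *-functor
   [dl_ob] from the product of the Cs i to C, whose morphism spaces are the
   tensor products of those of the Cs i and whose objects generate C under
   finite direct sums. *)
Record deligne (R : realType) (I : finType) (Cs : I -> fuscat R)
    (C : fuscat R) := Deligne {
  dl_ob :> (forall i, Cs i) -> C;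
  dl_mor : forall x y, (forall i, mor (x i) (y i)) -> mor (dl_ob x) (dl_ob y);
  dl_multilinear : forall x y, multilinear (@dl_mor x y);
  dl_id : forall x, dl_mor (fun i => idm (x i)) = idm (dl_ob x);
  dl_comp : forall x y z (g : forall i, mor (y i) (z i))
      (f : forall i, mor (x i) (y i)),
    dl_mor (fun i => g i ∘ f i) = dl_mor g ∘ dl_mor f;
  dl_dag : forall x y (f : forall i, mor (x i) (y i)),
    dl_mor (fun i => dag (f i)) = dag (dl_mor f);
  dl_tensor : forall x y (W : vectType R[i])
      (phi : (forall i, mor (x i) (y i)) -> W), multilinear phi ->
    exists! psi : 'Hom(mor (dl_ob x) (dl_ob y), W),
      forall f, phi f = psi (dl_mor f);
  dl_generate : forall c, exists n (x : 'I_n -> forall i, Cs i) v,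
    @is_dirsum R C n (fun p => dl_ob (x p)) c v;
  dl_mul : forall x y,
    mor (ten C (dl_ob x) (dl_ob y)) (dl_ob (fun i => ten (Cs i) (x i) (y i)));
  dl_one : mor (one C) (dl_ob (fun i => one (Cs i)));
  dl_mul_unitary : forall x y, unitary (dl_mul x y);
  dl_one_unitary : unitary dl_one;
  dl_mul_nat : forall x x' y y' (f : forall i, mor (x i) (x' i))
      (g : forall i, mor (y i) (y' i)),
    dl_mul x' y' ∘ (ten C)⟦dl_mor f, dl_mor g⟧ =
    dl_mor (fun i => (ten (Cs i))⟦f i, g i⟧) ∘ dl_mul x y;
  dl_mul_asc : forall x y z,
    dl_mul x (fun i => ten (Cs i) (y i) (z i)) ∘
      (ten C)⟦idm (dl_ob x), dl_mul y z⟧ ∘ asc (dl_ob x) (dl_ob y) (dl_ob z) =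
    dl_mor (fun i => asc (x i) (y i) (z i)) ∘
      dl_mul (fun i => ten (Cs i) (x i) (y i)) z ∘
      (ten C)⟦dl_mul x y, idm (dl_ob z)⟧;
  dl_mul_lun : forall x,
    dl_mor (fun i => lun (x i)) ∘ dl_mul (fun i => one (Cs i)) x ∘
      (ten C)⟦dl_one, idm (dl_ob x)⟧ = lun (dl_ob x);
  dl_mul_run : forall x,
    dl_mor (fun i => run (x i)) ∘ dl_mul x (fun i => one (Cs i)) ∘
      (ten C)⟦idm (dl_ob x), dl_one⟧ = run (dl_ob x) }.

(* A multimodule category for families Cs, Ds is a bimodule category over their
   Deligne products C, D. *)
Record bimodcat (R : realType) (C D : fuscat R) := BimodCat {
  bm_cat :> fscat R;
  la : bifunctor C bm_cat bm_cat;
  ra : bifunctor bm_cat D bm_cat;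
  lasc : forall a b m, mor (la (ten C a b) m) (la a (la b m));
  llun : forall m, mor (la (one C) m) m;
  rasc : forall m d e, mor (ra (ra m d) e) (ra m (ten D d e));
  rrun : forall m, mor (ra m (one D)) m;
  masc : forall a m d, mor (ra (la a m) d) (la a (ra m d));
  lasc_unitary : forall a b m, unitary (lasc a b m);
  llun_unitary : forall m, unitary (llun m);
  rasc_unitary : forall m d e, unitary (rasc m d e);
  rrun_unitary : forall m, unitary (rrun m);
  masc_unitary : forall a m d, unitary (masc a m d);
  lasc_nat : forall a a' b b' m m' (f : mor a a') (g : mor b b') (h : mor m m'),
    lasc a' b' m' ∘ la⟦(ten C)⟦f, g⟧, h⟧ = la⟦f, la⟦g, h⟧⟧ ∘ lasc a b m;
  llun_nat : forall m m' (h : mor m m'), llun m' ∘ la⟦idm (one C), h⟧ = h ∘ llun m;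
  rasc_nat : forall m m' d d' e e' (h : mor m m') (f : mor d d') (g : mor e e'),
    rasc m' d' e' ∘ ra⟦ra⟦h, f⟧, g⟧ = ra⟦h, (ten D)⟦f, g⟧⟧ ∘ rasc m d e;
  rrun_nat : forall m m' (h : mor m m'), rrun m' ∘ ra⟦h, idm (one D)⟧ = h ∘ rrun m;
  masc_nat : forall a a' m m' d d' (f : mor a a') (h : mor m m') (g : mor d d'),
    masc a' m' d' ∘ ra⟦la⟦f, h⟧, g⟧ = la⟦f, ra⟦h, g⟧⟧ ∘ masc a m d;
  lpentagon : forall a b c m,
    lasc a b (la c m) ∘ lasc (ten C a b) c m =
    la⟦idm a, lasc b c m⟧ ∘ lasc a (ten C b c) m ∘ la⟦asc a b c, idm m⟧;
  ltriangle : forall a m,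
    la⟦idm a, llun m⟧ ∘ lasc a (one C) m = la⟦run a, idm m⟧;
  rpentagon : forall m d e f,
    rasc m d (ten D e f) ∘ rasc (ra m d) e f =
    ra⟦idm m, asc d e f⟧ ∘ rasc m (ten D d e) f ∘ ra⟦rasc m d e, idm f⟧;
  rtriangle : forall m d,
    ra⟦idm m, lun d⟧ ∘ rasc m (one D) d = ra⟦rrun m, idm d⟧;
  mpentagonl : forall a b m d,
    la⟦idm a, masc b m d⟧ ∘ masc a (la b m) d ∘ ra⟦lasc a b m, idm d⟧ =
    lasc a b (ra m d) ∘ masc (ten C a b) m d;
  mpentagonr : forall a m d e,
    la⟦idm a, rasc m d e⟧ ∘ masc a (ra m d) e ∘ ra⟦masc a m d, idm e⟧ =
    masc a m (ten D d e) ∘ rasc (la a m) d e;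
  mtrianglel : forall m d, llun (ra m d) ∘ masc (one C) m d = ra⟦llun m, idm d⟧;
  mtriangler : forall a m, la⟦idm a, rrun m⟧ ∘ masc a m (one D) = rrun (la a m) }.

Arguments la {R C D} b : rename.
Arguments ra {R C D} b : rename.
Arguments lasc {R C D b} a b0 m : rename.
Arguments llun {R C D b} m : rename.
Arguments rasc {R C D b} m d e : rename.
Arguments rrun {R C D b} m : rename.
Arguments masc {R C D b} a m d : rename.

(* M is nonzero, and is not the direct sum of two nonzero full subcategories
   closed under both actions. *)
Definition indecomposable (R : realType) (C D : fuscat R) (M : bimodcat C D) : Prop :=
  (exists m : M, ~ is_zero_ob m) /\
  forall P : bool -> M -> Prop,
    (forall i m m' (f : mor m m') g, isom f g -> P i m -> P i m') ->
    (forall i a m, P i m -> P i (la M a m)) ->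
    (forall i m d, P i m -> P i (ra M m d)) ->
    (forall i j m m' (f : mor m m'), P i m -> P j m' -> i != j -> f = 0) ->
    (forall m, exists (x : 'I_2 -> M) v,
       [/\ P false (x ord0), P true (x ord_max) & @is_dirsum R M 2 x m v]) ->
  exists i, forall m, P i m -> is_zero_ob m.

Section Tube.
Variables (R : realType) (I J : finType).
Variables (Cs : I -> fuscat R) (Ds : J -> fuscat R) (C D : fuscat R).
Variables (PC : deligne Cs C) (PD : deligne Ds D) (M : bimodcat C D).
Variable dbC : forall (k : irr C) (x : C), dual_basis k x.
Variable dbD : forall (k : irr D) (x : D), dual_basis k x.

Local Notation "a ⊗ b" := (ten _ a b) (at level 38, left associativity).
Local Notation "a ⊳ m" := (la M a m) (at level 37, right associativity).
Local Notation "m ⊲ b" := (ra M m b) (at level 39, left associativity).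
Local Notation id := idm.

Definition label (S : finType) (Es : S -> fuscat R) (s : S -> nat) : finType :=
  {dffun forall i, (s i).-tuple (irr (Es i))}.

Definition label_ob (S : finType) (Es : S -> fuscat R) (E : fuscat R)
    (P : deligne Es E) (s : S -> nat) (c : label Es s) : E :=
  P (fun i => tenseq (c i)).

(* Boundary data (x, w, c, e) of one of the two circles of the annulus: the
   two wall labels and the labels of the edges. *)
Definition bdry (s : I -> nat) (m : J -> nat) : finType :=
  (irr M * irr M * label Cs s * label Ds m)%type.

Section Boundary.
Variables (s : I -> nat) (m : J -> nat) (p : bdry s m).
Definition wall1 : M := irr_ob p.1.1.1.
Definition wall2 : M := irr_ob p.1.1.2.
Definition edgeC : C := label_ob PC p.1.2.
Definition edgeD : D := label_ob PD p.2.
End Boundary.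

(* The labels (a, ã, b, b̃) of the arcs. *)
Definition arcs : finType := (irr C * irr C * irr D * irr D)%type.
Definition arcL1 (k : arcs) : C := irr_ob k.1.1.1.
Definition arcL2 (k : arcs) : C := irr_ob k.1.1.2.
Definition arcR1 (k : arcs) : D := irr_ob k.1.2.
Definition arcR2 (k : arcs) : D := irr_ob k.2.

Section Summand.
Variables (s r : I -> nat) (m n : J -> nat).
Variables (p : bdry s m) (q : bdry r n) (k : arcs).

Definition hom1 := mor (wall1 p) ((arcL1 k ⊳ wall1 q) ⊲ arcR1 k).
Definition hom2 := mor (arcL1 k ⊗ edgeC q) (edgeC p ⊗ arcL2 k).
Definition hom3 := mor (edgeD q ⊗ arcR1 k) (arcR2 k ⊗ edgeD p).
Definition hom4 := mor ((arcL2 k ⊳ wall2 q) ⊲ arcR2 k) (wall2 p).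

Definition summand : vectType R[i] := tensor4 hom1 hom2 hom3 hom4.
End Summand.

(* The tube space: p is the exterior and q the interior boundary. *)
Definition tube (s r : I -> nat) (m n : J -> nat) : vectType R[i] :=
  dsum (fun i : bdry s m * bdry r n * arcs => summand i.1.1 i.1.2 i.2).

(* The coherence isomorphism a ⊗ (a' ⊗ z ⊗ b') ⊗ b = (a ⊗ a') ⊗ z ⊗ (b' ⊗ b). *)
Definition nest (a a' : C) (z : M) (b' b : D) :
    mor ((a ⊳ ((a' ⊳ z) ⊲ b')) ⊲ b) (((a ⊗ a') ⊳ z) ⊲ (b' ⊗ b)) :=
  rasc _ _ _ ∘
  (ra M)⟦(ra M)⟦dag (lasc a a' z), id b'⟧ ∘ dag (masc a (a' ⊳ z) b'), id b⟧.

Section GluePure.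
Variables (s r t : I -> nat) (m n l : J -> nat).
Variables (P : bdry s m) (O : bdry r n) (Q : bdry t l) (k k1 kout : arcs).
Variables (f : hom1 P O k) (h : hom2 P O k) (q : hom3 P O k) (g : hom4 P O k).
Variables (f1 : hom1 O Q k1) (h1 : hom2 O Q k1) (q1 : hom3 O Q k1)
  (g1 : hom4 O Q k1).

Local Notation a := (arcL1 k).
Local Notation a' := (arcL2 k).
Local Notation b := (arcR1 k).
Local Notation b' := (arcR2 k).
Local Notation a1 := (arcL1 k1).
Local Notation a1' := (arcL2 k1).
Local Notation b1 := (arcR1 k1).
Local Notation b1' := (arcR2 k1).

Let tau := dbC kout.1.1.1 (a ⊗ a1).
Let tau' := dbC kout.1.1.2 (a' ⊗ a1').
Let sigma := dbD kout.1.2 (b1 ⊗ b).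
Let sigma' := dbD kout.2 (b1' ⊗ b').

(* The component with arc labels [kout] of the product of f ⊗ h ⊗ q ⊗ g and
   f1 ⊗ h1 ⊗ q1 ⊗ g1; primes stand for tildes. *)
Definition glue_pure : summand P Q kout :=
  \sum_(i < db_n tau) \sum_(i' < db_n tau')
  \sum_(j < db_n sigma) \sum_(j' < db_n sigma')
    pure4
      ((ra M)⟦(la M)⟦db_out i, id (wall1 Q)⟧, db_out j⟧ ∘
         nest a a1 (wall1 Q) b1 b ∘ (ra M)⟦(la M)⟦id a, f1⟧, id b⟧ ∘ f
        : hom1 P Q kout)
      ((ten C)⟦id (edgeC P), db_out i'⟧ ∘ asc (edgeC P) a' a1' ∘
         (ten C)⟦h, id a1'⟧ ∘ dag (asc a (edgeC O) a1') ∘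
         (ten C)⟦id a, h1⟧ ∘ asc a a1 (edgeC Q) ∘
         (ten C)⟦db_in i, id (edgeC Q)⟧
        : hom2 P Q kout)
      ((ten D)⟦db_out j', id (edgeD P)⟧ ∘ dag (asc b1' b' (edgeD P)) ∘
         (ten D)⟦id b1', q⟧ ∘ asc b1' (edgeD O) b ∘
         (ten D)⟦q1, id b⟧ ∘ dag (asc (edgeD Q) b1 b) ∘
         (ten D)⟦id (edgeD Q), db_in j⟧
        : hom3 P Q kout)
      (g ∘ (ra M)⟦(la M)⟦id a', g1⟧, id b'⟧ ∘
         dag (nest a' a1' (wall2 Q) b1' b') ∘
         (ra M)⟦(la M)⟦db_in i', id (wall2 Q)⟧, db_in j'⟧
        : hom4 P Q kout).

End GluePure.

Definition glue_summand (s r t : I -> nat) (m n l : J -> nat)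
    (P : bdry s m) (O : bdry r n) (Q : bdry t l) (k k1 kout : arcs)
    (T : summand P O k) (T1 : summand O Q k1) : summand P Q kout :=
  tlift4 (fun (f : hom1 P O k) (h : hom2 P O k) (q : hom3 P O k)
              (g : hom4 P O k) =>
    tlift4 (fun (f1 : hom1 O Q k1) (h1 : hom2 O Q k1) (q1 : hom3 O Q k1)
                (g1 : hom4 O Q k1) =>
      glue_pure kout f h q g f1 h1 q1 g1) T1) T.

(* T is the outer and T1 the inner annulus; only summands whose labels agree
   on the common circle O are composable. *)
Definition glue (s r t : I -> nat) (m n l : J -> nat)
    (T : tube s r m n) (T1 : tube r t n l) : tube s t m l :=
  dsum_of (fun i : bdry s m * bdry t l * arcs =>
    \sum_(O : bdry r n) \sum_(k : arcs) \sum_(k1 : arcs)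
      @glue_summand s r t m n l i.1.1 O i.1.2 k k1 i.2
        (T (i.1.1, O, k)) (T1 (O, i.1.2, k1))).

Definition arcs1 : arcs := (irr1 C, irr1 C, irr1 D, irr1 D).

Definition tube_id (s : I -> nat) (m : J -> nat) (P : bdry s m) :
    summand P P arcs1 :=
  pure4
    ((ra M)⟦(la M)⟦irr1_mor C, id (wall1 P)⟧, irr1_mor D⟧ ∘
       dag (rrun (one C ⊳ wall1 P)) ∘ dag (llun (wall1 P))
      : hom1 P P arcs1)
    ((ten C)⟦id (edgeC P), irr1_mor C⟧ ∘ dag (run (edgeC P)) ∘
       lun (edgeC P) ∘ (ten C)⟦dag (irr1_mor C), id (edgeC P)⟧
      : hom2 P P arcs1)
    ((ten D)⟦irr1_mor D, id (edgeD P)⟧ ∘ dag (lun (edgeD P)) ∘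
       run (edgeD P) ∘ (ten D)⟦id (edgeD P), dag (irr1_mor D)⟧
      : hom3 P P arcs1)
    (llun (wall2 P) ∘ rrun (one C ⊳ wall2 P) ∘
       (ra M)⟦(la M)⟦dag (irr1_mor C), id (wall2 P)⟧, dag (irr1_mor D)⟧
      : hom4 P P arcs1).

Definition tube_alg (s : I -> nat) (m : J -> nat) : alg R[i] :=
  @Alg _ (tube s s m m) (@glue s s s m m m)
    (\sum_(P : bdry s m)
       dsum_in (V := fun i : bdry s m * bdry s m * arcs => summand i.1.1 i.1.2 i.2)
         (i := (P, P, arcs1)) (tube_id P)).

Definition tube_bimod (s r : I -> nat) (m n : J -> nat) :
    bimod (tube_alg s m) (tube_alg r n) :=
  @Bimod _ (tube_alg s m) (tube_alg r n) (tube s r m n)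
    (@glue s s r m m n) (@glue s r r m n n).

End Tube.

(* Main.v *)
(* An annulus has four Hom factors, glued along arcs labelled by simple objects.
   Allowing arbitrary objects a, a' of C and b, b' of D on the arcs, every quadruple
   (f, h, q, g) still defines an element of the tube space, by expanding in
   dual bases, and this element is dinatural in a, a', b, b'.  The product
   becomes (f, h, q, g)(f1, h1, q1, g1) = (f f1, h h1, q q1, g g1) with tensored
   arc labels and no sum, so that associativity and the unit laws reduce to
   coherence in C, D and M.  By rigidity an edge c can be bent onto the wall:
   (x, w, c, e) is a retract of a sum of boundaries (x, w', 1, 1) with w' the
   simple summands of c w e.  As unit labels exist for every number of edges,
   the unit of each tube algebra is a sum of products of elements of any two
   opposite tube spaces, and such a Morita context is an equivalence. *)
From HB Require Import structures.
From mathcomp Require Import all_boot all_order all_algebra.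
From mathcomp Require Import reals complex.
From Stdlib Require Import FunctionalExtensionality.
Require Import Defs.

Set Implicit Arguments.
Unset Strict Implicit.
Unset Printing Implicit Defensive.

Import Order.TTheory GRing.Theory Num.Theory.
Local Open Scope ring_scope.

(** * Coherence in a module category *)

(** A right action of D is a left action of D with reversed tensor product, so M becomes a left
    module over the product of C and reversed D. The coherence identities for the wall factors f and
    g then involve a single action, and those for q are the ones for h read in reversed D. The
    product of categories meant here is the cartesian one, whose morphisms are pairs. This is why
    the coherence part lives in bare categories [precat], without linear structure or adjoints, and
    carries the inverses of associators and unitors as data. Linearity enters when arcs are expanded
    in dual bases. A dual basis consists of a basis of Hom(k, x) and a dual family in Hom(x, k);
    that this family spans Hom(x, k) has to be extracted from the positivity of the adjoint, and
    both the dinaturality and the completeness relation rest on it. Finally, the tube space is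
    treated as a matrix whose rows and columns are the labels of the two boundary circles and whose
    entries are spaces of annuli. Gluing is then matrix multiplication, and only the gluing of two
    annuli with fixed boundaries has to be studied. *)

Record precat := PreCat {
  pob :> Type;
  phom : pob -> pob -> Type;
  pid : forall x, phom x x;
  pcomp : forall x y z, phom y z -> phom x y -> phom x z;
  pcompA : forall w x y z (h : phom y z) (g : phom x y) (f : phom w x),
    pcomp h (pcomp g f) = pcomp (pcomp h g) f;
  pcomp1f : forall x y (f : phom x y), pcomp (pid y) f = f;
  pcompf1 : forall x y (f : phom x y), pcomp f (pid x) = f }.

Arguments phom {p} x y : rename.
Arguments pid {p} x : rename.
Local Notation "g \o' f" := (pcomp g f) (at level 40, left associativity).

Record prefun (X Y Z : precat) := PreFun {
  pf_ob :> X -> Y -> Z;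
  pf_hom : forall x x' y y', phom x x' -> phom y y' -> phom (pf_ob x y) (pf_ob x' y');
  pf_id : forall x y, pf_hom (pid x) (pid y) = pid (pf_ob x y);
  pf_comp : forall x x' x'' y y' y'' (f' : phom x' x'') (f : phom x x')
      (g' : phom y' y'') (g : phom y y'),
    pf_hom (f' \o' f) (g' \o' g) = pf_hom f' g' \o' pf_hom f g }.

Local Notation "F ⟪ f , g ⟫" := (pf_hom F f g) (at level 9, format "F ⟪ f ,  g ⟫").

Record moncat := MonCat {
  mo_cat :> precat;
  mten : prefun mo_cat mo_cat mo_cat;
  mone : mo_cat;
  mas : forall x y z, phom (mten (mten x y) z) (mten x (mten y z));
  masV : forall x y z, phom (mten x (mten y z)) (mten (mten x y) z);
  mlu : forall x, phom (mten mone x) x;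
  mluV : forall x, phom x (mten mone x);
  mru : forall x, phom (mten x mone) x;
  mruV : forall x, phom x (mten x mone);
  masK : forall x y z, masV x y z \o' mas x y z = pid _;
  masVK : forall x y z, mas x y z \o' masV x y z = pid _;
  mluK : forall x, mluV x \o' mlu x = pid _;
  mluVK : forall x, mlu x \o' mluV x = pid _;
  mruK : forall x, mruV x \o' mru x = pid _;
  mruVK : forall x, mru x \o' mruV x = pid _;
  mas_nat : forall x x' y y' z z' (f : phom x x') (g : phom y y') (h : phom z z'),
    mas x' y' z' \o' mten⟪mten⟪f, g⟫, h⟫ = mten⟪f, mten⟪g, h⟫⟫ \o' mas x y z;
  mlu_nat : forall x x' (f : phom x x'), mlu x' \o' mten⟪pid mone, f⟫ = f \o' mlu x;
  mru_nat : forall x x' (f : phom x x'), mru x' \o' mten⟪f, pid mone⟫ = f \o' mru x;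
  mpenta : forall w x y z,
    mas w x (mten y z) \o' mas (mten w x) y z =
    mten⟪pid w, mas x y z⟫ \o' mas w (mten x y) z \o' mten⟪mas w x y, pid z⟫;
  mtria : forall x y, mten⟪pid x, mlu y⟫ \o' mas x mone y = mten⟪mru x, pid y⟫ }.

Arguments mten {m} : rename.
Arguments mone {m} : rename.
Arguments mas {m} x y z : rename.
Arguments masV {m} x y z : rename.
Arguments mlu {m} x : rename.
Arguments mluV {m} x : rename.
Arguments mru {m} x : rename.
Arguments mruV {m} x : rename.

Record modcat (E : moncat) := ModCat {
  md_cat :> precat;
  mact : prefun E md_cat md_cat;
  aas : forall a b m, phom (mact (mten a b) m) (mact a (mact b m));
  aasV : forall a b m, phom (mact a (mact b m)) (mact (mten a b) m);
  alu : forall m, phom (mact mone m) m;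
  aluV : forall m, phom m (mact mone m);
  aasK : forall a b m, aasV a b m \o' aas a b m = pid _;
  aasVK : forall a b m, aas a b m \o' aasV a b m = pid _;
  aluK : forall m, aluV m \o' alu m = pid _;
  aluVK : forall m, alu m \o' aluV m = pid _;
  aas_nat : forall a a' b b' m m' (f : phom a a') (g : phom b b') (h : phom m m'),
    aas a' b' m' \o' mact⟪mten⟪f, g⟫, h⟫ = mact⟪f, mact⟪g, h⟫⟫ \o' aas a b m;
  alu_nat : forall m m' (h : phom m m'), alu m' \o' mact⟪pid mone, h⟫ = h \o' alu m;
  apenta : forall a b c m,
    aas a b (mact c m) \o' aas (mten a b) c m =
    mact⟪pid a, aas b c m⟫ \o' aas a (mten b c) m \o' mact⟪mas a b c, pid m⟫;
  atria : forall a m, mact⟪pid a, alu m⟫ \o' aas a mone m = mact⟪mru a, pid m⟫ }.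

Arguments mact {E m} : rename.
Arguments aas {E m} a b m0 : rename.
Arguments aasV {E m} a b m0 : rename.
Arguments alu {E m} m0 : rename.
Arguments aluV {E m} m0 : rename.

Section Compose.
Variable C : precat.

(** Composites are kept right-nested by [-!pcompA]; in this form an equation between two-fold
    composites applies at the head of a longer one. *)
Lemma pcompr (x y z : C) (g : phom y z) (f : phom x y) h :
  g \o' f = h -> forall w (k : phom w x), g \o' (f \o' k) = h \o' k.
Proof. by move=> <- w k; rewrite pcompA. Qed.

Lemma pcompr3 (x y z y' z' : C) (a : phom y z) (b : phom x y) (c : phom z' z)
    (d : phom y' z') (e : phom x y') :
  a \o' b = c \o' d \o' e ->
  forall w (k : phom w x), c \o' (d \o' (e \o' k)) = a \o' (b \o' k).
Proof. by move=> p w k; rewrite !pcompA p. Qed.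

Lemma pcomp_mid (v w x y z : C) (a : phom y z) (b : phom x y) (c : phom w x)
    (d : phom v w) : a \o' b \o' (c \o' d) = a \o' (b \o' c \o' d).
Proof. by rewrite -!pcompA. Qed.

Lemma epi_split (x y z : C) (e : phom x y) (s : phom y x) (f g : phom y z) :
  e \o' s = pid y -> f \o' e = g \o' e -> f = g.
Proof. by move=> es fg; rewrite -[f]pcompf1 -[g]pcompf1 -es !pcompA fg. Qed.

Lemma mono_split (x y z : C) (m : phom y z) (r : phom z y) (f g : phom x y) :
  r \o' m = pid y -> m \o' f = m \o' g -> f = g.
Proof. by move=> rm fg; rewrite -[f]pcomp1f -[g]pcomp1f -rm -!pcompA fg. Qed.

Lemma inv_uniq (x y : C) (p : phom x y) (l r : phom y x) :
  r \o' p = pid x -> p \o' l = pid y -> r = l.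
Proof. by move=> rp pl; rewrite -[r]pcompf1 -pl pcompA rp pcomp1f. Qed.

End Compose.

Section Functor.
Variables (X Y Z : precat) (F : prefun X Y Z).

Lemma pf_split x x' y y' (f : phom x x') (g : phom y y') :
  F⟪f, pid y'⟫ \o' F⟪pid x, g⟫ = F⟪f, g⟫.
Proof. by rewrite -pf_comp pcompf1 pcomp1f. Qed.

Lemma pf_splitV x x' y y' (f : phom x x') (g : phom y y') :
  F⟪pid x', g⟫ \o' F⟪f, pid y⟫ = F⟪f, g⟫.
Proof. by rewrite -pf_comp pcompf1 pcomp1f. Qed.

Lemma pf_compl x x' x'' y (f' : phom x' x'') (f : phom x x') :
  F⟪f' \o' f, pid y⟫ = F⟪f', pid y⟫ \o' F⟪f, pid y⟫.
Proof. by rewrite -pf_comp pcomp1f. Qed.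

Lemma pf_compr x y y' y'' (f' : phom y' y'') (f : phom y y') :
  F⟪pid x, f' \o' f⟫ = F⟪pid x, f'⟫ \o' F⟪pid x, f⟫.
Proof. by rewrite -pf_comp pcomp1f. Qed.

Lemma pf_swap x x' y y' (f : phom x x') (g : phom y y') :
  F⟪f, pid y'⟫ \o' F⟪pid x, g⟫ = F⟪pid x', g⟫ \o' F⟪f, pid y⟫.
Proof. by rewrite pf_split pf_splitV. Qed.

End Functor.

Section ModuleUnit.
Variables (E : moncat) (M : modcat E).

(** Naturality of the invertible [alu] recovers a morphism from its image under the action of the
    unit. *)
Lemma alu_faithful (m m' : M) (f g : phom m m') :
  mact⟪pid mone, f⟫ = mact⟪pid mone, g⟫ -> f = g.
Proof.
move=> fg; apply: (epi_split (aluVK m)).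
by rewrite -!alu_nat fg.
Qed.

(* Kelly: this triangle follows from the other one and the pentagon. *)
Lemma alu_aas (a : E) (m : M) : alu (mact a m) \o' aas mone a m = mact⟪mlu a, pid m⟫.
Proof.
apply: alu_faithful; rewrite pf_compr.
have e : mact⟪mas mone mone a, pid m⟫ \o' mact⟪masV mone mone a, pid m⟫ = pid _.
  by rewrite -pf_compl masVK pf_id.
apply: (epi_split (aasVK mone (mten mone a) m)); apply: (epi_split e).
have := apenta mone mone a m; rewrite -!pcompA => p.
rewrite -p pcompA atria -(pf_id mact a m) -(aas_nat (mru mone) (pid a) (pid m)).
by rewrite pcompA -aas_nat -!pcompA -pf_compl mtria.
Qed.

End ModuleUnit.

Section Regular.
Variable E : moncat.

(** E acting on itself, so that a law proved for modules, such as [alu_aas], specialises to E. *)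
Definition regmod : modcat E :=
  @ModCat E E mten mas masV mlu mluV (@masK E) (@masVK E) (@mluK E) (@mluVK E)
    (@mas_nat E) (@mlu_nat E) (@mpenta E) (@mtria E).

Lemma mlu_mas (x y : E) : mlu (mten x y) \o' mas mone x y = mten⟪mlu x, pid y⟫.
Proof. exact: (@alu_aas E regmod). Qed.

End Regular.

Section Reverse.
Variable E : moncat.

Definition revten : prefun E E E :=
  @PreFun E E E (fun x y => mten y x) (fun x x' y y' f g => mten⟪g, f⟫)
    (fun x y => pf_id mten y x) (fun x x' x'' y y' y'' f' f g' g => pf_comp mten g' g f' f).

Lemma inv_nat (C : precat) (x y x' y' : C) (i : phom x y) (i' : phom y x)
    (j : phom x' y') (j' : phom y' x') (f : phom x x') (g : phom y y') :
  i \o' i' = pid _ -> j' \o' j = pid _ -> j \o' f = g \o' i -> j' \o' g = f \o' i'.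
Proof.
move=> ii jj e.
by rewrite -[g]pcompf1 -ii (pcompA g) -e !pcompA jj pcomp1f.
Qed.

Lemma masV_nat x x' y y' z z' (f : phom x x') (g : phom y y') (h : phom z z') :
  masV x' y' z' \o' mten⟪f, mten⟪g, h⟫⟫ = mten⟪mten⟪f, g⟫, h⟫ \o' masV x y z :> phom _ (_ : E).
Proof. by apply: inv_nat (masVK _ _ _) (masK _ _ _) _; rewrite mas_nat. Qed.

Lemma masV_penta (w x y z : E) :
  masV (mten w x) y z \o' masV w x (mten y z) =
  mten⟪masV w x y, pid z⟫ \o' masV w (mten x y) z \o' mten⟪pid w, masV x y z⟫.
Proof.
have k : (masV (mten w x) y z \o' masV w x (mten y z)) \o'
  (mas w x (mten y z) \o' mas (mten w x) y z) = pid _.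
  by rewrite -!pcompA (pcompr (masK _ _ _)) pcomp1f masK.
have e : mten⟪masV w x y, pid z⟫ \o' masV w (mten x y) z \o' mten⟪pid w, masV x y z⟫ \o'
  (mas w x (mten y z) \o' mas (mten w x) y z) = pid _.
  rewrite mpenta -!pcompA (pcompr (esym (pf_compr _ _ _ _))) masK pf_id pcomp1f.
  by rewrite (pcompr (masK _ _ _)) pcomp1f -pf_compl masK pf_id.
apply: (@epi_split _ _ _ _ (mas w x (mten y z) \o' mas (mten w x) y z)
  (masV (mten w x) y z \o' masV w x (mten y z))); last by rewrite k e.
by rewrite -!pcompA (pcompr (masVK _ _ _)) pcomp1f masVK.
Qed.

Lemma mtriaV (x y : E) : mten⟪mru x, pid y⟫ \o' masV x mone y = mten⟪pid x, mlu y⟫.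
Proof. by rewrite -mtria -pcompA masVK pcompf1. Qed.

(** Reversal exchanges [mas] with [masV] and [mlu] with [mru], so every lemma about monoidal
    categories also yields its mirror image. *)
Definition revmon : moncat :=
  @MonCat E revten mone (fun x y z => masV z y x) (fun x y z => mas z y x)
    mru mruV mlu mluV (fun x y z => masVK z y x) (fun x y z => masK z y x)
    (@mruK E) (@mruVK E) (@mluK E) (@mluVK E)
    (fun x x' y y' z z' f g h => masV_nat h g f) (@mru_nat E) (@mlu_nat E)
    (fun w x y z => masV_penta z y x w) (fun x y => mtriaV y x).

End Reverse.

Lemma mru_mas (E : moncat) (x y : E) :
  mten⟪pid x, mru y⟫ \o' mas x y mone = mru (mten x y).
Proof.
have := @mlu_mas (revmon E) y x => /= <-.
by rewrite -pcompA masK pcompf1.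
Qed.

(** * Gluing and its laws for a single left action *)

Section Glue.
Variables (E : moncat) (M : modcat E).

(* With E = C x D^rev, these compose the factors f, (h, q) and g of two annuli. *)
Definition pasteI (a a1 : E) (x y z : M) (f : phom x (mact a y)) (f1 : phom y (mact a1 z)) :
    phom x (mact (mten a a1) z) :=
  aasV a a1 z \o' mact⟪pid a, f1⟫ \o' f.

Definition pasteX (a a' a1 a1' c c1 c2 : E) (h : phom (mten a c1) (mten c a'))
    (h1 : phom (mten a1 c2) (mten c1 a1')) :
    phom (mten (mten a a1) c2) (mten c (mten a' a1')) :=
  mas c a' a1' \o' mten⟪h, pid a1'⟫ \o' masV a c1 a1' \o' mten⟪pid a, h1⟫ \o'
    mas a a1 c2.

Definition pasteO (a a1 : E) (x y z : M) (g : phom (mact a y) x) (g1 : phom (mact a1 z) y) :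
    phom (mact (mten a a1) z) x :=
  g \o' mact⟪pid a, g1⟫ \o' aas a a1 z.

Lemma aasV_nat a a' b b' m m' (f : phom a a') (g : phom b b') (h : phom m m') :
  aasV a' b' m' \o' mact⟪f, mact⟪g, h⟫⟫ = mact⟪mten⟪f, g⟫, h⟫ \o' aasV a b m
    :> phom _ (_ : M).
Proof. by apply: inv_nat (aasVK _ _ _) (aasK _ _ _) _; rewrite aas_nat. Qed.

(** Naturality in the arc labels, used to expand an arc in simple objects. The letters [l] and [r]
    tell whether the arc belongs to the outer or to the inner annulus; in [pasteX] the prime marks
    the arc that runs to the factor g. *)
Lemma pasteI_natl a a' a1 x y z (u : phom a a') (f : phom x (mact a y)) (f1 : phom y (mact a1 z)) :
  pasteI (mact⟪u, pid y⟫ \o' f) f1 = mact⟪mten⟪u, pid a1⟫, pid z⟫ \o' pasteI f f1.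
Proof.
rewrite /pasteI -!pcompA (pcompr (pf_splitV _ _ _)) -(pf_split _ u f1).
by rewrite -(pf_id mact a1 z) -!pcompA (pcompr (aasV_nat _ _ _)) -!pcompA.
Qed.

Lemma pasteI_natr a a1 a1' x y z (u : phom a1 a1') (f : phom x (mact a y))
    (f1 : phom y (mact a1 z)) :
  pasteI f (mact⟪u, pid z⟫ \o' f1) = mact⟪mten⟪pid a, u⟫, pid z⟫ \o' pasteI f f1.
Proof.
by rewrite /pasteI pf_compr -!pcompA (pcompr (aasV_nat _ _ _)) -!pcompA.
Qed.

Lemma pasteO_natl a a' a1 x y z (u : phom a' a) (g : phom (mact a y) x) (g1 : phom (mact a1 z) y) :
  pasteO (g \o' mact⟪u, pid y⟫) g1 = pasteO g g1 \o' mact⟪mten⟪u, pid a1⟫, pid z⟫.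
Proof.
rewrite /pasteO -!pcompA (pcompr (pf_split _ _ _)) -(pf_splitV _ u g1).
by rewrite aas_nat -!pcompA pf_id.
Qed.

Lemma pasteO_natr a a1 a1' x y z (u : phom a1' a1) (g : phom (mact a y) x)
    (g1 : phom (mact a1 z) y) :
  pasteO g (g1 \o' mact⟪u, pid z⟫) = pasteO g g1 \o' mact⟪mten⟪pid a, u⟫, pid z⟫.
Proof.
by rewrite /pasteO pf_compr -!pcompA aas_nat.
Qed.

Lemma pasteX_natl a b a' a1 a1' c c1 c2 (u : phom b a)
    (h : phom (mten a c1) (mten c a')) (h1 : phom (mten a1 c2) (mten c1 a1')) :
  pasteX (h \o' mten⟪u, pid c1⟫) h1 = pasteX h h1 \o' mten⟪mten⟪u, pid a1⟫, pid c2⟫.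
Proof.
rewrite /pasteX pf_compl -!pcompA mas_nat (pcompr (esym (masV_nat _ _ _))) !pf_id -!pcompA.
by rewrite (pcompr (pf_swap _ u h1)) -!pcompA.
Qed.

Lemma pasteX_natr a a' a1 b1 a1' c c1 c2 (u : phom b1 a1)
    (h : phom (mten a c1) (mten c a')) (h1 : phom (mten a1 c2) (mten c1 a1')) :
  pasteX h (h1 \o' mten⟪u, pid c2⟫) = pasteX h h1 \o' mten⟪mten⟪pid a, u⟫, pid c2⟫.
Proof. by rewrite /pasteX pf_compr -!pcompA mas_nat. Qed.

Lemma pasteX_natl' a a' b' a1 a1' c c1 c2 (u : phom a' b')
    (h : phom (mten a c1) (mten c a')) (h1 : phom (mten a1 c2) (mten c1 a1')) :
  pasteX (mten⟪pid c, u⟫ \o' h) h1 = mten⟪pid c, mten⟪u, pid a1'⟫⟫ \o' pasteX h h1.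
Proof. by rewrite /pasteX pf_compl !pcompA mas_nat. Qed.

Lemma pasteX_natr' a a' a1 a1' b1' c c1 c2 (u : phom a1' b1')
    (h : phom (mten a c1) (mten c a')) (h1 : phom (mten a1 c2) (mten c1 a1')) :
  pasteX h (mten⟪pid c1, u⟫ \o' h1) = mten⟪pid c, mten⟪pid a', u⟫⟫ \o' pasteX h h1.
Proof.
rewrite /pasteX pf_compr -!pcompA (pcompr (masV_nat _ _ _)) pf_id -!pcompA.
rewrite (pcompr (pf_swap _ h u)) -!pcompA -(pf_id mten c a').
by rewrite (pcompr (mas_nat _ _ _)) -!pcompA.
Qed.

Lemma aasV_penta (a b c : E) (m : M) :
  aasV a (mten b c) m \o' mact⟪pid a, aasV b c m⟫ =
  mact⟪mas a b c, pid m⟫ \o' aasV (mten a b) c m \o' aasV a b (mact c m).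
Proof.
have e : (aas a b (mact c m) \o' aas (mten a b) c m) \o'
    (aasV (mten a b) c m \o' aasV a b (mact c m)) = pid _.
  by rewrite -!pcompA (pcompr (aasVK _ _ _)) pcomp1f aasVK.
rewrite -pcompA -[LHS]pcompf1 -e apenta -!pcompA.
rewrite (pcompr (esym (pf_compr mact a _ _))) aasK pf_id pcomp1f.
by rewrite (pcompr (aasK _ _ _)) pcomp1f.
Qed.

(** The pentagon with two edges inverted. Since [pasteX] uses both [mas] and [masV], iterated gluing
    produces such mixed forms. *)
Lemma mas_pentaV (w x y z : E) :
  masV w x (mten y z) \o' mten⟪pid w, mas x y z⟫ \o' mas w (mten x y) z =
  mas (mten w x) y z \o' mten⟪masV w x y, pid z⟫.
Proof.
have e : mten⟪mas w x y, pid z⟫ \o' mten⟪masV w x y, pid z⟫ = pid _.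
  by rewrite -pf_compl masVK pf_id.
by rewrite -[LHS]pcompf1 -e -!pcompA (pcompr3 (mpenta w x y z)) (pcompr (masK _ _ _)) pcomp1f.
Qed.

Lemma mas_pentaVr (w x y z : E) :
  mten⟪pid w, masV x y z⟫ \o' mas w x (mten y z) =
  mas w (mten x y) z \o' mten⟪mas w x y, pid z⟫ \o' masV (mten w x) y z.
Proof.
have := mpenta w x y z; rewrite -!pcompA => p.
rewrite -[LHS]pcompf1 -(masVK (mten w x) y z) -!pcompA (pcompr p) -!pcompA.
by rewrite (pcompr (esym (pf_compr mten w _ _))) masK pf_id pcomp1f.
Qed.

Lemma pasteIA a a1 a2 x y z w (f : phom x (mact a y)) (f1 : phom y (mact a1 z))
    (f2 : phom z (mact a2 w)) :
  mact⟪mas a a1 a2, pid w⟫ \o' pasteI (pasteI f f1) f2 = pasteI f (pasteI f1 f2).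
Proof.
rewrite /pasteI !pf_compr -!pcompA -(pf_id mten) (pcompr (esym (aasV_nat _ _ _))) -!pcompA.
by rewrite (pcompr3 (aasV_penta _ _ _ _)).
Qed.

Lemma pasteOA a a1 a2 x y z w (g : phom (mact a y) x) (g1 : phom (mact a1 z) y)
    (g2 : phom (mact a2 w) z) :
  pasteO g (pasteO g1 g2) \o' mact⟪mas a a1 a2, pid w⟫ = pasteO (pasteO g g1) g2.
Proof.
rewrite /pasteO !pf_compr -!pcompA; have := apenta a a1 a2 w; rewrite -!pcompA => <-.
by rewrite -(pf_id mten) (pcompr (aas_nat _ _ _)) -!pcompA.
Qed.

(** By naturality h, h1 and h2 slide past the associators until only associators stand between
    consecutive factors; these agree by the pentagon and its two mixed forms. *)
Lemma pasteXA a a' a1 a1' a2 a2' c c1 c2 c3 (h : phom (mten a c1) (mten c a'))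
    (h1 : phom (mten a1 c2) (mten c1 a1')) (h2 : phom (mten a2 c3) (mten c2 a2')) :
  mten⟪pid c, mas a' a1' a2'⟫ \o' pasteX (pasteX h h1) h2 =
  pasteX h (pasteX h1 h2) \o' mten⟪mas a a1 a2, pid c3⟫.
Proof.
rewrite /pasteX !pf_compr !pf_compl -!pcompA.
rewrite (pcompr3 (mpenta _ _ _ _)) (pcompr (mas_nat _ _ _)) -!pcompA.
rewrite -(pcompr3 (esym (mas_pentaV _ _ _ _))) (pcompr (mas_nat _ _ _)) -!pcompA.
rewrite (pcompr3 (mas_pentaVr _ _ _ _)).
by rewrite -(pf_id mten a a1) (pcompr (mas_nat _ _ _)) -!pcompA mpenta !pf_id -!pcompA.
Qed.

(** This left unit law rests on Kelly's triangle [alu_aas], the right one below on the triangle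
    axiom [atria]. *)
Lemma pasteI_1l a x y (f : phom x (mact a y)) :
  mact⟪mlu a, pid y⟫ \o' pasteI (aluV x) f = f.
Proof.
rewrite /pasteI -alu_aas -!pcompA (pcompr (aasVK _ _ _)) pcomp1f.
by rewrite (pcompr (alu_nat _)) -pcompA aluVK pcompf1.
Qed.

Lemma pasteI_1r a x y (f : phom x (mact a y)) :
  mact⟪mru a, pid y⟫ \o' pasteI f (aluV y) = f.
Proof.
rewrite /pasteI -atria -!pcompA (pcompr (aasVK _ _ _)) pcomp1f.
by rewrite (pcompr (esym (pf_compr _ _ _ _))) aluVK pf_id pcomp1f.
Qed.

Lemma pasteO_1l a x y (g : phom (mact a y) x) :
  pasteO (alu x) g = g \o' mact⟪mlu a, pid y⟫.
Proof. by rewrite /pasteO alu_nat -pcompA alu_aas. Qed.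

Lemma pasteO_1r a x y (g : phom (mact a y) x) :
  pasteO g (alu y) = g \o' mact⟪mru a, pid y⟫.
Proof. by rewrite /pasteO -pcompA atria. Qed.

Lemma pasteX_1l a a' c c1 (h : phom (mten a c1) (mten c a')) :
  mten⟪pid c, mlu a'⟫ \o' pasteX (mruV c \o' mlu c) h = h \o' mten⟪mlu a, pid c1⟫.
Proof.
rewrite /pasteX pf_compl -!pcompA (pcompr (mtria _ _)).
rewrite (pcompr (esym (pf_compl _ _ _ _))) mruVK pf_id pcomp1f.
rewrite -mlu_mas -!pcompA (pcompr (masVK _ _ _)) pcomp1f (pcompr (mlu_nat _)).
by rewrite -pcompA mlu_mas.
Qed.

Lemma pasteX_1r a a' c c1 (h : phom (mten a c1) (mten c a')) :
  mten⟪pid c, mru a'⟫ \o' pasteX h (mruV c1 \o' mlu c1) = h \o' mten⟪mru a, pid c1⟫.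
Proof.
rewrite /pasteX pf_compr -!pcompA (pcompr (mru_mas _ _)) (pcompr (mru_nat _)).
have -> : mru (mten a c1) = mten⟪pid a, mru c1⟫ \o' mas a c1 mone.
  by rewrite mru_mas.
rewrite -!pcompA (pcompr (masVK _ _ _)) pcomp1f.
by rewrite (pcompr (esym (pf_compr _ _ _ _))) mruVK pf_id pcomp1f mtria.
Qed.

(* j stands for a bundle of unit strands. *)
Section Zigzag.
Variables (c y j : E) (ev : phom (mten y c) mone) (coev : phom mone (mten c y)).
Variables (o : phom mone j) (o' : phom j mone).
Hypothesis zigzag :
  mru c \o' mten⟪pid c, ev⟫ \o' mas c y c \o' mten⟪coev, pid c⟫ \o' mluV c = pid c.
Hypothesis oK : o' \o' o = pid mone.

(** The outer piece creates the strand c together with its dual y on the arc and absorbs the unit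
    bundle j; the inner piece creates j and lets c run along its own arc. After gluing the arc is
    labelled by y ⊗ c, and contracting it with [ev] leaves a bent strand that the zigzag identity
    straightens to the plain crossing of c with a unit arc. *)
Lemma pasteX_zigzag :
  mten⟪pid c, ev⟫ \o' pasteX (coev \o' o' \o' mlu j) (mten⟪o, pid c⟫) =
  (mruV c \o' mlu c) \o' mten⟪mlu mone, pid c⟫.
Proof.
have -> : coev \o' o' \o' mlu j = coev \o' mlu mone \o' mten⟪pid mone, o'⟫.
  by rewrite -!pcompA -mlu_nat.
rewrite /pasteX !pf_compl -!pcompA (pcompr (esym (masV_nat _ _ _))) -!pcompA.
rewrite [mten⟪pid mone, mten⟪o', _⟫⟫ \o' _](pcompr (esym (pf_compr _ _ _ _))).
rewrite -pf_compl oK !pf_id pcomp1f masK pcompf1.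
have z : mten⟪pid c, ev⟫ \o' (mas c y c \o' mten⟪coev, pid c⟫) = mruV c \o' mlu c.
  apply: (epi_split (mluK c)); rewrite -[RHS]pcompA mluVK pcompf1.
  by apply: (mono_split (mruK c)); rewrite mruVK -[RHS]zigzag -!pcompA.
have := congr1 (fun t => t \o' mten⟪mlu mone, pid c⟫) z.
by rewrite -!pcompA.
Qed.

(** The associator of the gluing releases the strand c from the wall label [mact c w] and cancels
    the inverse associator in the outer factor. *)
Lemma pasteO_zigzag (w : M) :
  pasteO (alu w \o' mact⟪ev, pid w⟫ \o' aasV y c w) (pid (mact c w)) =
  alu w \o' mact⟪ev, pid w⟫.
Proof. by rewrite /pasteO pf_id pcompf1 -!pcompA aasK pcompf1. Qed.

End Zigzag.

End Glue.

(** * Bimodule categories as module categories *)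

Definition prodcat (X Y : precat) : precat :=
  @PreCat (X * Y) (fun u v => phom u.1 v.1 * phom u.2 v.2)%type
    (fun u => (pid u.1, pid u.2))
    (fun _ _ _ g f => (g.1 \o' f.1, g.2 \o' f.2))
    (fun _ _ _ _ _ _ _ => congr2 pair (pcompA _ _ _) (pcompA _ _ _))
    (fun _ _ f => let: (f1, f2) := f in congr2 pair (pcomp1f f1) (pcomp1f f2))
    (fun _ _ f => let: (f1, f2) := f in congr2 pair (pcompf1 f1) (pcompf1 f2)).

Definition prodten (E F : moncat) :
    prefun (prodcat E F) (prodcat E F) (prodcat E F) :=
  @PreFun (prodcat E F) (prodcat E F) (prodcat E F)
    (fun x y => (mten x.1 y.1, mten x.2 y.2))
    (fun _ _ _ _ f g => (mten⟪f.1, g.1⟫, mten⟪f.2, g.2⟫))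
    (fun _ _ => congr2 pair (pf_id _ _ _) (pf_id _ _ _))
    (fun _ _ _ _ _ _ _ _ _ _ => congr2 pair (pf_comp _ _ _ _ _) (pf_comp _ _ _ _ _)).

Definition prodmon (E F : moncat) : moncat :=
  @MonCat (prodcat E F) (prodten E F) (mone, mone)
    (fun x y z => (mas x.1 y.1 z.1, mas x.2 y.2 z.2))
    (fun x y z => (masV x.1 y.1 z.1, masV x.2 y.2 z.2))
    (fun x => (mlu x.1, mlu x.2)) (fun x => (mluV x.1, mluV x.2))
    (fun x => (mru x.1, mru x.2)) (fun x => (mruV x.1, mruV x.2))
    (fun _ _ _ => congr2 pair (masK _ _ _) (masK _ _ _))
    (fun _ _ _ => congr2 pair (masVK _ _ _) (masVK _ _ _))
    (fun _ => congr2 pair (mluK _) (mluK _))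
    (fun _ => congr2 pair (mluVK _) (mluVK _))
    (fun _ => congr2 pair (mruK _) (mruK _))
    (fun _ => congr2 pair (mruVK _) (mruVK _))
    (fun _ _ _ _ _ _ _ _ _ => congr2 pair (mas_nat _ _ _) (mas_nat _ _ _))
    (fun _ _ _ => congr2 pair (mlu_nat _) (mlu_nat _))
    (fun _ _ _ => congr2 pair (mru_nat _) (mru_nat _))
    (fun _ _ _ _ => congr2 pair (mpenta _ _ _ _) (mpenta _ _ _ _))
    (fun _ _ => congr2 pair (mtria _ _) (mtria _ _)).

Record bimcat (E F : moncat) := BimCat {
  b_mod :> modcat E;
  ract : prefun b_mod F b_mod;
  ras : forall m d e, phom (ract (ract m d) e) (ract m (mten d e));
  rasV : forall m d e, phom (ract m (mten d e)) (ract (ract m d) e);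
  rru : forall m, phom (ract m mone) m;
  rruV : forall m, phom m (ract m mone);
  bas : forall a m d, phom (ract (mact a m) d) (mact a (ract m d));
  basV : forall a m d, phom (mact a (ract m d)) (ract (mact a m) d);
  rasK : forall m d e, rasV m d e \o' ras m d e = pid _;
  rasVK : forall m d e, ras m d e \o' rasV m d e = pid _;
  rruK : forall m, rruV m \o' rru m = pid _;
  rruVK : forall m, rru m \o' rruV m = pid _;
  basK : forall a m d, basV a m d \o' bas a m d = pid _;
  basVK : forall a m d, bas a m d \o' basV a m d = pid _;
  ras_nat : forall m m' d d' e e' (h : phom m m') (f : phom d d') (g : phom e e'),
    ras m' d' e' \o' ract⟪ract⟪h, f⟫, g⟫ = ract⟪h, mten⟪f, g⟫⟫ \o' ras m d e;
  rru_nat : forall m m' (h : phom m m'), rru m' \o' ract⟪h, pid mone⟫ = h \o' rru m;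
  bas_nat : forall a a' m m' d d' (f : phom a a') (h : phom m m') (g : phom d d'),
    bas a' m' d' \o' ract⟪mact⟪f, h⟫, g⟫ = mact⟪f, ract⟪h, g⟫⟫ \o' bas a m d;
  rpenta : forall m d e f,
    ras m d (mten e f) \o' ras (ract m d) e f =
    ract⟪pid m, mas d e f⟫ \o' ras m (mten d e) f \o' ract⟪ras m d e, pid f⟫;
  rtria : forall m d,
    ract⟪pid m, mlu d⟫ \o' ras m mone d = ract⟪rru m, pid d⟫;
  bpental : forall a b m d,
    mact⟪pid a, bas b m d⟫ \o' bas a (mact b m) d \o' ract⟪aas a b m, pid d⟫ =
    aas a b (ract m d) \o' bas (mten a b) m d;
  bpentar : forall a m d e,
    mact⟪pid a, ras m d e⟫ \o' bas a (ract m d) e \o' ract⟪bas a m d, pid e⟫ =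
    bas a m (mten d e) \o' ras (mact a m) d e;
  btriar : forall a m, mact⟪pid a, rru m⟫ \o' bas a m mone = rru (mact a m) }.

Arguments ract {E F b} : rename.
Arguments ras {E F b} m0 d e : rename.
Arguments rasV {E F b} m0 d e : rename.
Arguments rru {E F b} m0 : rename.
Arguments rruV {E F b} m0 : rename.
Arguments bas {E F b} a m0 d : rename.
Arguments basV {E F b} a m0 d : rename.

(* An E-F-bimodule category as a left module over E x F^rev. *)
Section TwoSided.
Variables (E F : moncat) (M : bimcat E F).
Local Notation EF := (prodmon E (revmon F)).
Implicit Types (X Y Z : EF) (m : M).

Lemma two_act_id X m :
  ract⟪mact⟪pid X.1, pid m⟫, pid X.2⟫ = pid (ract (mact X.1 m) X.2).
Proof. by rewrite !pf_id. Qed.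

Lemma two_act_comp X X' X'' m m' m'' (f' : phom X' X'') (f : phom X X')
    (g' : phom m' m'') (g : phom m m') :
  ract⟪mact⟪f'.1 \o' f.1, g' \o' g⟫, f'.2 \o' f.2⟫ =
  ract⟪mact⟪f'.1, g'⟫, f'.2⟫ \o' ract⟪mact⟪f.1, g⟫, f.2⟫.
Proof. by rewrite !pf_comp. Qed.

Definition two_act : prefun EF M M :=
  @PreFun EF M M (fun X m => ract (mact X.1 m) X.2)
    (fun X X' m m' f g => ract⟪mact⟪f.1, g⟫, f.2⟫) two_act_id two_act_comp.

(** For a bimodule category this unfolds to [nest]; the gluing of wall factors is therefore [pasteI]
    and [pasteO] up to conversion. *)
Definition two_aasV X Y m :
    phom (two_act X (two_act Y m)) (two_act (mten X Y) m) :=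
  ras _ _ _ \o' ract⟪ract⟪aasV X.1 Y.1 m, pid Y.2⟫ \o' basV X.1 (mact Y.1 m) Y.2, pid X.2⟫.

Definition two_aas X Y m :
    phom (two_act (mten X Y) m) (two_act X (two_act Y m)) :=
  ract⟪bas X.1 (mact Y.1 m) Y.2 \o' ract⟪aas X.1 Y.1 m, pid Y.2⟫, pid X.2⟫ \o' rasV _ _ _.

Lemma two_aasK X Y m : two_aasV X Y m \o' two_aas X Y m = pid _.
Proof.
rewrite /two_aasV /two_aas /= -!pcompA (pcompr (esym (pf_compl _ _ _ _))) -!pcompA.
rewrite (pcompr (basK _ _ _)) pcomp1f -pf_compl aasK !pf_id pcomp1f.
exact: rasVK.
Qed.

Lemma two_aasVK X Y m : two_aas X Y m \o' two_aasV X Y m = pid _.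
Proof.
rewrite /two_aasV /two_aas /= -!pcompA (pcompr (rasK _ _ _)) pcomp1f -pf_compl -!pcompA.
rewrite (pcompr (esym (pf_compl _ _ _ _))) aasVK !pf_id pcomp1f basVK.
by rewrite !pf_id.
Qed.

Lemma basV_nat a a' m m' d d' (f : phom a a') (h : phom m m') (g : phom d d') :
  basV a' m' d' \o' mact⟪f, ract⟪h, g⟫⟫ = ract⟪mact⟪f, h⟫, g⟫ \o' basV a m d
    :> phom _ (_ : M).
Proof. by apply: inv_nat (basVK _ _ _) (basK _ _ _) _; rewrite bas_nat. Qed.

Lemma two_aasV_nat X X' Y Y' m m' (f : phom X X') (g : phom Y Y') (h : phom m m') :
  two_aasV X' Y' m' \o' two_act⟪f, two_act⟪g, h⟫⟫ =
  two_act⟪mten⟪f, g⟫, h⟫ \o' two_aasV X Y m.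
Proof.
rewrite /two_aasV /= -!pcompA -pf_comp -!pcompA basV_nat pcomp1f.
rewrite pcompA -pf_comp aasV_nat pcomp1f.
rewrite -[g.2]pcompf1 pf_comp -pcompA -{1}[f.2]pcompf1 pf_comp.
by rewrite [LHS]pcompA ras_nat -pcompA pcompf1.
Qed.

Lemma two_aas_nat X X' Y Y' m m' (f : phom X X') (g : phom Y Y') (h : phom m m') :
  two_aas X' Y' m' \o' two_act⟪mten⟪f, g⟫, h⟫ =
  two_act⟪f, two_act⟪g, h⟫⟫ \o' two_aas X Y m.
Proof.
by apply: inv_nat (two_aasK _ _ _) (two_aasVK _ _ _) _; rewrite two_aasV_nat.
Qed.

Definition two_alu m : phom (two_act mone m) m := alu m \o' rru (mact mone m).
Definition two_aluV m : phom m (two_act mone m) := rruV (mact mone m) \o' aluV m.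

Lemma two_aluK m : two_aluV m \o' two_alu m = pid _.
Proof.
by rewrite /two_aluV /two_alu -!pcompA (pcompr (aluK _)) pcomp1f rruK.
Qed.

Lemma two_aluVK m : two_alu m \o' two_aluV m = pid _.
Proof.
by rewrite /two_aluV /two_alu -!pcompA (pcompr (rruVK _)) pcomp1f aluVK.
Qed.

Lemma two_alu_nat m m' (h : phom m m') :
  two_alu m' \o' two_act⟪pid (mone : EF), h⟫ = h \o' two_alu m.
Proof. by rewrite /two_alu /= -pcompA rru_nat pcompA alu_nat -pcompA. Qed.

Lemma two_tria X m :
  two_act⟪pid X, two_alu m⟫ \o' two_aas X mone m = two_act⟪mru X, pid m⟫.
Proof.
rewrite /two_alu /two_aas /= pcompA -pf_compl pf_compr -!pcompA.
rewrite (pcompr (btriar _ _)) rru_nat pcompA atria pf_compl -rtria.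
by rewrite -!pcompA rasVK pcompf1 pf_split.
Qed.

Lemma basV_pental a b m d :
  ract⟪aasV a b m, pid d⟫ \o' basV a (mact b m) d \o' mact⟪pid a, basV b m d⟫ =
  basV (mten a b) m d \o' aasV a b (ract m d)
    :> phom _ (_ : M).
Proof.
apply: (inv_uniq (p := aas a b (ract m d) \o' bas (mten a b) m d)).
  rewrite -bpental -!pcompA (pcompr (esym (pf_compr mact a _ _))) basK pf_id pcomp1f.
  by rewrite (pcompr (basK _ _ _)) pcomp1f -pf_compl aasK pf_id.
by rewrite -!pcompA (pcompr (basVK _ _ _)) pcomp1f aasVK.
Qed.

Lemma basV_pentar a m d e :
  basV a m (mten d e) \o' mact⟪pid a, ras m d e⟫ =
  ras (mact a m) d e \o' ract⟪basV a m d, pid e⟫ \o' basV a (ract m d) e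
    :> phom _ (_ : M).
Proof.
have -> : mact⟪pid a, ras m d e⟫ = bas a m (mten d e) \o' ras (mact a m) d e \o'
    ract⟪basV a m d, pid e⟫ \o' basV a (ract m d) e.
  rewrite -bpentar -!pcompA (pcompr (esym (pf_compl ract _ _ _))) basVK pf_id pcomp1f.
  by rewrite basVK pcompf1.
by rewrite -!pcompA (pcompr (basK _ _ _)) pcomp1f.
Qed.

Lemma ras_slide (n n' : M) d e (u : phom n n') :
  ract⟪u, pid (mten d e)⟫ \o' ras n d e = ras n' d e \o' ract⟪ract⟪u, pid d⟫, pid e⟫.
Proof. by rewrite -(pf_id mten) ras_nat. Qed.

Lemma ract_masK (n n' : M) (u : phom n n') (d e f : F) (k : M)
    (v : phom k (ract n (mten (mten d e) f))) :
  ract⟪u, masV d e f⟫ \o' (ract⟪pid n, mas d e f⟫ \o' v) = ract⟪u, pid _⟫ \o' v.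
Proof. by rewrite pcompA -pf_comp pcompf1 masK. Qed.

(** Both sides are stripped of common outer factors layer by layer: [rpenta] settles the right
    associators, [basV_pentar] and [basV_pental] move the mixed associators past the right and the
    left ones, and what remains is the pentagon [aasV_penta] of the left action. *)
Lemma two_aasV_penta X Y Z m :
  two_act⟪mas X Y Z, pid m⟫ \o' (two_aasV (mten X Y) Z m \o' two_aasV X Y (two_act Z m)) =
  two_aasV X (mten Y Z) m \o' two_act⟪pid X, two_aasV Y Z m⟫.
Proof.
rewrite /two_aasV /=.
case: X Y Z => [a1 b1] [a2 b2] [a3 b3] /=.
rewrite !pf_compl -!pcompA.
rewrite (pcompr (ras_slide _ _ _)) -!pcompA (pcompr (ras_slide _ _ _)) -!pcompA.
rewrite (pcompr (rpenta _ _ _ _)) -!pcompA ract_masK.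
rewrite (pcompr (ras_slide _ _ _)) -!pcompA.
congr (_ \o' _); rewrite -!pf_compl; congr (ract⟪_, _⟫).
rewrite !pf_compr (pcompr (ras_slide _ _ _)) -!pcompA.
rewrite (pcompr (basV_pentar _ _ _ _)) -!pcompA (pcompr (ras_slide _ _ _)) -!pcompA.
congr (_ \o' _); rewrite basV_nat !pcompA.
congr (_ \o' _); rewrite -!pf_compl; congr (ract⟪_, _⟫).
rewrite pf_compr -!pcompA (pcompr (basV_nat _ _ _)) -!pcompA -basV_pental.
by rewrite pf_compl !pcompA -!pf_compl -!pcompA aasV_penta -!pcompA.
Qed.

Lemma two_penta X Y Z m :
  two_aas X Y (two_act Z m) \o' two_aas (mten X Y) Z m =
  two_act⟪pid X, two_aas Y Z m⟫ \o' two_aas X (mten Y Z) m \o' two_act⟪mas X Y Z, pid m⟫.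
Proof.
apply/esym; apply: (inv_uniq (p := two_aasV (mten X Y) Z m \o' two_aasV X Y (two_act Z m))).
  rewrite -[LHS]pcompA two_aasV_penta [LHS]pcomp_mid two_aasVK.
  by rewrite pcomp1f -pf_compr two_aasVK pf_id.
by rewrite [LHS]pcomp_mid two_aasK pcomp1f two_aasK.
Qed.

Definition twomod : modcat EF :=
  @ModCat EF M two_act two_aas two_aasV two_alu two_aluV two_aasK two_aasVK
    two_aluK two_aluVK two_aas_nat two_alu_nat two_penta two_tria.

End TwoSided.

(** * Gluing the four Hom factors *)

Section Underlying.
Variable R : realType.

Lemma dag_idm (C : cstarcat R) (x : C) : dag (idm x) = idm x.
Proof. by have := dag_comp (idm x) (dag (idm x)); rewrite comp1m dagK comp1m. Qed.

Definition precat_of (C : cstarcat R) : precat :=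
  @PreCat C (fun x y => mor x y) idm (@comp R C) (@compA R C) (@comp1m R C) (@compm1 R C).

Definition prefun_of (X Y Z : cstarcat R) (F : bifunctor X Y Z) :
    prefun (precat_of X) (precat_of Y) (precat_of Z) :=
  @PreFun (precat_of X) (precat_of Y) (precat_of Z) F (@bf_mor R X Y Z F)
    (@bf_id R X Y Z F) (@bf_comp R X Y Z F).

Definition mon_of (C : fuscat R) : moncat :=
  @MonCat (precat_of C) (prefun_of (ten C)) (one C)
    (@asc R C) (fun x y z => dag (asc x y z))
    (@lun R C) (fun x => dag (lun x)) (@run R C) (fun x => dag (run x))
    (fun x y z => (asc_unitary x y z).1) (fun x y z => (asc_unitary x y z).2)
    (fun x => (lun_unitary x).1) (fun x => (lun_unitary x).2)
    (fun x => (run_unitary x).1) (fun x => (run_unitary x).2)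
    (@asc_nat R C) (@lun_nat R C) (@run_nat R C) (@pentagon R C) (@triangle R C).

Variables (C D : fuscat R) (M : bimodcat C D).

Definition mod_of : modcat (mon_of C) :=
  @ModCat (mon_of C) (precat_of M) (prefun_of (la M))
    (@lasc R C D M) (fun a b m => dag (lasc a b m))
    (@llun R C D M) (fun m => dag (llun m))
    (fun a b m => (lasc_unitary a b m).1) (fun a b m => (lasc_unitary a b m).2)
    (fun m => (llun_unitary m).1) (fun m => (llun_unitary m).2)
    (@lasc_nat R C D M) (@llun_nat R C D M) (@lpentagon R C D M) (@ltriangle R C D M).

Definition bim_of : bimcat (mon_of C) (mon_of D) :=
  @BimCat (mon_of C) (mon_of D) mod_of (prefun_of (ra M))
    (@rasc R C D M) (fun m d e => dag (rasc m d e))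
    (@rrun R C D M) (fun m => dag (rrun m))
    (@masc R C D M) (fun a m d => dag (masc a m d))
    (fun m d e => (rasc_unitary m d e).1) (fun m d e => (rasc_unitary m d e).2)
    (fun m => (rrun_unitary m).1) (fun m => (rrun_unitary m).2)
    (fun a m d => (masc_unitary a m d).1) (fun a m d => (masc_unitary a m d).2)
    (@rasc_nat R C D M) (@rrun_nat R C D M) (@masc_nat R C D M)
    (@rpentagon R C D M) (@rtriangle R C D M)
    (@mpentagonl R C D M) (@mpentagonr R C D M) (@mtriangler R C D M).

Definition sides : moncat := prodmon (mon_of C) (revmon (mon_of D)).
Definition wall : modcat sides := twomod bim_of.

(** The right-hand side is what [two_aas] unfolds to, so after this rewriting the factor g is also
    covered by conversion. *)
Lemma dag_nest (a a1 : C) (z : M) (b1 b : D) :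
  dag (nest a a1 z b1 b) =
  (ra M)⟦masc a (la M a1 z) b1 ∘ (ra M)⟦lasc a a1 z, idm b1⟧, idm b⟧ ∘ dag (rasc _ b1 b).
Proof. by rewrite /nest dag_comp -bf_dag dag_comp -bf_dag !dagK !dag_idm. Qed.

Section Glue.
Implicit Types (a : C) (b : D) (x y z w : M).

(* W, C, D and W' refer to the factors f, h, q and g of an annulus. *)
Definition glueW a a1 b b1 x y z (f : mor x (ra M (la M a y) b))
    (f1 : mor y (ra M (la M a1 z) b1)) :
    mor x (ra M (la M (ten C a a1) z) (ten D b1 b)) :=
  nest a a1 z b1 b ∘ (ra M)⟦(la M)⟦idm a, f1⟧, idm b⟧ ∘ f.

Definition glueC a a' a1 a1' (c c1 c2 : C) (h : mor (ten C a c1) (ten C c a'))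
    (h1 : mor (ten C a1 c2) (ten C c1 a1')) :
    mor (ten C (ten C a a1) c2) (ten C c (ten C a' a1')) :=
  asc c a' a1' ∘ (ten C)⟦h, idm a1'⟧ ∘ dag (asc a c1 a1') ∘ (ten C)⟦idm a, h1⟧ ∘ asc a a1 c2.

Definition glueD b b' b1 b1' (e e1 e2 : D) (q : mor (ten D e1 b) (ten D b' e))
    (q1 : mor (ten D e2 b1) (ten D b1' e1)) :
    mor (ten D e2 (ten D b1 b)) (ten D (ten D b1' b') e) :=
  dag (asc b1' b' e) ∘ (ten D)⟦idm b1', q⟧ ∘ asc b1' e1 b ∘ (ten D)⟦q1, idm b⟧ ∘ dag (asc e2 b1 b).

Definition glueW' a a1 b b1 x y z (g : mor (ra M (la M a y) b) x)
    (g1 : mor (ra M (la M a1 z) b1) y) :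
    mor (ra M (la M (ten C a a1) z) (ten D b1 b)) x :=
  g ∘ (ra M)⟦(la M)⟦idm a, g1⟧, idm b⟧ ∘ dag (nest a a1 z b1 b).

Lemma glueW_bilin a a1 b b1 x y z : bilin (@glueW a a1 b b1 x y z).
Proof.
split=> ? ? ? ?; rewrite /glueW; first by rewrite (comp_bilin _ _ _).2.
by rewrite (bf_bilin (la M) _ _ _ _).2 (bf_bilin (ra M) _ _ _ _).1 (comp_bilin _ _ _).2
  (comp_bilin _ _ _).1.
Qed.

Lemma glueC_bilin a a' a1 a1' (c c1 c2 : C) : bilin (@glueC a a' a1 a1' c c1 c2).
Proof.
split=> ? ? ? ?; rewrite /glueC.
  by rewrite (bf_bilin (ten C) _ _ _ _).1 (comp_bilin _ _ _).2 !(comp_bilin _ _ _).1.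
by rewrite (bf_bilin (ten C) _ _ _ _).2 (comp_bilin _ _ _).2 !(comp_bilin _ _ _).1.
Qed.

Lemma glueD_bilin b b' b1 b1' (e e1 e2 : D) : bilin (@glueD b b' b1 b1' e e1 e2).
Proof.
split=> ? ? ? ?; rewrite /glueD.
  by rewrite (bf_bilin (ten D) _ _ _ _).2 (comp_bilin _ _ _).2 !(comp_bilin _ _ _).1.
by rewrite (bf_bilin (ten D) _ _ _ _).1 (comp_bilin _ _ _).2 !(comp_bilin _ _ _).1.
Qed.

Lemma glueW'_bilin a a1 b b1 x y z : bilin (@glueW' a a1 b b1 x y z).
Proof.
split=> ? ? ? ?; rewrite /glueW'; first by rewrite !(comp_bilin _ _ _).1.
by rewrite (bf_bilin (la M) _ _ _ _).2 (bf_bilin (ra M) _ _ _ _).1 (comp_bilin _ _ _).2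
  (comp_bilin _ _ _).1.
Qed.

(** This law and the following ones are instances of the paste lemmas: in [wall] for the wall
    factors, in C for [glueC], in reversed D for [glueD]. Right arcs are tensored in the opposite
    order, whence the adjoint of their associator. *)
Lemma glueWA a a1 a2 b b1 b2 x y z w (f : mor x (ra M (la M a y) b))
    (f1 : mor y (ra M (la M a1 z) b1)) (f2 : mor z (ra M (la M a2 w) b2)) :
  (ra M)⟦(la M)⟦asc a a1 a2, idm w⟧, dag (asc b2 b1 b)⟧ ∘ glueW (glueW f f1) f2 =
  glueW f (glueW f1 f2).
Proof. exact: (@pasteIA sides wall (a, b) (a1, b1) (a2, b2)). Qed.

Lemma glueCA a a' a1 a1' a2 a2' (c c1 c2 c3 : C) (h : mor (ten C a c1) (ten C c a'))
    (h1 : mor (ten C a1 c2) (ten C c1 a1')) (h2 : mor (ten C a2 c3) (ten C c2 a2')) :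
  (ten C)⟦idm c, asc a' a1' a2'⟧ ∘ glueC (glueC h h1) h2 =
  glueC h (glueC h1 h2) ∘ (ten C)⟦asc a a1 a2, idm c3⟧.
Proof. exact: (@pasteXA (mon_of C)). Qed.

Lemma glueDA b b' b1 b1' b2 b2' (e e1 e2 e3 : D) (q : mor (ten D e1 b) (ten D b' e))
    (q1 : mor (ten D e2 b1) (ten D b1' e1)) (q2 : mor (ten D e3 b2) (ten D b2' e2)) :
  (ten D)⟦dag (asc b2' b1' b'), idm e⟧ ∘ glueD (glueD q q1) q2 =
  glueD q (glueD q1 q2) ∘ (ten D)⟦idm e3, dag (asc b2 b1 b)⟧.
Proof. exact: (@pasteXA (revmon (mon_of D))). Qed.

Lemma glueW'A a a1 a2 b b1 b2 x y z w (g : mor (ra M (la M a y) b) x)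
    (g1 : mor (ra M (la M a1 z) b1) y) (g2 : mor (ra M (la M a2 w) b2) z) :
  glueW' g (glueW' g1 g2) ∘ (ra M)⟦(la M)⟦asc a a1 a2, idm w⟧, dag (asc b2 b1 b)⟧ =
  glueW' (glueW' g g1) g2.
Proof.
by rewrite /glueW' !dag_nest; exact: (@pasteOA sides wall (a, b) (a1, b1) (a2, b2)).
Qed.

Lemma glueW_natl a a' a1 b b' b1 x y z (u : mor a a') (v : mor b b')
    (f : mor x (ra M (la M a y) b)) (f1 : mor y (ra M (la M a1 z) b1)) :
  glueW ((ra M)⟦(la M)⟦u, idm y⟧, v⟧ ∘ f) f1 =
  (ra M)⟦(la M)⟦(ten C)⟦u, idm a1⟧, idm z⟧, (ten D)⟦idm b1, v⟧⟧ ∘ glueW f f1.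
Proof. exact: (@pasteI_natl sides wall (a, b) (a', b') (a1, b1) x y z (u, v)). Qed.

Lemma glueW_natr a a1 a1' b b1 b1' x y z (u : mor a1 a1') (v : mor b1 b1')
    (f : mor x (ra M (la M a y) b)) (f1 : mor y (ra M (la M a1 z) b1)) :
  glueW f ((ra M)⟦(la M)⟦u, idm z⟧, v⟧ ∘ f1) =
  (ra M)⟦(la M)⟦(ten C)⟦idm a, u⟧, idm z⟧, (ten D)⟦v, idm b⟧⟧ ∘ glueW f f1.
Proof. exact: (@pasteI_natr sides wall (a, b) (a1, b1) (a1', b1') x y z (u, v)). Qed.

Lemma glueW'_natl a a' a1 b b' b1 x y z (u : mor a' a) (v : mor b' b)
    (g : mor (ra M (la M a y) b) x) (g1 : mor (ra M (la M a1 z) b1) y) :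
  glueW' (g ∘ (ra M)⟦(la M)⟦u, idm y⟧, v⟧) g1 =
  glueW' g g1 ∘ (ra M)⟦(la M)⟦(ten C)⟦u, idm a1⟧, idm z⟧, (ten D)⟦idm b1, v⟧⟧.
Proof.
rewrite /glueW' !dag_nest.
exact: (@pasteO_natl sides wall (a, b) (a', b') (a1, b1) x y z (u, v)).
Qed.

Lemma glueW'_natr a a1 a1' b b1 b1' x y z (u : mor a1' a1) (v : mor b1' b1)
    (g : mor (ra M (la M a y) b) x) (g1 : mor (ra M (la M a1 z) b1) y) :
  glueW' g (g1 ∘ (ra M)⟦(la M)⟦u, idm z⟧, v⟧) =
  glueW' g g1 ∘ (ra M)⟦(la M)⟦(ten C)⟦idm a, u⟧, idm z⟧, (ten D)⟦v, idm b⟧⟧.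
Proof.
rewrite /glueW' !dag_nest.
exact: (@pasteO_natr sides wall (a, b) (a1, b1) (a1', b1') x y z (u, v)).
Qed.

Lemma glueC_natl a0 a a' a1 a1' (c c1 c2 : C) (u : mor a0 a)
    (h : mor (ten C a c1) (ten C c a')) (h1 : mor (ten C a1 c2) (ten C c1 a1')) :
  glueC (h ∘ (ten C)⟦u, idm c1⟧) h1 = glueC h h1 ∘ (ten C)⟦(ten C)⟦u, idm a1⟧, idm c2⟧.
Proof. exact: (@pasteX_natl (mon_of C)). Qed.

Lemma glueC_natr a a' a0 a1 a1' (c c1 c2 : C) (u : mor a0 a1)
    (h : mor (ten C a c1) (ten C c a')) (h1 : mor (ten C a1 c2) (ten C c1 a1')) :
  glueC h (h1 ∘ (ten C)⟦u, idm c2⟧) = glueC h h1 ∘ (ten C)⟦(ten C)⟦idm a, u⟧, idm c2⟧.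
Proof. exact: (@pasteX_natr (mon_of C)). Qed.

Lemma glueC_natl' a a' a0 a1 a1' (c c1 c2 : C) (u : mor a' a0)
    (h : mor (ten C a c1) (ten C c a')) (h1 : mor (ten C a1 c2) (ten C c1 a1')) :
  glueC ((ten C)⟦idm c, u⟧ ∘ h) h1 = (ten C)⟦idm c, (ten C)⟦u, idm a1'⟧⟧ ∘ glueC h h1.
Proof. exact: (@pasteX_natl' (mon_of C)). Qed.

Lemma glueC_natr' a a' a0 a1 a1' (c c1 c2 : C) (u : mor a1' a0)
    (h : mor (ten C a c1) (ten C c a')) (h1 : mor (ten C a1 c2) (ten C c1 a1')) :
  glueC h ((ten C)⟦idm c1, u⟧ ∘ h1) = (ten C)⟦idm c, (ten C)⟦idm a', u⟧⟧ ∘ glueC h h1.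
Proof. exact: (@pasteX_natr' (mon_of C)). Qed.

Lemma glueD_natl b0 b b' b1 b1' (e e1 e2 : D) (v : mor b0 b)
    (q : mor (ten D e1 b) (ten D b' e)) (q1 : mor (ten D e2 b1) (ten D b1' e1)) :
  glueD (q ∘ (ten D)⟦idm e1, v⟧) q1 = glueD q q1 ∘ (ten D)⟦idm e2, (ten D)⟦idm b1, v⟧⟧.
Proof. exact: (@pasteX_natl (revmon (mon_of D))). Qed.

Lemma glueD_natr b b' b0 b1 b1' (e e1 e2 : D) (v : mor b0 b1)
    (q : mor (ten D e1 b) (ten D b' e)) (q1 : mor (ten D e2 b1) (ten D b1' e1)) :
  glueD q (q1 ∘ (ten D)⟦idm e2, v⟧) = glueD q q1 ∘ (ten D)⟦idm e2, (ten D)⟦v, idm b⟧⟧.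
Proof. exact: (@pasteX_natr (revmon (mon_of D))). Qed.

Lemma glueD_natl' b b' b0 b1 b1' (e e1 e2 : D) (v : mor b' b0)
    (q : mor (ten D e1 b) (ten D b' e)) (q1 : mor (ten D e2 b1) (ten D b1' e1)) :
  glueD ((ten D)⟦v, idm e⟧ ∘ q) q1 = (ten D)⟦(ten D)⟦idm b1', v⟧, idm e⟧ ∘ glueD q q1.
Proof. exact: (@pasteX_natl' (revmon (mon_of D))). Qed.

Lemma glueD_natr' b b' b0 b1 b1' (e e1 e2 : D) (v : mor b1' b0)
    (q : mor (ten D e1 b) (ten D b' e)) (q1 : mor (ten D e2 b1) (ten D b1' e1)) :
  glueD q ((ten D)⟦v, idm e1⟧ ∘ q1) = (ten D)⟦(ten D)⟦v, idm b'⟧, idm e⟧ ∘ glueD q q1.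
Proof. exact: (@pasteX_natr' (revmon (mon_of D))). Qed.

Definition unitW x : mor x (ra M (la M (one C) x) (one D)) :=
  dag (rrun (la M (one C) x)) ∘ dag (llun x).
Definition unitC (c : C) : mor (ten C (one C) c) (ten C c (one C)) := dag (run c) ∘ lun c.
Definition unitD (e : D) : mor (ten D e (one D)) (ten D (one D) e) := dag (lun e) ∘ run e.
Definition unitW' x : mor (ra M (la M (one C) x) (one D)) x :=
  llun x ∘ rrun (la M (one C) x).

Lemma glueW1l a b x y (f : mor x (ra M (la M a y) b)) :
  (ra M)⟦(la M)⟦lun a, idm y⟧, run b⟧ ∘ glueW (unitW x) f = f.
Proof. exact: (@pasteI_1l sides wall (a, b)). Qed.

Lemma glueW1r a b x y (f : mor x (ra M (la M a y) b)) :
  (ra M)⟦(la M)⟦run a, idm y⟧, lun b⟧ ∘ glueW f (unitW y) = f.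
Proof. exact: (@pasteI_1r sides wall (a, b)). Qed.

Lemma glueW'1l a b x y (g : mor (ra M (la M a y) b) x) :
  glueW' (unitW' x) g = g ∘ (ra M)⟦(la M)⟦lun a, idm y⟧, run b⟧.
Proof. by rewrite /glueW' dag_nest; exact: (@pasteO_1l sides wall (a, b)). Qed.

Lemma glueW'1r a b x y (g : mor (ra M (la M a y) b) x) :
  glueW' g (unitW' y) = g ∘ (ra M)⟦(la M)⟦run a, idm y⟧, lun b⟧.
Proof. by rewrite /glueW' dag_nest; exact: (@pasteO_1r sides wall (a, b)). Qed.

Lemma glueC1l a a' (c c1 : C) (h : mor (ten C a c1) (ten C c a')) :
  (ten C)⟦idm c, lun a'⟧ ∘ glueC (unitC c) h = h ∘ (ten C)⟦lun a, idm c1⟧.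
Proof. exact: (@pasteX_1l (mon_of C)). Qed.

Lemma glueC1r a a' (c c1 : C) (h : mor (ten C a c1) (ten C c a')) :
  (ten C)⟦idm c, run a'⟧ ∘ glueC h (unitC c1) = h ∘ (ten C)⟦run a, idm c1⟧.
Proof. exact: (@pasteX_1r (mon_of C)). Qed.

Lemma glueD1l b b' (e e1 : D) (q : mor (ten D e1 b) (ten D b' e)) :
  (ten D)⟦run b', idm e⟧ ∘ glueD (unitD e) q = q ∘ (ten D)⟦idm e1, run b⟧.
Proof. exact: (@pasteX_1l (revmon (mon_of D))). Qed.

Lemma glueD1r b b' (e e1 : D) (q : mor (ten D e1 b) (ten D b' e)) :
  (ten D)⟦lun b', idm e⟧ ∘ glueD q (unitD e1) = q ∘ (ten D)⟦idm e1, lun b⟧.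
Proof. exact: (@pasteX_1r (revmon (mon_of D))). Qed.

Lemma glueC_zigzag (c y j : C) (ev : mor (ten C y c) (one C)) (coev : mor (one C) (ten C c y))
    (o : mor (one C) j) (o' : mor j (one C)) :
  run c ∘ (ten C)⟦idm c, ev⟧ ∘ asc c y c ∘ (ten C)⟦coev, idm c⟧ ∘ dag (lun c) = idm c ->
  o' ∘ o = idm (one C) ->
  (ten C)⟦idm c, ev⟧ ∘ glueC (coev ∘ o' ∘ lun j) (ten C)⟦o, idm c⟧ =
  unitC c ∘ (ten C)⟦lun (one C), idm c⟧.
Proof. exact: (@pasteX_zigzag (mon_of C)). Qed.

(** Mirror image of [glueC_zigzag]: the zigzag of a right dual in D is that of a left dual in
    reversed D. *)
Lemma glueD_zigzag (e y j : D) (ev : mor (ten D e y) (one D)) (coev : mor (one D) (ten D y e))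
    (o : mor (one D) j) (o' : mor j (one D)) :
  lun e ∘ (ten D)⟦ev, idm e⟧ ∘ dag (asc e y e) ∘ (ten D)⟦idm e, coev⟧ ∘ dag (run e) = idm e ->
  o' ∘ o = idm (one D) ->
  (ten D)⟦ev, idm e⟧ ∘ glueD (coev ∘ o' ∘ run j) (ten D)⟦idm e, o⟧ =
  unitD e ∘ (ten D)⟦idm e, run (one D)⟧.
Proof. exact: (@pasteX_zigzag (revmon (mon_of D))). Qed.

(** The strands c and e, already absorbed in the wall label, are annihilated against the arcs y and
    v that end on the wall. *)
Definition pullW (c y : C) (e v : D) (evC : mor (ten C y c) (one C))
    (evD : mor (ten D e v) (one D)) (w : M) :
    mor (ra M (la M y (ra M (la M c w) e)) v) w :=
  unitW' w ∘ (ra M)⟦(la M)⟦evC, idm w⟧, evD⟧ ∘ nest y c w e v.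

Lemma glueW'_zigzag (c y : C) (e v : D) (evC : mor (ten C y c) (one C))
    (evD : mor (ten D e v) (one D)) (w : M) :
  glueW' (pullW evC evD w) (idm (ra M (la M c w) e)) =
  unitW' w ∘ (ra M)⟦(la M)⟦evC, idm w⟧, evD⟧.
Proof.
rewrite /glueW' dag_nest.
exact: (@pasteO_zigzag sides wall (c, e) (y, v) (evC, evD)).
Qed.

End Glue.

End Underlying.

(** * Dual bases *)

Section Linear.
Variables (K : fieldType) (U V : lmodType K) (f : U -> V).
Hypothesis lf : linear f.

Lemma plinear_D x y : f (x + y) = f x + f y.
Proof. by have := lf 1 x y; rewrite !scale1r. Qed.

Lemma plinear_0 : f 0 = 0.
Proof. by have /eqP := plinear_D 0 0; rewrite addr0 -subr_eq subrr => /eqP. Qed.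

Lemma plinear_Z a x : f (a *: x) = a *: f x.
Proof. by have := lf a x 0; rewrite plinear_0 !addr0. Qed.

Lemma plinear_sum (J : Type) (r : seq J) (P : pred J) (u : J -> U) :
  f (\sum_(j <- r | P j) u j) = \sum_(j <- r | P j) f (u j).
Proof. exact: (big_morph f plinear_D plinear_0). Qed.

Lemma plinear_B x y : f (x - y) = f x - f y.
Proof. by rewrite plinear_D -scaleN1r plinear_Z scaleN1r. Qed.

End Linear.

Section FsCat.
Variables (R : realType) (C : fscat R).
Implicit Types (x y z : C) (k : irr C).

Lemma comp_linl x y z (f : mor x y) : linear (fun g : mor y z => g ∘ f).
Proof. exact: (@comp_bilin R C x y z).1. Qed.

Lemma comp_linr x y z (g : mor y z) : linear (fun f : mor x y => g ∘ f).
Proof. exact: (@comp_bilin R C x y z).2. Qed.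

Lemma comp0r x y z (g : mor y z) : g ∘ (0 : mor x y) = 0.
Proof. exact: plinear_0 (comp_linr g). Qed.

Lemma comp0l x y z (f : mor x y) : (0 : mor y z) ∘ f = 0.
Proof. exact: plinear_0 (comp_linl f). Qed.

Lemma compZr x y z a (g : mor y z) (f : mor x y) : g ∘ (a *: f) = a *: (g ∘ f).
Proof. exact: plinear_Z (comp_linr g) a f. Qed.

Lemma compZl x y z a (g : mor y z) (f : mor x y) : (a *: g) ∘ f = a *: (g ∘ f).
Proof. exact: plinear_Z (comp_linl f) a g. Qed.

Lemma compBl x y z (g g' : mor y z) (f : mor x y) : (g - g') ∘ f = g ∘ f - g' ∘ f.
Proof. exact: plinear_B (comp_linl f) g g'. Qed.

Lemma comp_sumr x y z (J : Type) (r : seq J) (P : pred J) (g : mor y z) (f : J -> mor x y) :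
  g ∘ (\sum_(j <- r | P j) f j) = \sum_(j <- r | P j) g ∘ f j.
Proof. exact: (plinear_sum (comp_linr g)). Qed.

Lemma comp_suml x y z (J : Type) (r : seq J) (P : pred J) (g : J -> mor y z) (f : mor x y) :
  (\sum_(j <- r | P j) g j) ∘ f = \sum_(j <- r | P j) g j ∘ f.
Proof. exact: (plinear_sum (comp_linl f)). Qed.

Lemma dag0 x y : dag (0 : mor x y) = 0.
Proof.
by have := dag_antilinear (-1) (0 : mor x y) 0; rewrite scaler0 addr0 rmorphN1 scaleN1r addNr.
Qed.

(** By the C*-identity the square of the norm of f is the norm of 0. *)
Lemma dag_eq0 x y (f : mor x y) : dag f ∘ f = 0 -> f = 0.
Proof.
move=> f0; apply: nrm_eq0; apply/eqP; rewrite -sqrf_eq0 -nrm_cstar f0.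
have := nrmZ 0 (0 : mor x x); rewrite scale0r normr0 mul0r => /eqP.
by rewrite (_ : 0 = (0 : R)%:C%C) // (inj_eq (@complexI _)).
Qed.

(** Schur's lemma. For f nonzero, [dag f ∘ f] and [f ∘ dag f] are scalars a and b, equal by
    associativity and nonzero by [dag_eq0]; then [dag f] divided by a inverts f, against
    [irr_inj]. *)
Lemma irr_mor0 k k' (f : mor (irr_ob k) (irr_ob k')) : k != k' -> f = 0.
Proof.
move=> kk; apply/eqP/negPn/negP => f0.
have [n1 /(_ (dag f ∘ f)) [a fa]] := irr_simple k.
have [n2 /(_ (f ∘ dag f)) [b fb]] := irr_simple k'.
have a0 : a != 0.
  by apply/eqP => a0; case/eqP: f0; apply: dag_eq0; rewrite fa a0 scale0r.
have ab : a = b.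
  have /eqP := compA f (dag f) f; rewrite fa fb compZr compZl compm1 comp1m.
  by rewrite -subr_eq0 -scalerBl scaler_eq0 (negPf f0) orbF subr_eq0 => /eqP.
case/eqP: kk; apply: (@irr_inj R C k k' f (a^-1 *: dag f)).
by rewrite /isom compZl compZr fa fb -ab !scalerA mulVf // !scale1r.
Qed.

Lemma dual_in k x (b : dual_basis k x) (f : mor (irr_ob k) x) :
  \sum_(p < db_n b) db_in p ∘ (db_out p ∘ f) = f.
Proof.
have: f \in <<[seq db_in p | p : 'I_(db_n b)]>>%VS by rewrite (span_basis (db_basis b)) memvf.
rewrite span_def big_map big_enum => /memv_sumP[g gI ->]; apply: eq_bigr => p _.
rewrite comp_sumr (bigD1 p) //= big1 => [|q qp].
  have /vlineP[a ->] := gI p isT.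
  by rewrite compZr db_dual eqxx scale1r addr0 compZr compm1.
by have /vlineP[a ->] := gI q isT; rewrite compZr db_dual eq_sym (negPf qp) scale0r scaler0.
Qed.

(** The difference d of the two sides kills every [db_in p]. Its adjoint lies in Hom(k, x) and is
    thus a combination of the [db_in p], so d composed with its adjoint is 0, and d vanishes by
    positivity. *)
Lemma dual_out k x (b : dual_basis k x) (f : mor x (irr_ob k)) :
  \sum_(p < db_n b) (f ∘ db_in p) ∘ db_out p = f.
Proof.
apply/eqP; rewrite -subr_eq0; apply/eqP; rewrite -[LHS]dagK.
set d := _ - _; suff -> : dag d = 0.
  by rewrite dag0.
apply: dag_eq0; rewrite dagK -[dag d](dual_in b) comp_sumr big1 // => p _.
rewrite compA /d compBl comp_suml (bigD1 p) //= big1 => [|q qp].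
  by rewrite -compA db_dual eqxx scale1r compm1 addr0 subrr comp0l.
by rewrite -compA db_dual (negPf qp) scale0r comp0r.
Qed.

Lemma irr_scalar k (f : mor (irr_ob k) (irr_ob k)) : exists a, f = a *: idm _.
Proof. by have [_ /(_ f)] := irr_simple k. Qed.

(* The element sum_p out_p (x) in_p is dinatural, in particular it does not
   depend on the dual bases. *)
Lemma dual_slide k x x' (b : dual_basis k x) (b' : dual_basis k x') (u : mor x x')
    (W : lmodType R[i]) (F : mor x (irr_ob k) -> mor (irr_ob k) x' -> W) : bilin F ->
  \sum_(i < db_n b') F (db_out i ∘ u) (db_in i) = \sum_(j < db_n b) F (db_out j) (u ∘ db_in j).
Proof.
case=> Fl Fr.
transitivity (\sum_(i < db_n b') \sum_(j < db_n b) F (db_out i ∘ u ∘ db_in j ∘ db_out j) (db_in i)).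
  by apply: eq_bigr => i _; rewrite -{1}(dual_out b (db_out i ∘ u)) (plinear_sum (Fl _)).
rewrite exchange_big; apply: eq_bigr => j _ /=.
rewrite -[in RHS](dual_in b' (u ∘ db_in j)) (plinear_sum (Fr _)); apply: eq_bigr => i _.
have [a e] := irr_scalar (db_out i ∘ u ∘ db_in j).
rewrite e (compA (db_out i)) e compZl compZr comp1m compm1.
by rewrite (plinear_Z (Fl _)) (plinear_Z (Fr _)).
Qed.

(** It suffices to test on the inclusion of each simple summand of x: there the terms of other
    labels vanish by Schur's lemma, and the remaining label is [dual_in]. *)
Lemma dual_complete (b : forall k x, dual_basis k x) x :
  \sum_k \sum_(p < db_n (b k x)) db_in p ∘ db_out p = idm x.
Proof.
have [n [l [v [_ _ dv]]]] := fs_semisimple x.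
apply/eqP; rewrite -subr_eq0; apply/eqP; set e := _ - _.
rewrite -[LHS]compm1 -dv comp_sumr big1 // => q _; rewrite compA.
suff -> : e ∘ v q = 0 by rewrite comp0l.
rewrite /e compBl comp1m comp_suml (bigD1 (l q)) //= [X in _ + X - _]big1 => [|k kl].
  rewrite addr0 comp_suml -[X in _ - X](dual_in (b (l q) x)).
  by apply/eqP; rewrite subr_eq0; apply/eqP; apply: eq_bigr => p _; rewrite compA.
rewrite comp_suml big1 // => p _; rewrite -compA.
by rewrite (irr_mor0 (db_out p ∘ v q)) ?comp0r // eq_sym.
Qed.

Lemma dual_complete_lin (b : forall k x, dual_basis k x) x (W : lmodType R[i])
    (F : mor x x -> W) : linear F ->
  \sum_k \sum_(p < db_n (b k x)) F (db_in p ∘ db_out p) = F (idm x).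
Proof.
move=> lF; rewrite -(dual_complete b) (plinear_sum lF).
by apply: eq_bigr => k _; rewrite (plinear_sum lF).
Qed.

(** Each [db_out p] is a scalar, which bilinearity moves to the other argument, where [dual_in] sums
    the terms to the identity. *)
Lemma dual_irr k (b : dual_basis k (irr_ob k)) (W : lmodType R[i])
    (F : mor (irr_ob k) (irr_ob k) -> mor (irr_ob k) (irr_ob k) -> W) : bilin F ->
  \sum_(p < db_n b) F (db_out p) (db_in p) = F (idm _) (idm _).
Proof.
case=> Fl Fr; rewrite -[X in _ = F _ X](dual_in b (idm _)) (plinear_sum (Fr _)).
apply: eq_bigr => p _; have [a ->] := irr_scalar (db_out p).
by rewrite compm1 compZr compm1 (plinear_Z (Fl _)) (plinear_Z (Fr _)).
Qed.

End FsCat.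

(** * Annuli with arbitrary objects on the arcs *)

Section TensorLinear.
Variable K : fieldType.

Lemma plinear_sumf (U V : lmodType K) (J : Type) (r : seq J) (P : pred J) (f : J -> U -> V) :
  (forall j, linear (f j)) -> linear (fun u => \sum_(j <- r | P j) f j u).
Proof.
move=> lf a x y; rewrite scaler_sumr -big_split.
by apply: eq_bigr => j _; rewrite lf.
Qed.

Section Pure4.
Variables V1 V2 V3 V4 : vectType K.

Lemma pure4P1 a (v1 v1' : V1) (v2 : V2) (v3 : V3) (v4 : V4) :
  pure4 (a *: v1 + v1') v2 v3 v4 = a *: pure4 v1 v2 v3 v4 + pure4 v1' v2 v3 v4.
Proof. exact: (pure_bilin _ _).1. Qed.

Lemma pure4P2 a (v1 : V1) (v2 v2' : V2) (v3 : V3) (v4 : V4) :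
  pure4 v1 (a *: v2 + v2') v3 v4 = a *: pure4 v1 v2 v3 v4 + pure4 v1 v2' v3 v4.
Proof. by rewrite /pure4 (pure_bilin _ _).1 (pure_bilin _ _).2. Qed.

Lemma pure4P3 a (v1 : V1) (v2 : V2) (v3 v3' : V3) (v4 : V4) :
  pure4 v1 v2 (a *: v3 + v3') v4 = a *: pure4 v1 v2 v3 v4 + pure4 v1 v2 v3' v4.
Proof. by rewrite /pure4 (pure_bilin _ _).1 !(pure_bilin _ _).2. Qed.

Lemma pure4P4 a (v1 : V1) (v2 : V2) (v3 : V3) (v4 v4' : V4) :
  pure4 v1 v2 v3 (a *: v4 + v4') = a *: pure4 v1 v2 v3 v4 + pure4 v1 v2 v3 v4'.
Proof. by rewrite /pure4 !(pure_bilin _ _).2. Qed.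

Lemma tensor_ind (V W : vectType K) (P : tensor V W -> Prop) :
  P 0 -> (forall s t, P s -> P t -> P (s + t)) -> (forall v w, P (pure v w)) ->
  forall t, P t.
Proof.
move=> P0 PD Pp t; rewrite [t]tensor_exp.
apply: big_ind => // i _; apply: big_ind => // j _.
by rewrite -[_ *: _]addr0 -(plinear_0 ((pure_bilin V W).1 (vbasis {:W})`_j)) -(pure_bilin V W).1.
Qed.

Lemma tensor4_ind (P : tensor4 V1 V2 V3 V4 -> Prop) :
  P 0 -> (forall s t, P s -> P t -> P (s + t)) ->
  (forall v1 v2 v3 v4, P (pure4 v1 v2 v3 v4)) -> forall t, P t.
Proof.
move=> P0 PD Pp; apply: tensor_ind => // v1.
have l1 := (pure_bilin V1 (tensor V2 (tensor V3 V4))).2 v1.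
apply: tensor_ind => [|s t Ps Pt|v2]; first by rewrite (plinear_0 l1).
  by rewrite (plinear_D l1); apply: PD.
have l2 := (pure_bilin V2 (tensor V3 V4)).2 v2.
apply: tensor_ind => [|s t Ps Pt|v3 v4]; last exact: Pp.
  by rewrite (plinear_0 l2) (plinear_0 l1).
by rewrite (plinear_D l2) (plinear_D l1); apply: PD.
Qed.

Lemma tlift_lin (V W : vectType K) (U : lmodType K) (f g h : V -> W -> U) a t :
  (forall v w, f v w = a *: g v w + h v w) -> tlift f t = a *: tlift g t + tlift h t.
Proof.
move=> e; rewrite /tlift scaler_sumr -big_split; apply: eq_bigr => i _ /=.
rewrite scaler_sumr -big_split; apply: eq_bigr => j _ /=.
by rewrite e scalerDr !scalerA mulrC.
Qed.

Lemma tlift4_lin (U : lmodType K) (f g h : V1 -> V2 -> V3 -> V4 -> U) a t :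
  (forall v1 v2 v3 v4, f v1 v2 v3 v4 = a *: g v1 v2 v3 v4 + h v1 v2 v3 v4) ->
  tlift4 f t = a *: tlift4 g t + tlift4 h t.
Proof. by move=> e; do 2![apply: tlift_lin => ? ?]; apply: tlift_lin. Qed.

Lemma tlift4_linear (U : lmodType K) (f : V1 -> V2 -> V3 -> V4 -> U) : linear (tlift4 f).
Proof. exact: tlift_linear. Qed.

Lemma tlift4_pure4 (U : lmodType K) (f : V1 -> V2 -> V3 -> V4 -> U) v1 v2 v3 v4 :
  (forall v2 v3 v4, linear (fun v1 => f v1 v2 v3 v4)) ->
  (forall v1 v3 v4, linear (fun v2 => f v1 v2 v3 v4)) ->
  (forall v1 v2 v4, linear (fun v3 => f v1 v2 v3 v4)) ->
  (forall v1 v2 v3, linear (fun v4 => f v1 v2 v3 v4)) ->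
  tlift4 f (pure4 v1 v2 v3 v4) = f v1 v2 v3 v4.
Proof.
move=> l1 l2 l3 l4; rewrite /tlift4 /pure4.
rewrite tlift_pure; last first.
  split=> [t a x y|x]; last exact: tlift_linear.
  by apply: tlift_lin => ? ?; apply: tlift_lin => ? ?; exact: l1.
rewrite tlift_pure; last first.
  split=> [t a x y|x]; last exact: tlift_linear.
  by apply: tlift_lin => ? ?; exact: l2.
by rewrite tlift_pure.
Qed.

End Pure4.
End TensorLinear.

Section DirectSumMaps.
Variable K : fieldType.

Section OneSum.
Variables (I : finType) (V : I -> vectType K).

Lemma dsum_ofE (f : forall i, V i) i : dsum_of f i = f i.
Proof. exact: ffunE. Qed.

Lemma dsumP a (u v : dsum V) i : (a *: u + v) i = a *: u i + v i.
Proof. by rewrite !ffunE. Qed.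

Lemma dsum_coord_linear i : linear (fun u : dsum V => u i).
Proof. by move=> a u v; rewrite dsumP. Qed.

Lemma dsum_ext (u v : dsum V) : (forall i, u i = v i) -> u = v.
Proof. by move=> uv; apply/ffunP. Qed.

Lemma dsum_in_same i (v : V i) : dsum_in v i = v.
Proof. by rewrite dsum_ofE dfwith_in. Qed.

Lemma dsum_in_other i j (v : V i) : i != j -> dsum_in v j = 0.
Proof. by move=> ij; rewrite dsum_ofE dfwith_out. Qed.

Lemma dsum_of_linear (U : lmodType K) (f : U -> forall i, V i) :
  (forall i, linear (fun u => f u i)) -> linear (fun u => dsum_of (f u)).
Proof. by move=> lf a u v; apply: dsum_ext => i; rewrite dsumP !dsum_ofE lf. Qed.

Lemma dsum_in_linear i : linear (@dsum_in K I V i).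
Proof.
move=> a u v; apply: dsum_ext => j; rewrite dsumP.
have [<-|ij] := eqVneq i j; first by rewrite !dsum_in_same.
by rewrite !dsum_in_other // scaler0 addr0.
Qed.

Lemma dsum_ind (P : dsum V -> Prop) :
  P 0 -> (forall s t, P s -> P t -> P (s + t)) -> (forall i (v : V i), P (dsum_in v)) ->
  forall t, P t.
Proof.
move=> P0 PD Pin t; have -> : t = \sum_i dsum_in (t i).
  apply: dsum_ext => j; rewrite (plinear_sum (dsum_coord_linear j)) (bigD1 j) //=.
  rewrite dsum_in_same big1 ?addr0 // => i ij; exact: dsum_in_other.
by apply: big_ind.
Qed.

End OneSum.

Variables (I I1 I2 : finType) (V : I -> vectType K) (V1 : I1 -> vectType K).
Variables (V2 : I2 -> vectType K) (G : forall i k k', V1 k -> V2 k' -> V i).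
Hypothesis bG : forall i k k', bilin (@G i k k').

Definition dsum_mul (u : dsum V1) (v : dsum V2) : dsum V :=
  dsum_of (fun i => \sum_k \sum_k' G i (u k) (v k')).

Lemma dsum_mul_bilin : bilin dsum_mul.
Proof.
split=> t; apply: dsum_of_linear => i; do 2![apply: plinear_sumf => ?] => a u v.
  by rewrite dsumP (bG _ _ _).1.
by rewrite dsumP (bG _ _ _).2.
Qed.

Lemma dsum_mul_in k k' (x : V1 k) (y : V2 k') :
  dsum_mul (dsum_in x) (dsum_in y) = dsum_of (fun i => G i x y).
Proof.
apply: dsum_ext => i; rewrite !dsum_ofE (bigD1 k) //= [X in _ + X]big1 => [|l lk].
  rewrite addr0 (bigD1 k') //= [X in _ + X]big1 => [|l lk].
    by rewrite addr0 !dsum_in_same.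
  by rewrite (dsum_in_other y) 1?eq_sym // (plinear_0 ((bG _ _ _).2 _)).
apply: big1 => l' _.
by rewrite dsum_in_other 1?eq_sym // (plinear_0 ((bG _ _ _).1 _)).
Qed.

End DirectSumMaps.

Section Multi.
Variables (R : realType) (X Y Z : cstarcat R).

Lemma bfPl (F : bifunctor X Y Z) x x' y y' a (f f' : mor x x') (g : mor y y') :
  F⟦a *: f + f', g⟧ = a *: F⟦f, g⟧ + F⟦f', g⟧.
Proof. exact: (bf_bilin F _ _ _ _).1. Qed.

Lemma bfPr (F : bifunctor X Y Z) x x' y y' a (f : mor x x') (g g' : mor y y') :
  F⟦f, a *: g + g'⟧ = a *: F⟦f, g⟧ + F⟦f, g'⟧.
Proof. exact: (bf_bilin F _ _ _ _).2. Qed.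

Lemma compPl (x y z : X) a (g g' : mor y z) (f : mor x y) :
  (a *: g + g') ∘ f = a *: (g ∘ f) + g' ∘ f.
Proof. exact: (@comp_bilin R X x y z).1. Qed.

Lemma compPr (x y z : X) a (g : mor y z) (f f' : mor x y) :
  g ∘ (a *: f + f') = a *: (g ∘ f) + g ∘ f'.
Proof. exact: (@comp_bilin R X x y z).2. Qed.

End Multi.

Definition multiP := (bfPl, bfPr, compPl, compPr).
Lemma arcs_neq (R : realType) (C D : fuscat R) (k k' : arcs C D) : k != k' ->
  [|| k.1.1.1 != k'.1.1.1, k.1.1.2 != k'.1.1.2, k.1.2 != k'.1.2 | k.2 != k'.2].
Proof.
apply: contraR; rewrite !negb_or !negbK.
by case: k k' => [[[? ?] ?] ?] [[[? ?] ?] ?] /= /and4P[/eqP-> /eqP-> /eqP-> /eqP->].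
Qed.

(** * Expansion of a quadruple (f, h, q, g) in simple arc labels *)

Section Compress.
Variables (R : realType) (C D : fuscat R) (M : bimodcat C D).
Variable dbC : forall (k : irr C) (x : C), dual_basis k x.
Variable dbD : forall (k : irr D) (x : D), dual_basis k x.
Variables (x z w u : M) (c c' : C) (e e' : D).

Local Notation "a ⊗ b" := (ten _ a b) (at level 38, left associativity).
Local Notation "a ⊳ m" := (la M a m) (at level 37, right associativity).
Local Notation "m ⊲ b" := (ra M m b) (at level 39, left associativity).
Local Notation id := idm.

Definition block (k : arcs C D) : vectType R[i] :=
  tensor4 (mor x ((arcL1 k ⊳ z) ⊲ arcR1 k)) (mor (arcL1 k ⊗ c') (c ⊗ arcL2 k))
    (mor (e' ⊗ arcR1 k) (arcR2 k ⊗ e)) (mor ((arcL2 k ⊳ u) ⊲ arcR2 k) w).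

Section Arcs.
Variables (A A' : C) (B B' : D).
Implicit Types (f : mor x ((A ⊳ z) ⊲ B)) (h : mor (A ⊗ c') (c ⊗ A'))
  (q : mor (e' ⊗ B) (B' ⊗ e)) (g : mor ((A' ⊳ u) ⊲ B') w).

Definition compress_at k f h q g : block k :=
  \sum_(i < db_n (dbC k.1.1.1 A)) \sum_(i' < db_n (dbC k.1.1.2 A'))
  \sum_(j < db_n (dbD k.1.2 B)) \sum_(j' < db_n (dbD k.2 B'))
    pure4
      ((ra M)⟦(la M)⟦db_out i, id z⟧, db_out j⟧ ∘ f)
      ((ten C)⟦id c, db_out i'⟧ ∘ h ∘ (ten C)⟦db_in i, id c'⟧)
      ((ten D)⟦db_out j', id e⟧ ∘ q ∘ (ten D)⟦id e', db_in j⟧)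
      (g ∘ (ra M)⟦(la M)⟦db_in i', id u⟧, db_in j'⟧).

(* The annulus with arbitrary objects on its arcs, expanded in simple ones. *)
Definition compress f h q g : dsum block := dsum_of (fun k => compress_at k f h q g).

Lemma compressE k f h q g : compress f h q g k = compress_at k f h q g.
Proof. exact: ffunE. Qed.

Lemma compress_at_linear k (f0 : mor x ((A ⊳ z) ⊲ B)) h0 q0 g0 :
  [/\ linear (fun f => compress_at k f h0 q0 g0), linear (fun h => compress_at k f0 h q0 g0),
      linear (fun q => compress_at k f0 h0 q g0) & linear (fun g => compress_at k f0 h0 q0 g)].
Proof.
split.
- by do 4!apply: plinear_sumf => ?; move=> ? ? ?; cbv beta; rewrite !multiP pure4P1.
- by do 4!apply: plinear_sumf => ?; move=> ? ? ?; cbv beta; rewrite !multiP pure4P2.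
- by do 4!apply: plinear_sumf => ?; move=> ? ? ?; cbv beta; rewrite !multiP pure4P3.
by do 4!apply: plinear_sumf => ?; move=> ? ? ?; cbv beta; rewrite !multiP pure4P4.
Qed.

Lemma compress_atP1 k a f f' h q g :
  compress_at k (a *: f + f') h q g = a *: compress_at k f h q g + compress_at k f' h q g.
Proof. by have [-> _ _ _] := compress_at_linear k f h q g. Qed.

Lemma compress_atP2 k a f h h' q g :
  compress_at k f (a *: h + h') q g = a *: compress_at k f h q g + compress_at k f h' q g.
Proof. by have [_ -> _ _] := compress_at_linear k f h q g. Qed.

Lemma compress_atP3 k a f h q q' g :
  compress_at k f h (a *: q + q') g = a *: compress_at k f h q g + compress_at k f h q' g.
Proof. by have [_ _ -> _] := compress_at_linear k f h q g. Qed.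

Lemma compress_atP4 k a f h q g g' :
  compress_at k f h q (a *: g + g') = a *: compress_at k f h q g + compress_at k f h q g'.
Proof. by have [_ _ _ ->] := compress_at_linear k f h q g. Qed.

Lemma compress_linear (f0 : mor x ((A ⊳ z) ⊲ B)) h0 q0 g0 :
  [/\ linear (fun f => compress f h0 q0 g0), linear (fun h => compress f0 h q0 g0),
      linear (fun q => compress f0 h0 q g0) & linear (fun g => compress f0 h0 q0 g)].
Proof.
by split; apply: dsum_of_linear => k; have [] := compress_at_linear k f0 h0 q0 g0.
Qed.

End Arcs.

Section Slides.
Variables (A A0 A' A0' : C) (B B0 B' B0' : D).

(** Dinaturality in the arcs that leave the factor f; [compress_slidei] is the same for the arcs
    that enter g. Both apply [dual_slide] to the C arc and then to the D arc. *)
Lemma compress_slideo (t : mor A A0) (v : mor B B0) (f : mor x ((A ⊳ z) ⊲ B))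
    (h : mor (A0 ⊗ c') (c ⊗ A')) (q : mor (e' ⊗ B0) (B' ⊗ e)) (g : mor ((A' ⊳ u) ⊲ B') w) :
  compress ((ra M)⟦(la M)⟦t, id z⟧, v⟧ ∘ f) h q g =
  compress f (h ∘ (ten C)⟦t, id c'⟧) (q ∘ (ten D)⟦id e', v⟧) g.
Proof.
apply/ffunP => k; rewrite !compressE /compress_at.
transitivity (\sum_(i < db_n (dbC k.1.1.1 A0)) \sum_(i' < db_n (dbC k.1.1.2 A'))
  \sum_(j < db_n (dbD k.1.2 B0)) \sum_(j' < db_n (dbD k.2 B'))
    pure4
      ((ra M)⟦(la M)⟦db_out i ∘ t, id z⟧, db_out j ∘ v⟧ ∘ f)
      ((ten C)⟦id c, db_out i'⟧ ∘ h ∘ (ten C)⟦db_in i, id c'⟧)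
      ((ten D)⟦db_out j', id e⟧ ∘ q ∘ (ten D)⟦id e', db_in j⟧)
      (g ∘ (ra M)⟦(la M)⟦db_in i', id u⟧, db_in j'⟧)).
  do 4![apply: eq_bigr => ? _].
  by rewrite compA -bf_comp -bf_comp comp1m.
(* The sum over one dual basis is isolated: F takes the pair of dual basis elements of the left arc,
   and G below that of the right arc. *)
pose F := fun (al : mor A (irr_ob k.1.1.1)) (be : mor (irr_ob k.1.1.1) A0) =>
  \sum_(i' < db_n (dbC k.1.1.2 A'))
  \sum_(j < db_n (dbD k.1.2 B0)) \sum_(j' < db_n (dbD k.2 B'))
    pure4
      ((ra M)⟦(la M)⟦al, id z⟧, db_out j ∘ v⟧ ∘ f)
      ((ten C)⟦id c, db_out i'⟧ ∘ h ∘ (ten C)⟦be, id c'⟧)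
      ((ten D)⟦db_out j', id e⟧ ∘ q ∘ (ten D)⟦id e', db_in j⟧)
      (g ∘ (ra M)⟦(la M)⟦db_in i', id u⟧, db_in j'⟧).
rewrite (@dual_slide _ _ _ _ _ (dbC _ A) _ _ _ F); last first.
  split=> s; do 3!apply: plinear_sumf => ?; move=> ? ? ?; cbv beta;
    by rewrite !multiP ?pure4P1 ?pure4P2.
apply: eq_bigr => i _; apply: eq_bigr => i' _.
pose G := fun (al : mor B (irr_ob k.1.2)) (be : mor (irr_ob k.1.2) B0) =>
  \sum_(j' < db_n (dbD k.2 B'))
    pure4
      ((ra M)⟦(la M)⟦db_out i, id z⟧, al⟧ ∘ f)
      ((ten C)⟦id c, db_out i'⟧ ∘ h ∘ (ten C)⟦t ∘ db_in i, id c'⟧)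
      ((ten D)⟦db_out j', id e⟧ ∘ q ∘ (ten D)⟦id e', be⟧)
      (g ∘ (ra M)⟦(la M)⟦db_in i', id u⟧, db_in j'⟧).
rewrite (@dual_slide _ _ _ _ _ (dbD _ B) _ _ _ G); last first.
  by split=> s; apply: plinear_sumf => ?; move=> ? ? ?; cbv beta; rewrite !multiP ?pure4P1 ?pure4P3.
apply: eq_bigr => j _; apply: eq_bigr => j' _.
by congr (pure4 _ _ _ _); rewrite -!compA -bf_comp comp1m.
Qed.

Lemma compress_slidei (t : mor A' A0') (v : mor B' B0') (f : mor x ((A ⊳ z) ⊲ B))
    (h : mor (A ⊗ c') (c ⊗ A')) (q : mor (e' ⊗ B) (B' ⊗ e)) (g : mor ((A0' ⊳ u) ⊲ B0') w) :
  compress f ((ten C)⟦id c, t⟧ ∘ h) ((ten D)⟦v, id e⟧ ∘ q) g =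
  compress f h q (g ∘ (ra M)⟦(la M)⟦t, id u⟧, v⟧).
Proof.
apply/ffunP => k; rewrite !compressE /compress_at.
transitivity (\sum_(i < db_n (dbC k.1.1.1 A)) \sum_(i' < db_n (dbC k.1.1.2 A0'))
  \sum_(j < db_n (dbD k.1.2 B)) \sum_(j' < db_n (dbD k.2 B0'))
    pure4
      ((ra M)⟦(la M)⟦db_out i, id z⟧, db_out j⟧ ∘ f)
      ((ten C)⟦id c, db_out i' ∘ t⟧ ∘ h ∘ (ten C)⟦db_in i, id c'⟧)
      ((ten D)⟦db_out j' ∘ v, id e⟧ ∘ q ∘ (ten D)⟦id e', db_in j⟧)
      (g ∘ (ra M)⟦(la M)⟦db_in i', id u⟧, db_in j'⟧)).
  do 4![apply: eq_bigr => ? _].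
  by rewrite !compA -bf_comp comp1m -bf_comp comp1m.
apply: eq_bigr => i _.
pose F := fun (al : mor A' (irr_ob k.1.1.2)) (be : mor (irr_ob k.1.1.2) A0') =>
  \sum_(j < db_n (dbD k.1.2 B)) \sum_(j' < db_n (dbD k.2 B0'))
    pure4
      ((ra M)⟦(la M)⟦db_out i, id z⟧, db_out j⟧ ∘ f)
      ((ten C)⟦id c, al⟧ ∘ h ∘ (ten C)⟦db_in i, id c'⟧)
      ((ten D)⟦db_out j' ∘ v, id e⟧ ∘ q ∘ (ten D)⟦id e', db_in j⟧)
      (g ∘ (ra M)⟦(la M)⟦be, id u⟧, db_in j'⟧).
rewrite (@dual_slide _ _ _ _ _ (dbC _ A') _ _ _ F); last first.
  split=> s; do 2!apply: plinear_sumf => ?; move=> ? ? ?; cbv beta;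
    by rewrite !multiP ?pure4P2 ?pure4P4.
apply: eq_bigr => i' _; apply: eq_bigr => j _.
pose G := fun (al : mor B' (irr_ob k.2)) (be : mor (irr_ob k.2) B0') =>
    pure4
      ((ra M)⟦(la M)⟦db_out i, id z⟧, db_out j⟧ ∘ f)
      ((ten C)⟦id c, db_out i'⟧ ∘ h ∘ (ten C)⟦db_in i, id c'⟧)
      ((ten D)⟦al, id e⟧ ∘ q ∘ (ten D)⟦id e', db_in j⟧)
      (g ∘ (ra M)⟦(la M)⟦t ∘ db_in i', id u⟧, be⟧).
rewrite (@dual_slide _ _ _ _ _ (dbD _ B') _ _ _ G); last first.
  by split=> s; move=> ? ? ?; rewrite /G !multiP ?pure4P3 ?pure4P4.
apply: eq_bigr => j' _.
by congr (pure4 _ _ _ _); rewrite -!compA -!bf_comp comp1m.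
Qed.

End Slides.

(** The two slides combined. Later identities between annuli are proved by naming four arc morphisms
    that intertwine the factors. These may be non-invertible, for instance evaluations. *)
Lemma compress_mor (A A0 A' A0' : C) (B B0 B' B0' : D) (t : mor A A0) (v : mor B B0)
    (t' : mor A' A0') (v' : mor B' B0') (f : mor x ((A ⊳ z) ⊲ B)) (h : mor (A ⊗ c') (c ⊗ A'))
    (q : mor (e' ⊗ B) (B' ⊗ e)) (g : mor ((A' ⊳ u) ⊲ B') w) (f0 : mor x ((A0 ⊳ z) ⊲ B0))
    (h0 : mor (A0 ⊗ c') (c ⊗ A0')) (q0 : mor (e' ⊗ B0) (B0' ⊗ e))
    (g0 : mor ((A0' ⊳ u) ⊲ B0') w) :
  (ra M)⟦(la M)⟦t, id z⟧, v⟧ ∘ f = f0 ->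
  (ten C)⟦id c, t'⟧ ∘ h = h0 ∘ (ten C)⟦t, id c'⟧ ->
  (ten D)⟦v', id e⟧ ∘ q = q0 ∘ (ten D)⟦id e', v⟧ ->
  g0 ∘ (ra M)⟦(la M)⟦t', id u⟧, v'⟧ = g ->
  compress f h q g = compress f0 h0 q0 g0.
Proof.
by move=> <- hh qq <-; rewrite -compress_slidei hh qq -compress_slideo.
Qed.

(** The maps [phi] and [psi] insert the resolution of the identity of X and Y into arcs that merely
    contain them, typically as one tensor factor of a glued arc. *)
Lemma compress_completeo (A A' X : C) (B B' Y : D) (f : mor x ((A ⊳ z) ⊲ B))
    (h : mor (A ⊗ c') (c ⊗ A')) (q : mor (e' ⊗ B) (B' ⊗ e)) (g : mor ((A' ⊳ u) ⊲ B') w)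
    (phi : mor X X -> mor A A) (psi : mor Y Y -> mor B B) :
  linear phi -> linear psi -> phi (id X) = id A -> psi (id Y) = id B ->
  \sum_a \sum_(i < db_n (dbC a X)) \sum_b \sum_(j < db_n (dbD b Y))
    compress f (h ∘ (ten C)⟦phi (db_in i ∘ db_out i), id c'⟧)
      (q ∘ (ten D)⟦id e', psi (db_in j ∘ db_out j)⟧) g =
  compress f h q g.
Proof.
move=> lphi lpsi phi1 psi1; have [_ l2 _ _] := compress_linear f h q g.
pose F t := compress f (h ∘ (ten C)⟦phi t, id c'⟧) q g.
have lF : linear F by move=> a t t'; rewrite /F lphi !multiP l2.
transitivity (F (id X)); last by rewrite /F phi1 bf_id compm1.
rewrite -(dual_complete_lin dbC lF); apply: eq_bigr => a _; apply: eq_bigr => i _.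
rewrite /F; set hi := h ∘ _; have [_ _ l3 _] := compress_linear f hi q g.
pose G t := compress f hi (q ∘ (ten D)⟦id e', psi t⟧) g.
have lG : linear G by move=> b t t'; rewrite /G lpsi !multiP l3.
transitivity (G (id Y)); last by rewrite /G psi1 bf_id compm1.
by rewrite -(dual_complete_lin dbD lG).
Qed.

Lemma compress_completei (A A' X : C) (B B' Y : D) (f : mor x ((A ⊳ z) ⊲ B))
    (h : mor (A ⊗ c') (c ⊗ A')) (q : mor (e' ⊗ B) (B' ⊗ e)) (g : mor ((A' ⊳ u) ⊲ B') w)
    (phi : mor X X -> mor A' A') (psi : mor Y Y -> mor B' B') :
  linear phi -> linear psi -> phi (id X) = id A' -> psi (id Y) = id B' ->
  \sum_a \sum_(i < db_n (dbC a X)) \sum_b \sum_(j < db_n (dbD b Y))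
    compress f ((ten C)⟦id c, phi (db_in i ∘ db_out i)⟧ ∘ h)
      ((ten D)⟦psi (db_in j ∘ db_out j), id e⟧ ∘ q) g =
  compress f h q g.
Proof.
move=> lphi lpsi phi1 psi1; have [_ l2 _ _] := compress_linear f h q g.
pose F t := compress f ((ten C)⟦id c, phi t⟧ ∘ h) q g.
have lF : linear F by move=> a t t'; rewrite /F lphi !multiP l2.
transitivity (F (id X)); last by rewrite /F phi1 bf_id comp1m.
rewrite -(dual_complete_lin dbC lF); apply: eq_bigr => a _; apply: eq_bigr => i _.
rewrite /F; set hi := _ ∘ h; have [_ _ l3 _] := compress_linear f hi q g.
pose G t := compress f hi ((ten D)⟦psi t, id e⟧ ∘ q) g.
have lG : linear G by move=> b t t'; rewrite /G lpsi !multiP l3.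
transitivity (G (id Y)); last by rewrite /G psi1 bf_id comp1m.
by rewrite -(dual_complete_lin dbD lG).
Qed.

Lemma linear_id (U : lmodType R[i]) : linear (fun v : U => v).
Proof. by []. Qed.

Lemma compress_expando (A A' : C) (B B' : D) (f : mor x ((A ⊳ z) ⊲ B))
    (h : mor (A ⊗ c') (c ⊗ A')) (q : mor (e' ⊗ B) (B' ⊗ e)) (g : mor ((A' ⊳ u) ⊲ B') w) :
  compress f h q g =
  \sum_a \sum_(i < db_n (dbC a A)) \sum_b \sum_(j < db_n (dbD b B))
    compress ((ra M)⟦(la M)⟦db_out i, id z⟧, db_out j⟧ ∘ f)
      (h ∘ (ten C)⟦db_in i, id c'⟧) (q ∘ (ten D)⟦id e', db_in j⟧) g.
Proof.
rewrite -(compress_completeo f h q g (linear_id (U := _)) (linear_id (U := _)) erefl erefl).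
do 4![apply: eq_bigr => ? _].
by rewrite compress_slideo -!compA -!bf_comp !comp1m.
Qed.

Lemma compress_expandi (A A' : C) (B B' : D) (f : mor x ((A ⊳ z) ⊲ B))
    (h : mor (A ⊗ c') (c ⊗ A')) (q : mor (e' ⊗ B) (B' ⊗ e)) (g : mor ((A' ⊳ u) ⊲ B') w) :
  compress f h q g =
  \sum_a \sum_(i < db_n (dbC a A')) \sum_b \sum_(j < db_n (dbD b B'))
    compress f ((ten C)⟦id c, db_out i⟧ ∘ h) ((ten D)⟦db_out j, id e⟧ ∘ q)
      (g ∘ (ra M)⟦(la M)⟦db_in i, id u⟧, db_in j⟧).
Proof.
rewrite -(compress_completei f h q g (linear_id (U := _)) (linear_id (U := _)) erefl erefl).
do 4![apply: eq_bigr => ? _].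
by rewrite -compress_slidei !compA -!bf_comp !comp1m.
Qed.

Section Irr.
Variable k : arcs C D.
Variables (f : mor x ((arcL1 k ⊳ z) ⊲ arcR1 k)) (h : mor (arcL1 k ⊗ c') (c ⊗ arcL2 k)).
Variables (q : mor (e' ⊗ arcR1 k) (arcR2 k ⊗ e)) (g : mor ((arcL2 k ⊳ u) ⊲ arcR2 k) w).

Let F k0 (al1 : mor (arcL1 k) (arcL1 k0)) (be1 : mor (arcL1 k0) (arcL1 k))
    (al2 : mor (arcL2 k) (arcL2 k0)) (be2 : mor (arcL2 k0) (arcL2 k))
    (al3 : mor (arcR1 k) (arcR1 k0)) (be3 : mor (arcR1 k0) (arcR1 k))
    (al4 : mor (arcR2 k) (arcR2 k0)) (be4 : mor (arcR2 k0) (arcR2 k)) : block k0 :=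
  pure4
    ((ra M)⟦(la M)⟦al1, id z⟧, al3⟧ ∘ f)
    ((ten C)⟦id c, al2⟧ ∘ h ∘ (ten C)⟦be1, id c'⟧)
    ((ten D)⟦al4, id e⟧ ∘ q ∘ (ten D)⟦id e', be3⟧)
    (g ∘ (ra M)⟦(la M)⟦be2, id u⟧, be4⟧).

Let bilinF1 k0 al2 be2 al3 be3 al4 be4 :
  bilin (fun al1 be1 => F (k0 := k0) al1 be1 al2 be2 al3 be3 al4 be4).
Proof. by split=> ? ? ? ?; rewrite /F !multiP ?pure4P1 ?pure4P2. Qed.

Let bilinF2 k0 al1 be1 al3 be3 al4 be4 :
  bilin (fun al2 be2 => F (k0 := k0) al1 be1 al2 be2 al3 be3 al4 be4).
Proof. by split=> ? ? ? ?; rewrite /F !multiP ?pure4P2 ?pure4P4. Qed.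

Let bilinF3 k0 al1 be1 al2 be2 al4 be4 :
  bilin (fun al3 be3 => F (k0 := k0) al1 be1 al2 be2 al3 be3 al4 be4).
Proof. by split=> ? ? ? ?; rewrite /F !multiP ?pure4P1 ?pure4P3. Qed.

Let bilinF4 k0 al1 be1 al2 be2 al3 be3 :
  bilin (fun al4 be4 => F (k0 := k0) al1 be1 al2 be2 al3 be3 al4 be4).
Proof. by split=> ? ? ? ?; rewrite /F !multiP ?pure4P3 ?pure4P4. Qed.

Lemma compress_irr_at : compress_at k f h q g = pure4 f h q g.
Proof.
transitivity (F (k0 := k) (id _) (id _) (id _) (id _) (id _) (id _) (id _) (id _)); last first.
  by rewrite /F !bf_id !comp1m !compm1.
rewrite -(dual_irr (dbC k.1.1.1 _) (bilinF1 _ _ _ _ _ _)); apply: eq_bigr => i _.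
rewrite -(dual_irr (dbC k.1.1.2 _) (bilinF2 _ _ _ _ _ _)); apply: eq_bigr => i' _.
rewrite -(dual_irr (dbD k.1.2 _) (bilinF3 _ _ _ _ _ _)); apply: eq_bigr => j _.
by rewrite -(dual_irr (dbD k.2 _) (bilinF4 _ _ _ _ _ _)).
Qed.

Lemma compress_irr_neq k0 : k0 != k -> compress_at k0 f h q g = 0.
Proof.
move=> /arcs_neq/or4P[] ne; do 4![apply: big1 => ? _].
- by rewrite (irr_mor0 (db_in _) ne); exact: (plinear_0 ((bilinF1 _ _ _ _ _ _).2 _)).
- by rewrite (irr_mor0 (db_in _) ne); exact: (plinear_0 ((bilinF2 _ _ _ _ _ _).2 _)).
- by rewrite (irr_mor0 (db_in _) ne); exact: (plinear_0 ((bilinF3 _ _ _ _ _ _).2 _)).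
by rewrite (irr_mor0 (db_in _) ne); exact: (plinear_0 ((bilinF4 _ _ _ _ _ _).2 _)).
Qed.

(** With simple arcs the expansion collapses to the quadruple itself, so [compress] extends the
    inclusions of the summands, and diagrams span all annuli. *)
Lemma compress_irr : compress f h q g = dsum_in (V := block) (pure4 f h q g).
Proof.
apply/ffunP => k0; rewrite compressE ffunE.
have [<-|nk] := eqVneq k k0; first by rewrite dfwith_in compress_irr_at.
by rewrite dfwith_out // compress_irr_neq // eq_sym.
Qed.

End Irr.
End Compress.

(** * Gluing annuli *)

Section Annuli.
Variables (R : realType) (C D : fuscat R) (M : bimodcat C D).
Variable dbC : forall (k : irr C) (x : C), dual_basis k x.
Variable dbD : forall (k : irr D) (x : D), dual_basis k x.

Local Notation "a ⊗ b" := (ten _ a b) (at level 38, left associativity).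
Local Notation "a ⊳ m" := (la M a m) (at level 37, right associativity).
Local Notation "m ⊲ b" := (ra M m b) (at level 39, left associativity).
Local Notation id := idm.

(* A boundary circle with arbitrary objects as labels. *)
Definition circle : Type := (M * M * C * D)%type.
Definition topM (P : circle) : M := P.1.1.1.
Definition botM (P : circle) : M := P.1.1.2.
Definition strC (P : circle) : C := P.1.2.
Definition strD (P : circle) : D := P.2.

Definition ann1 (P Q : circle) (A : C) (B : D) := mor (topM P) ((A ⊳ topM Q) ⊲ B).
Definition ann2 (P Q : circle) (A A' : C) := mor (A ⊗ strC Q) (strC P ⊗ A').
Definition ann3 (P Q : circle) (B B' : D) := mor (strD Q ⊗ B) (B' ⊗ strD P).
Definition ann4 (P Q : circle) (A : C) (B : D) := mor ((A ⊳ botM Q) ⊲ B) (botM P).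

Definition annblock (P Q : circle) (k : arcs C D) : vectType R[i] :=
  block (topM P) (topM Q) (botM P) (botM Q) (strC P) (strC Q) (strD P) (strD Q) k.

Definition annulus (P Q : circle) : vectType R[i] := dsum (annblock P Q).

Definition compressed (P Q : circle) A A' B B' (f : ann1 P Q A B) (h : ann2 P Q A A')
    (q : ann3 P Q B B') (g : ann4 P Q A' B') : annulus P Q :=
  compress dbC dbD f h q g.

Section GlueBlocks.
Variables (P O Q : circle) (k k1 kout : arcs C D).

(** The sum over dual bases in the product of tube spaces is the expansion of the glued quadruple,
    whose arcs carry tensor products of simple objects. *)
Definition glue_block (T : annblock P O k) (T1 : annblock O Q k1) : annblock P Q kout :=
  tlift4 (fun f h q g => tlift4 (fun f1 h1 q1 g1 =>
    compress_at dbC dbD kout (glueW f f1) (glueC h h1) (glueD q q1) (glueW' g g1)) T1) T.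

Lemma glue_block_bilin : bilin glue_block.
Proof.
split=> [T1|T] a t t'; rewrite /glue_block.
  by rewrite tlift4_linear.
by apply: tlift4_lin => f h q g; rewrite tlift4_linear.
Qed.

Lemma glue_block_pure4 f h q g f1 h1 q1 g1 :
  glue_block (pure4 f h q g) (pure4 f1 h1 q1 g1) =
  compress_at dbC dbD kout (glueW f f1) (glueC h h1) (glueD q q1) (glueW' g g1).
Proof.
rewrite /glue_block tlift4_pure4; last 4 first.
- move=> h' q' g' a v v'; apply: tlift4_lin => f1' h1' q1' g1'.
  by rewrite (glueW_bilin _ _ _ _ _ _ _).1 compress_atP1.
- move=> f' q' g' a v v'; apply: tlift4_lin => f1' h1' q1' g1'.
  by rewrite (glueC_bilin _ _ _ _ _ _ _).1 compress_atP2.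
- move=> f' h' g' a v v'; apply: tlift4_lin => f1' h1' q1' g1'.
  by rewrite (glueD_bilin _ _ _ _ _ _ _).1 compress_atP3.
- move=> f' h' q' a v v'; apply: tlift4_lin => f1' h1' q1' g1'.
  by rewrite (glueW'_bilin _ _ _ _ _ _ _).1 compress_atP4.
rewrite tlift4_pure4 // => * ? ? ?.
- by rewrite (glueW_bilin _ _ _ _ _ _ _).2 compress_atP1.
- by rewrite (glueC_bilin _ _ _ _ _ _ _).2 compress_atP2.
- by rewrite (glueD_bilin _ _ _ _ _ _ _).2 compress_atP3.
by rewrite (glueW'_bilin _ _ _ _ _ _ _).2 compress_atP4.
Qed.

End GlueBlocks.

Section Glue.
Variables (P O Q : circle).

Definition pasting : annulus P O -> annulus O Q -> annulus P Q :=
  dsum_mul (fun kout k k1 => @glue_block P O Q k k1 kout).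

Lemma pasting_bilin : bilin pasting.
Proof. by apply: dsum_mul_bilin => *; exact: glue_block_bilin. Qed.

Definition pastingl T1 := pasting_bilin.1 T1.
Definition pastingr T := pasting_bilin.2 T.

(** Named so that each of the four reductions below can replace one pair of arcs by simple ones
    while quantifying over the remaining factors. *)
Definition compat A A' B B' (f : ann1 P O A B) (h : ann2 P O A A')
    (q : ann3 P O B B') (g : ann4 P O A' B') A1 A1' B1 B1' (f1 : ann1 O Q A1 B1)
    (h1 : ann2 O Q A1 A1') (q1 : ann3 O Q B1 B1') (g1 : ann4 O Q A1' B1') : Prop :=
  pasting (compressed f h q g) (compressed f1 h1 q1 g1) =
  @compressed P Q _ _ _ _ (glueW f f1) (glueC h h1) (glueD q q1) (glueW' g g1).

Lemma paste_compressed_irr k k1 f h q g f1 h1 q1 g1 :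
  @compat (arcL1 k) (arcL2 k) (arcR1 k) (arcR2 k) f h q g
    (arcL1 k1) (arcL2 k1) (arcR1 k1) (arcR2 k1) f1 h1 q1 g1.
Proof.
rewrite /compat /compressed !compress_irr /pasting dsum_mul_in; last first.
  by move=> *; exact: glue_block_bilin.
by apply: dsum_ext => kout; rewrite dsum_ofE glue_block_pure4 compressE.
Qed.

(* One pair of arcs at a time is expanded in simple objects. *)
Section Slots.
Variables (A A' A1 A1' : C) (B B' B1 B1' : D).

Lemma compat_o1 (f : ann1 P O A B) (h : ann2 P O A A') (q : ann3 P O B B')
    (g : ann4 P O A' B') (f1 : ann1 O Q A1 B1) (h1 : ann2 O Q A1 A1')
    (q1 : ann3 O Q B1 B1') (g1 : ann4 O Q A1' B1') :
  (forall (a : irr C) (b : irr D) (f : ann1 P O (irr_ob a) (irr_ob b)) h q,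
    compat f h q g f1 h1 q1 g1) ->
  compat f h q g f1 h1 q1 g1.
Proof.
move=> irr_case; rewrite /compat {1}/compressed compress_expando.
(* The same resolutions of the identity are inserted on the right, in the factor A of [A ⊗ A1] and
   the factor B of [B1 ⊗ B]; the sums then agree term by term. *)
rewrite -[RHS](compress_completeo _ _ _ _ _ _
  (phi := fun t => (ten C)⟦t, id A1⟧) (psi := fun t => (ten D)⟦id B1, t⟧)
  (fun _ _ _ => bfPl _ _ _ _ _) (fun _ _ _ => bfPr _ _ _ _ _) (bf_id _ _ _) (bf_id _ _ _)).
do 4![rewrite (plinear_sum (pastingl _)); apply: eq_bigr => ? _].
rewrite (irr_case _ _ _ _ _) /compressed glueW_natl glueC_natl glueD_natl.
by rewrite compress_slideo -!compA -!bf_comp !comp1m.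
Qed.

Lemma compat_i1 (f : ann1 P O A B) (h : ann2 P O A A') (q : ann3 P O B B')
    (g : ann4 P O A' B') (f1 : ann1 O Q A1 B1) (h1 : ann2 O Q A1 A1')
    (q1 : ann3 O Q B1 B1') (g1 : ann4 O Q A1' B1') :
  (forall (a : irr C) (b : irr D) h q (g : ann4 P O (irr_ob a) (irr_ob b)),
    compat f h q g f1 h1 q1 g1) ->
  compat f h q g f1 h1 q1 g1.
Proof.
move=> irr_case; rewrite /compat {1}/compressed compress_expandi.
rewrite -[RHS](compress_completei _ _ _ _ _ _
  (phi := fun t => (ten C)⟦t, id A1'⟧) (psi := fun t => (ten D)⟦id B1', t⟧)
  (fun _ _ _ => bfPl _ _ _ _ _) (fun _ _ _ => bfPr _ _ _ _ _) (bf_id _ _ _) (bf_id _ _ _)).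
do 4![rewrite (plinear_sum (pastingl _)); apply: eq_bigr => ? _].
rewrite (irr_case _ _ _ _ _) /compressed glueW'_natl glueC_natl' glueD_natl'.
by rewrite -compress_slidei !compA -!bf_comp !comp1m.
Qed.

Lemma compat_o2 (f : ann1 P O A B) (h : ann2 P O A A') (q : ann3 P O B B')
    (g : ann4 P O A' B') (f1 : ann1 O Q A1 B1) (h1 : ann2 O Q A1 A1')
    (q1 : ann3 O Q B1 B1') (g1 : ann4 O Q A1' B1') :
  (forall (a : irr C) (b : irr D) (f1 : ann1 O Q (irr_ob a) (irr_ob b)) h1 q1,
    compat f h q g f1 h1 q1 g1) ->
  compat f h q g f1 h1 q1 g1.
Proof.
move=> irr_case; rewrite /compat {2}/compressed compress_expando.
rewrite -[RHS](compress_completeo _ _ _ _ _ _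
  (phi := fun t => (ten C)⟦id A, t⟧) (psi := fun t => (ten D)⟦t, id B⟧)
  (fun _ _ _ => bfPr _ _ _ _ _) (fun _ _ _ => bfPl _ _ _ _ _) (bf_id _ _ _) (bf_id _ _ _)).
do 4![rewrite (plinear_sum (pastingr _)); apply: eq_bigr => ? _].
rewrite (irr_case _ _ _ _ _) /compressed glueW_natr glueC_natr glueD_natr.
by rewrite compress_slideo -!compA -!bf_comp !comp1m.
Qed.

Lemma compat_i2 (f : ann1 P O A B) (h : ann2 P O A A') (q : ann3 P O B B')
    (g : ann4 P O A' B') (f1 : ann1 O Q A1 B1) (h1 : ann2 O Q A1 A1')
    (q1 : ann3 O Q B1 B1') (g1 : ann4 O Q A1' B1') :
  (forall (a : irr C) (b : irr D) h1 q1 (g1 : ann4 O Q (irr_ob a) (irr_ob b)),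
    compat f h q g f1 h1 q1 g1) ->
  compat f h q g f1 h1 q1 g1.
Proof.
move=> irr_case; rewrite /compat {2}/compressed compress_expandi.
rewrite -[RHS](compress_completei _ _ _ _ _ _
  (phi := fun t => (ten C)⟦id A', t⟧) (psi := fun t => (ten D)⟦t, id B'⟧)
  (fun _ _ _ => bfPr _ _ _ _ _) (fun _ _ _ => bfPl _ _ _ _ _) (bf_id _ _ _) (bf_id _ _ _)).
do 4![rewrite (plinear_sum (pastingr _)); apply: eq_bigr => ? _].
rewrite (irr_case _ _ _ _ _) /compressed glueW'_natr glueC_natr' glueD_natr'.
by rewrite -compress_slidei !compA -!bf_comp !comp1m.
Qed.

End Slots.

Lemma paste_compressed A A' B B' (f : ann1 P O A B) (h : ann2 P O A A')
    (q : ann3 P O B B') (g : ann4 P O A' B') A1 A1' B1 B1' (f1 : ann1 O Q A1 B1)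
    (h1 : ann2 O Q A1 A1') (q1 : ann3 O Q B1 B1') (g1 : ann4 O Q A1' B1') :
  pasting (compressed f h q g) (compressed f1 h1 q1 g1) =
  @compressed P Q _ _ _ _ (glueW f f1) (glueC h h1) (glueD q q1) (glueW' g g1).
Proof.
apply: compat_o1 => a b {}f {}h {}q; apply: compat_i1 => a' b' {}h {}q {}g.
apply: compat_o2 => a1 b1 {}f1 {}h1 {}q1; apply: compat_i2 => a1' b1' {}h1 {}q1 {}g1.
exact: (@paste_compressed_irr (a, a', b, b') (a1, a1', b1, b1')).
Qed.

End Glue.

(* Locked, to keep unification from unfolding the sums over arcs. *)
Fact annulus_key : unit. Proof. exact: tt. Qed.

Definition diagram (P Q : circle) A A' B B' (f : ann1 P Q A B) (h : ann2 P Q A A')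
    (q : ann3 P Q B B') (g : ann4 P Q A' B') : annulus P Q :=
  locked_with annulus_key (compressed f h q g).

Definition glue_ann (P O Q : circle) : annulus P O -> annulus O Q -> annulus P Q :=
  locked_with annulus_key (@pasting P O Q).

Lemma diagramE P Q A A' B B' (f : ann1 P Q A B) (h : ann2 P Q A A')
    (q : ann3 P Q B B') (g : ann4 P Q A' B') : diagram f h q g = compressed f h q g.
Proof. exact: unlock. Qed.

Section GlueTheory.
Variables (P O Q : circle).

Lemma glue_annE : @glue_ann P O Q = @pasting P O Q.
Proof. exact: unlock. Qed.

Lemma glue_ann_bilin : bilin (@glue_ann P O Q).
Proof. by rewrite glue_annE; exact: pasting_bilin. Qed.

Lemma glue_ann0l (T1 : annulus O Q) : glue_ann (0 : annulus P O) T1 = 0.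
Proof. exact: (plinear_0 (glue_ann_bilin.1 T1)). Qed.

Lemma glue_ann0r (T : annulus P O) : glue_ann T (0 : annulus O Q) = 0.
Proof. exact: (plinear_0 (glue_ann_bilin.2 T)). Qed.

Lemma glue_annDl (s t : annulus P O) (T1 : annulus O Q) :
  glue_ann (s + t) T1 = glue_ann s T1 + glue_ann t T1.
Proof. exact: (plinear_D (glue_ann_bilin.1 T1)). Qed.

Lemma glue_annDr (T : annulus P O) (s t : annulus O Q) :
  glue_ann T (s + t) = glue_ann T s + glue_ann T t.
Proof. exact: (plinear_D (glue_ann_bilin.2 T)). Qed.

Lemma glue_diagram A A' B B' (f : ann1 P O A B) (h : ann2 P O A A')
    (q : ann3 P O B B') (g : ann4 P O A' B') A1 A1' B1 B1' (f1 : ann1 O Q A1 B1)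
    (h1 : ann2 O Q A1 A1') (q1 : ann3 O Q B1 B1') (g1 : ann4 O Q A1' B1') :
  glue_ann (diagram f h q g) (diagram f1 h1 q1 g1) =
  @diagram P Q _ _ _ _ (glueW f f1) (glueC h h1) (glueD q q1) (glueW' g g1).
Proof. by rewrite glue_annE !diagramE paste_compressed. Qed.

Lemma diagram_mor A A0 A' A0' B B0 B' B0' (t : mor A A0) (v : mor B B0) (t' : mor A' A0')
    (v' : mor B' B0') (f : ann1 P Q A B) (h : ann2 P Q A A') (q : ann3 P Q B B')
    (g : ann4 P Q A' B') (f0 : ann1 P Q A0 B0) (h0 : ann2 P Q A0 A0')
    (q0 : ann3 P Q B0 B0') (g0 : ann4 P Q A0' B0') :
  (ra M)⟦(la M)⟦t, id (topM Q)⟧, v⟧ ∘ f = f0 ->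
  (ten C)⟦id (strC P), t'⟧ ∘ h = h0 ∘ (ten C)⟦t, id (strC Q)⟧ ->
  (ten D)⟦v', id (strD P)⟧ ∘ q = q0 ∘ (ten D)⟦id (strD Q), v⟧ ->
  g0 ∘ (ra M)⟦(la M)⟦t', id (botM Q)⟧, v'⟧ = g ->
  diagram f h q g = diagram f0 h0 q0 g0.
Proof. by rewrite !diagramE; exact: compress_mor. Qed.

Lemma annulus_ind (S : annulus P Q -> Prop) :
  S 0 -> (forall s t, S s -> S t -> S (s + t)) ->
  (forall A A' B B' (f : ann1 P Q A B) (h : ann2 P Q A A') (q : ann3 P Q B B')
    (g : ann4 P Q A' B'), S (diagram f h q g)) ->
  forall T, S T.
Proof.
move=> S0 SD Sd; apply: dsum_ind => // k.
have lin := @dsum_in_linear _ _ (annblock P Q) k.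
apply: tensor4_ind => [|s t Ss St|f h q g].
- by rewrite (plinear_0 lin).
- by rewrite (plinear_D lin); exact: SD.
by have := Sd _ _ _ _ f h q g; rewrite diagramE /compressed compress_irr.
Qed.

End GlueTheory.

Lemma glue_annA P O Q S (T : annulus P O) (T1 : annulus O Q) (T2 : annulus Q S) :
  glue_ann T (glue_ann T1 T2) = glue_ann (glue_ann T T1) T2.
Proof.
elim/annulus_ind: T => [|s t Hs Ht|A A' B B' f h q g]; first by rewrite !glue_ann0l.
  by rewrite !glue_annDl Hs Ht.
elim/annulus_ind: T1 => [|s t Hs Ht|A1 A1' B1 B1' f1 h1 q1 g1].
- by rewrite glue_ann0l !glue_ann0r glue_ann0l.
- by rewrite glue_annDl !glue_annDr glue_annDl Hs Ht.
elim/annulus_ind: T2 => [|s t Hs Ht|A2 A2' B2 B2' f2 h2 q2 g2].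
- by rewrite !glue_ann0r.
- by rewrite !glue_annDr Hs Ht.
rewrite !glue_diagram; apply/esym.
(* The two bracketings differ only by the associators of the four tripled arcs. *)
apply: (diagram_mor (t := asc A A1 A2) (v := dag (asc B2 B1 B)) (t' := asc A' A1' A2')
  (v' := dag (asc B2' B1' B'))).
- exact: glueWA.
- exact: glueCA.
- exact: glueDA.
exact: glueW'A.
Qed.

(** The arcs carry the unit object itself rather than its simple representative, so that the unitors
    apply directly; [unit_annE] compares it with [tube_id]. *)
Definition unit_ann (P : circle) : annulus P P :=
  @diagram P P _ _ _ _ (unitW (topM P)) (unitC (strC P)) (unitD (strD P)) (unitW' (botM P)).

Lemma glue_unitl P Q (T : annulus P Q) : glue_ann (unit_ann P) T = T.
Proof.
elim/annulus_ind: T => [|s t Hs Ht|A A' B B' f h q g].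
- exact: glue_ann0r.
- by rewrite glue_annDr Hs Ht.
rewrite glue_diagram.
apply: (diagram_mor (t := lun A) (v := run B) (t' := lun A') (v' := run B')).
- exact: glueW1l.
- exact: glueC1l.
- exact: glueD1l.
by rewrite glueW'1l.
Qed.

Lemma glue_unitr P Q (T : annulus P Q) : glue_ann T (unit_ann Q) = T.
Proof.
elim/annulus_ind: T => [|s t Hs Ht|A A' B B' f h q g].
- exact: glue_ann0l.
- by rewrite glue_annDl Hs Ht.
rewrite glue_diagram.
apply: (diagram_mor (t := run A) (v := lun B) (t' := run A') (v' := lun B')).
- exact: glueW1r.
- exact: glueC1r.
- exact: glueD1r.
by rewrite glueW'1r.
Qed.

Lemma diagram_sum P Q A A' B B' (f : ann1 P Q A B) (h : ann2 P Q A A')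
    (q : ann3 P Q B B') n (g : 'I_n -> ann4 P Q A' B') :
  \sum_i diagram f h q (g i) = diagram f h q (\sum_i g i).
Proof.
have lin : linear (fun g' : ann4 P Q A' B' => diagram f h q g').
  move=> a g1 g2; rewrite !diagramE.
  by have [_ _ _ l4] := compress_linear dbC dbD f h q g1; exact: l4.
exact: (esym (plinear_sum lin _ _ _)).
Qed.

(** A morphism on the wall between two glued annuli may be counted with either of them. *)
Lemma glueW'_mid a b a1 b1 (x y y' z : M) (g : mor ((a ⊳ y) ⊲ b) x) (v : mor y' y)
    (g1 : mor ((a1 ⊳ z) ⊲ b1) y') :
  glueW' (g ∘ (ra M)⟦(la M)⟦id a, v⟧, id b⟧) g1 = glueW' g (v ∘ g1).
Proof. by rewrite /glueW' -(compA g) -!bf_comp !comp1m. Qed.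

(* The strands of P are moved to the wall, where simple objects split off. *)
Lemma unit_ann_factor (P : circle) (c : C) (e : D) (oC : mor (one C) c)
    (oC' : mor c (one C)) (oD : mor (one D) e) (oD' : mor e (one D)) :
  oC' ∘ oC = id _ -> oD' ∘ oD = id _ ->
  exists n (l : 'I_n -> irr M) (F : forall p, annulus P (topM P, irr_ob (l p), c, e))
    (G : forall p, annulus (topM P, irr_ob (l p), c, e) P),
  \sum_p glue_ann (F p) (G p) = unit_ann P.
Proof.
move=> oCK oDK.
(* The C strand is bent onto the left arc and needs a left dual; the D strand is bent onto the right
   arc and needs a right dual. *)
have [[y [ev [coev [z _]]]] _] := rigid (strC P).
have [_ [y' [ev' [coev' [_ z']]]]] := rigid (strD P).
have [n [l [v [_ _ dv]]]] := fs_semisimple ((strC P ⊳ botM P) ⊲ strD P).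
pose Q p : circle := (topM P, irr_ob (l p), c, e).
(* F creates the strands of P with their duals on the lower arcs and contracts these duals with the
   strands hidden in the wall label [l p]; G puts the strands of P on its arcs and projects their
   product with the wall to [l p]. The inner boundary of F carries only the unit bundles c and e. *)
exists n, l, (fun p => @diagram P (Q p) _ _ _ _ (unitW (topM P)) (coev ∘ oC' ∘ lun c)
    (coev' ∘ oD' ∘ run e)
    (pullW ev ev' (botM P) ∘ (ra M)⟦(la M)⟦id y, v p⟧, id y'⟧)).
exists (fun p => @diagram (Q p) P _ _ _ _ (unitW (topM P)) (ten C)⟦oC, id (strC P)⟧
    (ten D)⟦id (strD P), oD⟧ (dag (v p))).
transitivity (\sum_(p < n) @diagram P P _ _ _ _
  (glueW (unitW (topM P)) (unitW (topM P)))
  (glueC (coev ∘ oC' ∘ lun c) (ten C)⟦oC, id (strC P)⟧)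
  (glueD (coev' ∘ oD' ∘ run e) (ten D)⟦id (strD P), oD⟧)
  (glueW' (pullW ev ev' (botM P)) (v p ∘ dag (v p)))).
  by apply: eq_bigr => p _; rewrite glue_diagram glueW'_mid.
rewrite diagram_sum -(plinear_sum ((glueW'_bilin _ _ _ _ _ _ _).2 _)) dv.
(* The wall projections have summed to the identity. Contracting the lower arcs by the evaluations
   triggers the zigzag identities. *)
apply: (diagram_mor (t := lun (one C)) (v := run (one D)) (t' := ev) (v' := ev')).
- exact: glueW1l.
- exact: glueC_zigzag.
- exact: glueD_zigzag.
by rewrite glueW'_zigzag.
Qed.

End Annuli.

(** * Morita contexts *)

(** Surjectivity of the pairings is stored as decompositions of the two units. They give explicit
    dual bases: every y in N is the sum over i of [leftB i] times the pairing of [rightB i] with y,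
    and likewise for M. *)
Record morita_context (K : fieldType) (A B : alg K) := MoritaContext {
  contextM : bimod A B;
  contextN : bimod B A;
  contextM_bimod : is_bimod contextM;
  contextN_bimod : is_bimod contextN;
  pairMN : contextM -> contextN -> A;
  pairNM : contextN -> contextM -> B;
  pairMN_bilin : bilin pairMN;
  pairNM_bilin : bilin pairNM;
  pairMN_act : forall a m n, pairMN (bact a m) n = amul a (pairMN m n);
  pairMN_actr : forall m n a, pairMN m (bactr n a) = amul (pairMN m n) a;
  pairMN_bal : forall m b n, pairMN (bactr m b) n = pairMN m (bact b n);
  pairNM_act : forall b n m, pairNM (bact b n) m = amul b (pairNM n m);
  pairNM_actr : forall n m b, pairNM n (bactr m b) = amul (pairNM n m) b;
  pairNM_bal : forall n a m, pairNM (bactr n a) m = pairNM n (bact a m);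
  pairMN_swap : forall m n m', bact (pairMN m n) m' = bactr m (pairNM n m');
  pairNM_swap : forall n m n', bact (pairNM n m) n' = bactr n (pairMN m n');
  sizeA : nat;
  leftA : 'I_sizeA -> contextM;
  rightA : 'I_sizeA -> contextN;
  oneA_factor : \sum_i pairMN (leftA i) (rightA i) = aone A;
  sizeB : nat;
  leftB : 'I_sizeB -> contextN;
  rightB : 'I_sizeB -> contextM;
  oneB_factor : \sum_i pairNM (leftB i) (rightB i) = aone B }.

Definition swap_context (K : fieldType) (A B : alg K) (X : morita_context A B) :
    morita_context B A :=
  @MoritaContext K B A (contextN X) (contextM X) (contextN_bimod X)
    (contextM_bimod X) (@pairNM K A B X) (@pairMN K A B X)
    (pairNM_bilin X) (pairMN_bilin X) (@pairNM_act K A B X)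
    (@pairNM_actr K A B X) (@pairNM_bal K A B X)
    (@pairMN_act K A B X) (@pairMN_actr K A B X)
    (@pairMN_bal K A B X) (@pairNM_swap K A B X)
    (@pairMN_swap K A B X) _ (@leftB K A B X) (@rightB K A B X) (oneB_factor X) _
    (@leftA K A B X) (@rightA K A B X) (oneA_factor X).

Lemma swap_contextK (K : fieldType) (A B : alg K) (X : morita_context A B) :
  swap_context (swap_context X) = X.
Proof. by case: X. Qed.

Section TensorIso.
Variables (K : fieldType) (A B : alg K) (X : morita_context A B).
Local Notation M := (contextM X).
Local Notation N := (contextN X).
Hypothesis algA : is_alg A.

Let pairing (q : btens M N) : A := tlift (@pairMN K A B X) (vsval q).

Let pairing_linear : linear pairing.
Proof. by move=> a u v; rewrite /pairing linearP tlift_linear. Qed.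

Let pairing_pi t : pairing (quot_pi (bspace M N) t) = tlift (@pairMN K A B X) t.
Proof.
apply/eqP; rewrite -subr_eq0 /pairing -(plinear_B (@tlift_linear _ _ _ _ _)).
apply/eqP; apply: (bspaceP (f := tlift (@pairMN K A B X))); first exact: tlift_linear.
  move=> m b n; rewrite (plinear_B (@tlift_linear _ _ _ _ _)).
  by rewrite !tlift_pure ?pairMN_bal ?subrr //; exact: pairMN_bilin.
apply/quot_pi_eq0; rewrite (plinear_B (@quot_pi_linear _ _ _)) quot_piK subrr //.
Qed.

Let pairing_pure m n : pairing (bpure m n) = pairMN m n.
Proof. by rewrite pairing_pi tlift_pure //; exact: pairMN_bilin. Qed.

Let btens_ind (P : btens M N -> Prop) : P 0 -> (forall s t, P s -> P t -> P (s + t)) ->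
  (forall m n, P (bpure m n)) -> forall q, P q.
Proof.
move=> P0 PD Pp q; rewrite -[q]quot_piK.
have lin := @quot_pi_linear K _ (bspace M N).
elim/tensor_ind: (vsval q) => [|s t Ps Pt|m n]; last exact: Pp.
  by rewrite (plinear_0 lin).
by rewrite (plinear_D lin); exact: PD.
Qed.

Lemma btens_regular : bimod_iso (btens M N) (regular A).
Proof.
have bM := contextM_bimod X; have bN := contextN_bimod X.
have [ambil _ _ am1] := algA.
have bpl (m : M) : linear (fun n : N => bpure m n).
  by move=> c x y; rewrite /bpure (pure_bilin _ _).2 quot_pi_linear.
have actl (a : A) : linear (fun q : btens M N => bact a q).
  by move=> c x y; rewrite /= tlift_linear quot_pi_linear.
have actrl (a : A) : linear (fun q : btens M N => bactr q a).
  by move=> c x y; rewrite /= tlift_linear quot_pi_linear.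
have bpr (n : N) : linear (fun m : M => bpure m n).
  by move=> c x y; rewrite /bpure (pure_bilin _ _).1 quot_pi_linear.
exists pairing; split=> //.
(* With l_i, r_i the decomposition of the unit of A, the inverse sends a to the sum of a l_i ⊗ r_i.
   On the image of m ⊗ n one has (m, n) l_i ⊗ r_i = m (n, l_i) ⊗ r_i = m ⊗ n (l_i, r_i), which sums
   to m ⊗ n. *)
- exists (fun a => \sum_i bpure (bact a (leftA i)) (rightA i)).
    have sl : linear (fun a : A => \sum_i bpure (bact a (@leftA _ _ _ X i)) (rightA i)).
      apply: plinear_sumf => i a u v.
      by have [[[bl _] _] _ _ _] := bM; rewrite bl bpr.
    elim/btens_ind => [|s t Hs Ht|m n].
    + by rewrite (plinear_0 pairing_linear) (plinear_0 sl).
    + by rewrite (plinear_D pairing_linear) (plinear_D sl) Hs Ht.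
    rewrite pairing_pure; under eq_bigr do rewrite pairMN_swap (bpure_bal bM bN) pairNM_swap.
    rewrite -(plinear_sum (bpl m)); congr bpure.
    have [[_ [_ br]] _ [_ bN1] _] := bN.
    by rewrite -(plinear_sum (br n)) oneA_factor bN1.
  move=> a; rewrite (plinear_sum pairing_linear).
  under eq_bigr do rewrite pairing_pure pairMN_act.
  by rewrite -(plinear_sum (ambil.2 a)) oneA_factor am1.
- move=> a; elim/btens_ind => [|s t Hs Ht|m n].
  + rewrite (plinear_0 (actl a)) (plinear_0 pairing_linear).
    by rewrite /= (plinear_0 (ambil.2 a)).
  + by rewrite (plinear_D (actl a)) !(plinear_D pairing_linear) Hs Ht /= (plinear_D (ambil.2 a)).
  by rewrite (btens_bact bM bN) !pairing_pure pairMN_act.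
move=> q a; elim/btens_ind: q => [|s t Hs Ht|m n].
- rewrite (plinear_0 (actrl a)) (plinear_0 pairing_linear).
  by rewrite /= (plinear_0 (ambil.1 a)).
- by rewrite (plinear_D (actrl a)) !(plinear_D pairing_linear) Hs Ht /= (plinear_D (ambil.1 a)).
by rewrite (btens_bactr bM bN) !pairing_pure pairMN_actr.
Qed.

End TensorIso.

(** * The induction functor of a Morita context *)

Lemma lact_suml (K : fieldType) (A : alg K) (V : lmodule A) (v : V) n (a : 'I_n -> A) :
  \sum_i lact (a i) v = lact (\sum_i a i) v.
Proof. exact: (esym (plinear_sum ((lact_bilin V).1 v) _ _ _)). Qed.

Lemma lact_sumr (K : fieldType) (A : alg K) (V : lmodule A) (a : A) n (v : 'I_n -> V) :
  lact a (\sum_i v i) = \sum_i lact a (v i).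
Proof. exact: (plinear_sum ((lact_bilin V).2 a)). Qed.

(* The balanced tensor product of N with a left A-module V, realised as the
   image of an idempotent matrix over A acting on V^n. *)
Section Induction.
Variables (K : fieldType) (A B : alg K) (X : morita_context A B).
Hypothesis algB : is_alg B.
Local Notation M := (contextM X).
Local Notation N := (contextN X).
Local Notation n := (sizeB X).
Local Notation n_ := (@leftB K A B X).
Local Notation m_ := (@rightB K A B X).

Section Carrier.
Variable V : lmodule A.

(** The family v stands for the sum of n_l ⊗ v_l. As b n_l is the sum of n_k (m_k b, n_l) over k,
    this matrix is the action of b in coordinates; for b = 1 it is the idempotent that cuts out the
    tensor product. *)
Definition twist (b : B) (v : {ffun 'I_n -> V}) : {ffun 'I_n -> V} :=
  [ffun k => \sum_l lact (pairMN (bactr (m_ k) b) (n_ l)) (v l)].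

Lemma twist_linear b : linear (twist b).
Proof.
move=> c u v; apply/ffunP => k; rewrite !ffunE scaler_sumr -big_split.
by apply: eq_bigr => l _; rewrite !ffunE (lact_bilin V).2.
Qed.

Lemma twist_linearl v : linear (twist^~ v).
Proof.
move=> c a b; apply/ffunP => k; rewrite !ffunE scaler_sumr -big_split.
apply: eq_bigr => l _ /=; have [[_ [_ br]] _ _ _] := contextM_bimod X.
by rewrite br (pairMN_bilin X).1 (lact_bilin V).1.
Qed.

(** The matrices multiply because (m_k a, n_l)(m_l b, n_j) = (m_k a (n_l, m_l) b, n_j), and the
    (n_l, m_l) sum to 1. *)
Lemma twistM a b v : twist a (twist b v) = twist (amul a b) v.
Proof.
have [[_ [_ br]] _ [bA _] _] := contextM_bimod X; have [bmul _ mul1 _] := algB.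
apply/ffunP => k; rewrite !ffunE; under eq_bigr => l _ do rewrite ffunE lact_sumr.
rewrite exchange_big; apply: eq_bigr => j _ /=.
under eq_bigr => l _ do rewrite lactA -pairMN_actr -pairNM_swap pairNM_actr -pairMN_bal.
rewrite lact_suml -(plinear_sum ((pairMN_bilin X).1 _)) -(plinear_sum (br _)).
by rewrite -(plinear_sum (bmul.1 b)) oneB_factor mul1 bA.
Qed.

Definition fixed_by_one : pred {ffun 'I_n -> V} := fun v => twist (aone B) v == v.

Lemma fixed_submod : subsemimod_closed fixed_by_one.
Proof.
have lin := twist_linear (aone B); split; [split|].
- by apply/eqP; rewrite (plinear_0 lin).
- by move=> u v /eqP eu /eqP ev; apply/eqP; rewrite (plinear_D lin) eu ev.
by move=> a v /eqP ev; apply/eqP; rewrite (plinear_Z lin) ev.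
Qed.

HB.instance Definition _ := GRing.isSubmodClosed.Build K {ffun 'I_n -> V} fixed_by_one fixed_submod.

Record induced := Induced { induced_val :> {ffun 'I_n -> V}; _ : fixed_by_one induced_val }.
HB.instance Definition _ := [isSub for induced_val].
HB.instance Definition _ := [Choice of induced by <:].
HB.instance Definition _ := [SubChoice_isSubLmodule of induced by <:].

Lemma inducedP (v : induced) : twist (aone B) v = v.
Proof. by apply/eqP; case: v. Qed.

Fact twist_fixed b (v : {ffun 'I_n -> V}) : fixed_by_one (twist b v).
Proof. by apply/eqP; rewrite twistM; have [_ _ mul1 _] := algB; rewrite mul1. Qed.

Definition induced_act (b : B) (v : induced) : induced := Induced (twist_fixed b v).

Lemma induced_act_bilin : bilin induced_act.
Proof.
split=> [v|b] c x y; apply: val_inj; rewrite linearP /=.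
  exact: (twist_linearl v).
by rewrite -twist_linear; congr (twist _ _); exact: (linearP (\val : induced -> _)).
Qed.

Lemma induced_actA a b v : induced_act a (induced_act b v) = induced_act (amul a b) v.
Proof. by apply: val_inj; rewrite /= twistM. Qed.

Lemma induced_act1 v : induced_act (aone B) v = v.
Proof. by apply: val_inj; rewrite /= inducedP. Qed.

Definition induced_module : lmodule B :=
  LModule induced_act_bilin induced_actA induced_act1.

End Carrier.

Section Hom.
Variables (V W : lmodule A) (f : lmodhom V W).

Definition pointwise (v : {ffun 'I_n -> V}) : {ffun 'I_n -> W} := [ffun k => f (v k)].

Lemma twist_pointwise b v : twist b (pointwise v) = pointwise (twist b v).
Proof.
apply/ffunP => k; rewrite !ffunE (plinear_sum (lmh_linear f)).
by apply: eq_bigr => l _; rewrite !ffunE lmh_lact.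
Qed.

Fact pointwise_fixed (v : induced V) : fixed_by_one (pointwise v).
Proof. by apply/eqP; rewrite twist_pointwise inducedP. Qed.

Definition induced_map (v : induced V) : induced W := Induced (pointwise_fixed v).

Lemma induced_map_linear : linear induced_map.
Proof.
move=> c u v; apply: val_inj; rewrite linearP /=; apply/ffunP => k.
by rewrite !ffunE (lmh_linear f).
Qed.

Lemma induced_map_act (b : B) (v : induced_module V) :
  induced_map (induced_act b v) = induced_act b (induced_map v).
Proof. by apply: val_inj; rewrite /= twist_pointwise. Qed.

Definition induced_hom : lmodhom (induced_module V) (induced_module W) :=
  @LModHom _ _ (induced_module V) (induced_module W) induced_map induced_map_linear
    induced_map_act.

End Hom.

Definition induction : lmodfunctor A B.
Proof.
refine (@LModFunctor _ _ _ induced_module induced_hom _ _ _).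
- move=> V W c f g h fgh v; apply: val_inj; rewrite linearP /=; apply/ffunP => k.
  by rewrite !ffunE fgh.
- move=> V f fid v; apply: val_inj => /=; apply/ffunP => k; by rewrite !ffunE fid.
move=> U V W f g h fgh v; apply: val_inj => /=; apply/ffunP => k.
by rewrite !ffunE fgh.
Defined.

End Induction.

(** * The two induction functors are mutually inverse *)

Section Retract.
Variables (K : fieldType) (A B : alg K) (X : morita_context A B).
Hypotheses (algA : is_alg A) (algB : is_alg B).
Let F := induction X algB.
Let G := induction (swap_context X) algA.

Local Notation M := (contextM X).
Local Notation N := (contextN X).
Local Notation n := (sizeB X).

Section Counit.
Variable V : lmodule A.

(** In coordinates, the map from the tensor product of N and V to V that sends n ⊗ v to (m, n) v. *)
Definition evaluate (m : M) (v : {ffun 'I_n -> V}) : V :=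
  \sum_k lact (pairMN m (leftB k)) (v k).

(** The coordinates of y ⊗ v, obtained by expanding y as the sum of n_k (m_k, y). *)
Definition coevaluate (y : N) (v : V) : {ffun 'I_n -> V} :=
  [ffun k => lact (pairMN (rightB k) y) v].

Lemma evaluate_linear m : linear (evaluate m).
Proof.
by apply: plinear_sumf => k c u v; rewrite !ffunE (lact_bilin V).2.
Qed.

Lemma evaluate_linearl v : linear (evaluate^~ v).
Proof.
by apply: plinear_sumf => k c m m'; rewrite (pairMN_bilin X).1 (lact_bilin V).1.
Qed.

Lemma coevaluate_linearl v : linear (coevaluate^~ v).
Proof.
by move=> c y y'; apply/ffunP => k; rewrite !ffunE (pairMN_bilin X).2 (lact_bilin V).1.
Qed.

Lemma evaluate_act a m v : evaluate (bact a m) v = lact a (evaluate m v).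
Proof.
by rewrite /evaluate lact_sumr; apply: eq_bigr => k _; rewrite pairMN_act lactA.
Qed.

(** The dual basis expansion of y, paired with m. *)
Lemma pairMN_insert (m : M) (y : N) :
  \sum_k amul (pairMN m (leftB k)) (pairMN (rightB k) y) = pairMN m y.
Proof.
have [[[bl _] _] [_ b1] _ _] := contextN_bimod X.
under eq_bigr => k _ do rewrite -pairMN_actr -pairNM_swap.
by rewrite -(plinear_sum ((pairMN_bilin X).2 m)) -(plinear_sum (bl y)) oneB_factor b1.
Qed.

Lemma evaluate_twist m b v : evaluate m (twist b v) = evaluate (bactr m b) v.
Proof.
rewrite /evaluate; under eq_bigr => k _ do rewrite ffunE lact_sumr.
rewrite exchange_big; apply: eq_bigr => l _ /=.
under eq_bigr => k _ do rewrite lactA pairMN_bal.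
by rewrite lact_suml pairMN_insert pairMN_bal.
Qed.

Lemma twist_coevaluate b y v : twist b (coevaluate y v) = coevaluate (bact b y) v.
Proof.
apply/ffunP => k; rewrite !ffunE; under eq_bigr => l _ do rewrite ffunE lactA.
by rewrite lact_suml pairMN_insert pairMN_bal.
Qed.

Lemma evaluate_coevaluate (m : M) (y : N) (v : V) :
  evaluate m (coevaluate y v) = lact (pairMN m y) v.
Proof.
by rewrite /evaluate; under eq_bigr => k _ do rewrite ffunE lactA; rewrite lact_suml pairMN_insert.
Qed.

Lemma evaluate_m k v : evaluate (rightB k) v = twist (aone B) v k.
Proof.
have [_ _ [_ b1] _] := contextM_bimod X.
by rewrite ffunE; apply: eq_bigr => l _; rewrite b1.
Qed.

(** An element of G (F V) is a sum of l_i ⊗ w_i with w_i in F V, and the pairing of M with N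
    contracts l_i with w_i. *)
Definition counit (w : G (F V)) : V := \sum_i evaluate (leftA i) (val (val w i)).

Lemma counit_linear : linear counit.
Proof.
apply: plinear_sumf => i c u v.
rewrite -evaluate_linear; congr evaluate.
rewrite (linearP (\val : induced (swap_context X) (F V) -> _) c u v) !ffunE.
exact: (linearP (\val : induced X V -> _)).
Qed.

Lemma val_sum (J : Type) (r : seq J) (P : pred J) (u : J -> induced X V) :
  val (\sum_(j <- r | P j) u j) = \sum_(j <- r | P j) val (u j).
Proof. exact: (linear_sum (\val : induced X V -> _)). Qed.

Lemma counit_act a w : counit (lact a w) = lact a (counit w).
Proof.
rewrite /counit lact_sumr /=.
under eq_bigr => i _ do rewrite ffunE val_sum (plinear_sum (evaluate_linear _)).
rewrite exchange_big; apply: eq_bigr => j _ /=.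
under eq_bigr => i _ do rewrite /= evaluate_twist -pairMN_swap pairMN_actr.
rewrite -(plinear_sum (evaluate_linearl _)) -evaluate_act; congr evaluate.
have [[[bl _] _] _ _ _] := contextM_bimod X; have [bmul _ mul1 _] := algA.
by rewrite -(plinear_sum (bl _)) -(plinear_sum (bmul.1 a)) oneA_factor mul1.
Qed.

Definition counit_hom := LModHom counit_linear counit_act.

Fact coevaluate_fixed y v : fixed_by_one (coevaluate y v).
Proof.
have [_ [_ b1] _ _] := contextN_bimod X.
by apply/eqP; rewrite twist_coevaluate b1.
Qed.

(** The inverse of [counit]: v = 1 v becomes the sum of l_i ⊗ r_i ⊗ v. *)
Definition unit_family (v : V) : {ffun 'I_(sizeA X) -> F V} :=
  [ffun i => Induced (coevaluate_fixed (rightA i) v)].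

Fact unit_fixed v : fixed_by_one (X := swap_context X) (unit_family v).
Proof.
apply/eqP/ffunP => i; apply: val_inj; rewrite !ffunE val_sum /=.
have [[_ [_ br]] _ [_ b1] _] := contextN_bimod X.
under eq_bigr => j _ do rewrite ffunE /= twist_coevaluate b1 pairNM_swap.
rewrite -(plinear_sum (coevaluate_linearl v)) -(plinear_sum (br _)).
by rewrite oneA_factor b1.
Qed.

Lemma counit_bij : bijective counit_hom.
Proof.
have [_ _ mul1 _] := algB; have [_ _ [_ b1] _] := contextN_bimod X.
exists (fun v => Induced (unit_fixed v)) => [w|v] /=.
  apply: val_inj => /=; apply/ffunP => i; apply: val_inj; rewrite ffunE /=.
  apply/ffunP => k; rewrite ffunE /counit lact_sumr.
  (* Since (m_k, r_i) l_j = m_k (r_i, l_j), the j-th term becomes the matrix entry (r_i, l_j)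
     applied to w_j. The sum over j is the idempotent of the swapped context applied to w, hence
     w. *)
  under eq_bigr => j _ do rewrite -evaluate_act pairMN_swap -evaluate_twist evaluate_m
    twistM // mul1.
  have /ffunP/(_ i)/(congr1 val)/ffunP/(_ k) := inducedP w => <-.
  rewrite ffunE val_sum sum_ffunE; apply: eq_bigr => j _.
  by rewrite /= b1.
rewrite /counit -[RHS]lact1 -(oneA_factor X) -lact_suml; apply: eq_bigr => i _.
by rewrite /= ffunE evaluate_coevaluate.
Qed.

End Counit.

Lemma induction_retracts : retracts F G.
Proof.
exists counit_hom; split=> [V|V W f w]; first exact: counit_bij.
rewrite /= /counit (plinear_sum (lmh_linear f)); apply: eq_bigr => i _.
rewrite ffunE /evaluate (plinear_sum (lmh_linear f)); apply: eq_bigr => k _.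
by rewrite /= ffunE lmh_lact.
Qed.

End Retract.

Lemma context_morita (K : fieldType) (A B : alg K) (X : morita_context A B) :
  is_alg A -> is_alg B -> morita A B.
Proof.
move=> algA algB; exists (induction X algB), (induction (swap_context X) algA).
split; first exact: induction_retracts.
(* Swapping the context exchanges the two functors, so the same lemma gives the other composite. *)
by have := @induction_retracts _ _ _ (swap_context X) algB algA; rewrite swap_contextK.
Qed.

(** * Tube spaces *)

Lemma eq_tlift (K : fieldType) (V W : vectType K) (U : lmodType K) (f g : V -> W -> U) t :
  (forall v w, f v w = g v w) -> tlift f t = tlift g t.
Proof. by move=> fg; apply: eq_bigr => i _; apply: eq_bigr => j _; rewrite fg. Qed.

Lemma eq_tlift4 (K : fieldType) (V1 V2 V3 V4 : vectType K) (U : lmodType K)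
    (f g : V1 -> V2 -> V3 -> V4 -> U) t :
  (forall v1 v2 v3 v4, f v1 v2 v3 v4 = g v1 v2 v3 v4) -> tlift4 f t = tlift4 g t.
Proof. by move=> fg; do 2![apply: eq_tlift => ? ?]; apply: eq_tlift. Qed.

(** * Direct sums over pairs, grouped by the first index *)

Section DoubleSum.
Variables (K : fieldType) (S T : finType) (V : S -> T -> vectType K).
Local Notation dsum2 := (dsum (fun ij : S * T => V ij.1 ij.2)).

(** Used with i a pair of boundaries and j an arc label: a row collects all annuli between two fixed
    circles. *)
Definition row_of (u : dsum2) (i : S) : dsum (V i) := dsum_of (fun j => u (i, j)).

Definition row_in (i : S) (x : dsum (V i)) : dsum2 :=
  dsum_of (fun ij => dsum_in (V := fun i => dsum (V i)) x ij.1 ij.2).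

Lemma row_of_linear i : linear (fun u => row_of u i).
Proof.
apply: dsum_of_linear => j.
exact: (@dsum_coord_linear _ _ (fun ij : S * T => V ij.1 ij.2) (i, j)).
Qed.

Lemma row_of_ext u v : (forall i, row_of u i = row_of v i) -> u = v.
Proof.
move=> uv; apply: dsum_ext => [[i j]].
by have := congr1 (fun x : dsum (V i) => x j) (uv i); rewrite /row_of !dsum_ofE.
Qed.

Lemma row_of_in_same i (x : dsum (V i)) : row_of (row_in x) i = x.
Proof. by apply: dsum_ext => j; rewrite 2!dsum_ofE /= dsum_in_same. Qed.

Lemma row_of_in_other i i' (x : dsum (V i)) : i != i' -> row_of (row_in x) i' = 0.
Proof.
by move=> ii; apply: dsum_ext => j; rewrite 2!dsum_ofE /= dsum_in_other // ffunE.
Qed.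

Lemma row_in_linear i : linear (@row_in i).
Proof.
move=> a x y; apply: row_of_ext => i'; rewrite row_of_linear.
have [<-|ii] := eqVneq i i'; first by rewrite !row_of_in_same.
by rewrite !row_of_in_other // scaler0 addr0.
Qed.

Lemma row_in_dsum_in i j (v : V i j) : row_in (dsum_in v) =
  dsum_in (V := fun ij : S * T => V ij.1 ij.2) (i := (i, j)) v.
Proof.
apply: dsum_ext => [[i' j']]; rewrite dsum_ofE /=.
have [<-|ii] := eqVneq i i'; last first.
  by rewrite dsum_in_other // ffunE dsum_in_other // xpair_eqE negb_and ii.
rewrite dsum_in_same; have [<-|jj] := eqVneq j j'; first by rewrite !dsum_in_same.
by rewrite !dsum_in_other // xpair_eqE negb_and jj orbT.
Qed.

End DoubleSum.

(** * Unit labels for any number of edges *)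

Section UnitLabels.
Variable R : realType.

(** The case n = 1 stands apart because [tenseq] gives a single label without a unit factor; the
    empty bundle is the unit object itself. *)
Lemma unit_tenseq (C : fuscat R) n :
  exists oo : mor (one C) (tenseq (nseq n (irr1 C))) * mor (tenseq (nseq n (irr1 C))) (one C),
    oo.2 ∘ oo.1 = idm _.
Proof.
elim: n => [|[|n] [[o o'] /= oo]].
- by exists (idm _, idm _); rewrite comp1m.
- by exists (irr1_mor C, dag (irr1_mor C)); have [-> _] := irr1_unitary C.
exists ((ten C)⟦irr1_mor C, o⟧ ∘ dag (lun _), lun _ ∘ (ten C)⟦dag (irr1_mor C), o'⟧) => /=.
rewrite -compA (compA _ _ (dag _)) -bf_comp oo (irr1_unitary C).1 bf_id comp1m.
exact: (lun_unitary _).2.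
Qed.

Lemma unit_label (S : finType) (Es : S -> fuscat R) (E : fuscat R) (P : deligne Es E)
    (s : S -> nat) :
  exists (c : label Es s) (o : mor (one E) (label_ob P c)) (o' : mor (label_ob P c) (one E)),
    o' ∘ o = idm _.
Proof.
exists (finfun (fun i => nseq_tuple (s i) (irr1 (Es i)))).
have /fin_all_exists[f fP] : forall i, exists oo : mor (one (Es i))
    (tenseq ((finfun (fun i => nseq_tuple (s i) (irr1 (Es i))) : label Es s) i)) *
    mor (tenseq ((finfun (fun i => nseq_tuple (s i) (irr1 (Es i))) : label Es s) i))
      (one (Es i)), oo.2 ∘ oo.1 = idm _.
  by move=> i; rewrite ffunE; exact: unit_tenseq.
exists (dl_mor P (fun i => (f i).1) ∘ dl_one P), (dag (dl_one P) ∘ dl_mor P (fun i => (f i).2)).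
rewrite -compA (compA _ _ (dl_one P)) -dl_comp.
(* [dl_mor] takes a whole family of morphisms, so the pointwise equations must become one equation
   between families. *)
rewrite (functional_extensionality_dep _ _ fP) dl_id comp1m.
exact: (dl_one_unitary P).1.
Qed.

End UnitLabels.

(** * Tube algebras, their bimodules and the Morita context *)

Section Tubes.
Variables (R : realType) (I J : finType).
Variables (Cs : I -> fuscat R) (Ds : J -> fuscat R) (C D : fuscat R).
Variables (PC : deligne Cs C) (PD : deligne Ds D) (M : bimodcat C D).
Variable dbC : forall (k : irr C) (x : C), dual_basis k x.
Variable dbD : forall (k : irr D) (x : D), dual_basis k x.

Local Notation tube := (tube PC PD M).
Local Notation glue := (@glue R I J Cs Ds C D PC PD M dbC dbD).
Local Notation glue_ann := (glue_ann dbC dbD).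
Local Notation unit_ann := (unit_ann dbC dbD).

Definition circle_of s m (P : bdry Cs Ds M s m) : circle M :=
  (wall1 P, wall2 P, edgeC PC P, edgeD PD P).

(** The product of summands is the gluing of annuli between the circles of the labels; the two
    formulas differ only in the bracketing of composites. *)
Lemma glue_summandE s r t m n l (P : bdry Cs Ds M s m) (O : bdry Cs Ds M r n)
    (Q : bdry Cs Ds M t l) k k1 kout (T : summand PC PD P O k) (T1 : summand PC PD O Q k1) :
  glue_summand dbC dbD kout T T1 =
  @glue_block R C D M dbC dbD (circle_of P) (circle_of O) (circle_of Q) k k1 kout T T1.
Proof.
apply: eq_tlift4 => f h q g; apply: eq_tlift4 => f1 h1 q1 g1.
rewrite /glue_pure /compress_at.
do 4![apply: eq_bigr => ? _].
congr (pure4 _ _ _ _).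
- by rewrite /glueW !compA.
- by rewrite /glueC !compA.
by rewrite /glueD !compA.
Qed.

Section Parts.
Variables (s r : I -> nat) (m n : J -> nat).
Implicit Types (P : bdry Cs Ds M s m) (Q : bdry Cs Ds M r n).
Let V (PQ : bdry Cs Ds M s m * bdry Cs Ds M r n) k :=
  annblock (circle_of PQ.1) (circle_of PQ.2) k.

Definition part (T : tube s r m n) P Q : annulus (circle_of P) (circle_of Q) :=
  row_of (V := V) T (P, Q).

Definition matrix_unit P Q (X : annulus (circle_of P) (circle_of Q)) : tube s r m n :=
  row_in (V := V) (i := (P, Q)) X.

Lemma part_linear P Q : linear (fun T => part T P Q).
Proof. exact: (@row_of_linear _ _ _ V (P, Q)). Qed.

Lemma part_ext (T T' : tube s r m n) : (forall P Q, part T P Q = part T' P Q) -> T = T'.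
Proof. by move=> TT; apply: (@row_of_ext _ _ _ V) => [[P Q]]; exact: TT. Qed.

Lemma part_same P Q (X : annulus (circle_of P) (circle_of Q)) : part (matrix_unit X) P Q = X.
Proof. exact: (@row_of_in_same _ _ _ V (P, Q)). Qed.

Lemma part_other P Q (X : annulus (circle_of P) (circle_of Q)) P' Q' :
  (P, Q) != (P', Q') -> part (matrix_unit X) P' Q' = 0.
Proof. exact: (@row_of_in_other _ _ _ V (P, Q) (P', Q')). Qed.

Lemma matrix_unit_linear P Q : linear (@matrix_unit P Q).
Proof. exact: (@row_in_linear _ _ _ V (P, Q)). Qed.

End Parts.

(** Matrix multiplication over the common boundary, which reduces bilinearity, associativity and
    unit laws of tubes to those of [glue_ann]. *)
Lemma part_glue s r t m n l (T : tube s r m n) (T1 : tube r t n l) P Q :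
  part (glue T T1) P Q = \sum_O glue_ann (part T P O) (part T1 O Q).
Proof.
apply: dsum_ext => k; rewrite (plinear_sum (dsum_coord_linear k)) !dsum_ofE.
apply: eq_bigr => O _; rewrite glue_annE /pasting /dsum_mul dsum_ofE.
apply: eq_bigr => k' _; apply: eq_bigr => k1 _.
by rewrite glue_summandE !dsum_ofE.
Qed.

(** The unitaries [irr1_mor] carry arcs labelled by the unit object to arcs labelled by its simple
    representative. *)
Lemma unit_annE s m (P : bdry Cs Ds M s m) :
  unit_ann (circle_of P) =
  dsum_in (V := annblock (circle_of P) (circle_of P)) (i := arcs1 C D) (tube_id PC PD P).
Proof.
rewrite /tube_id -(compress_irr dbC dbD) -[RHS]diagramE.
have [uC _] := irr1_unitary C; have [uD _] := irr1_unitary D.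
apply: (diagram_mor dbC dbD (t := irr1_mor C) (v := irr1_mor D) (t' := irr1_mor C)
  (v' := irr1_mor D)).
- by rewrite /unitW compA.
- by rewrite /unitC -!compA -bf_comp uC comp1m bf_id compm1.
- by rewrite /unitD -!compA -bf_comp uD comp1m bf_id compm1.
by rewrite /unitW' -!compA -!bf_comp uC uD comp1m !bf_id compm1.
Qed.

Local Notation A := (tube_alg PC PD M dbC dbD).
Local Notation T := (tube_bimod PC PD M dbC dbD).

Lemma aone_units s m : aone (A s m) = \sum_P matrix_unit (unit_ann (circle_of P)).
Proof.
apply: eq_bigr => P _; rewrite unit_annE.
by apply/esym; exact: (@row_in_dsum_in _ _ _
  (fun PQ k => annblock (circle_of PQ.1) (circle_of PQ.2) k) (P, P) (arcs1 C D)).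
Qed.

Lemma part_sum s r m n (S : Type) (l : seq S) (X : S -> tube s r m n) P Q :
  part (\sum_(i <- l) X i) P Q = \sum_(i <- l) part (X i) P Q.
Proof. exact: (plinear_sum (part_linear P Q)). Qed.

Lemma part_one_same s m (P : bdry Cs Ds M s m) :
  part (aone (A s m)) P P = unit_ann (circle_of P).
Proof.
rewrite aone_units part_sum (bigD1 P) //= part_same big1 ?addr0 // => Q QP.
by rewrite part_other // xpair_eqE negb_and QP.
Qed.

Lemma part_one_other s m (P Q : bdry Cs Ds M s m) : P != Q -> part (aone (A s m)) P Q = 0.
Proof.
move=> PQ; rewrite aone_units part_sum big1 // => O _.
rewrite part_other // xpair_eqE negb_and.
by have [->|] := eqVneq O P.
Qed.

Lemma glue1l s r m n (X : tube s r m n) : glue (aone (A s m)) X = X.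
Proof.
apply: part_ext => P Q; rewrite part_glue (bigD1 P) //= part_one_same glue_unitl.
by rewrite big1 ?addr0 // => O OP; rewrite part_one_other 1?eq_sym // glue_ann0l.
Qed.

Lemma glue1r s r m n (X : tube s r m n) : glue X (aone (A r n)) = X.
Proof.
apply: part_ext => P Q; rewrite part_glue (bigD1 Q) //= part_one_same glue_unitr.
by rewrite big1 ?addr0 // => O OP; rewrite part_one_other // glue_ann0r.
Qed.

Lemma glue_bilin s r t m n l : bilin (@glue s r t m n l).
Proof.
split=> Y a X X'; apply: part_ext => P Q.
- rewrite (part_linear P Q a (glue X Y) (glue X' Y)) (part_glue X Y) (part_glue X' Y)
    (part_glue (a *: X + X') Y).
  have lin : linear (fun Z => \sum_O glue_ann (part Z P O) (part Y O Q)).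
    apply: plinear_sumf => O b Z Z'; rewrite (part_linear P O b Z Z').
    exact: (glue_ann_bilin dbC dbD _ _ _).1.
  exact: lin.
rewrite [LHS]part_glue [RHS](part_linear P Q a (glue Y X) (glue Y X')).
rewrite [X in _ = _ *: X + _]part_glue [X in _ = _ + X]part_glue.
have lin : linear (fun Z => \sum_O glue_ann (part Y P O) (part Z O Q)).
  apply: plinear_sumf => O b Z Z'; rewrite (part_linear O Q b Z Z').
  exact: (glue_ann_bilin dbC dbD _ _ _).2.
exact: lin.
Qed.

Lemma glueA s r t v m n l k (X : tube s r m n) (Y : tube r t n l) (Z : tube t v l k) :
  glue X (glue Y Z) = glue (glue X Y) Z.
Proof.
apply: part_ext => P Q; rewrite !part_glue.
under eq_bigr => O _ do
  rewrite part_glue (plinear_sum ((glue_ann_bilin dbC dbD _ _ _).2 _)).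
rewrite exchange_big; apply: eq_bigr => O' _ /=.
rewrite part_glue (plinear_sum ((glue_ann_bilin dbC dbD _ _ _).1 _)).
by apply: eq_bigr => O _; rewrite glue_annA.
Qed.

Lemma tube_is_alg s m : is_alg (A s m).
Proof.
split; [exact: glue_bilin | by move=> *; exact: glueA | exact: glue1l | exact: glue1r].
Qed.

Lemma tube_is_bimod s r m n : is_bimod (T s r m n).
Proof.
split; first by split; exact: glue_bilin.
- by split=> *; [exact: glueA | exact: glue1l].
- by split=> *; [exact/esym/glueA | exact: glue1r].
by move=> *; exact/esym/glueA.
Qed.

Lemma glue_matrix_unit s r t m n l (P : bdry Cs Ds M s m) (O : bdry Cs Ds M r n)
    (Q : bdry Cs Ds M t l) (X : annulus (circle_of P) (circle_of O))
    (Y : annulus (circle_of O) (circle_of Q)) :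
  glue (matrix_unit X) (matrix_unit Y) = matrix_unit (glue_ann X Y).
Proof.
apply: part_ext => P' Q'; rewrite part_glue (bigD1 O) //= big1 => [|O' OO]; last first.
  by rewrite part_other ?glue_ann0l // xpair_eqE negb_and orbC eq_sym OO.
rewrite addr0; have [PQ|] := eqVneq (P, Q) (P', Q').
  by case: PQ => <- <-; rewrite !part_same.
move=> PQ; rewrite (part_other _ PQ); move: PQ; rewrite xpair_eqE negb_and => /orP[] ne.
  by rewrite part_other ?glue_ann0l // xpair_eqE negb_and ne.
by rewrite [X in glue_ann _ X]part_other ?glue_ann0r // xpair_eqE negb_and ne orbT.
Qed.

Lemma aone_factor s r m n : exists l : seq (tube s r m n * tube r s n m),
  \sum_(x <- l) glue x.1 x.2 = aone (A s m).
Proof.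
have [cC [oC [oC' oCK]]] := unit_label PC r.
have [cD [oD [oD' oDK]]] := unit_label PD n.
(* Sums of products are closed under addition by concatenating lists, so each diagonal unit can be
   factored separately. *)
rewrite aone_units; apply: (big_ind (fun a : tube s s m m =>
  exists l : seq (tube s r m n * tube r s n m), \sum_(x <- l) glue x.1 x.2 = a)).
- by exists [::]; rewrite big_nil.
- by move=> a b [l la] [l' lb]; exists (l ++ l'); rewrite big_cat la lb.
move=> P _.
have [N [k [F [G FG]]]] := unit_ann_factor dbC dbD (circle_of P) oCK oDK.
(* The intermediate boundary keeps the upper wall label of P, takes the simple summand [k p] as
   lower one, and has unit labels on all edges of types r and n. *)
pose Q p : bdry Cs Ds M r n := (P.1.1.1, k p, cC, cD).
exists [seq (matrix_unit (F p : annulus (circle_of P) (circle_of (Q p))),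
   matrix_unit (G p : annulus (circle_of (Q p)) (circle_of P))) | p : 'I_N].
rewrite big_map big_enum /= -FG (plinear_sum (@matrix_unit_linear _ _ _ _ P P)).
by apply: eq_bigr => p _; rewrite glue_matrix_unit.
Qed.

(** [glue] serves as action and as pairing alike, so the action, balancing and swap laws are all
    instances of [glueA]; only the decompositions of the units come from [aone_factor]. *)
Lemma tube_context s r m n : exists X : morita_context (A s m) (A r n),
  contextM X = T s r m n /\ contextN X = T r s n m.
Proof.
have [l lE] := aone_factor s r m n; have [l' lE'] := aone_factor r s n m.
have e : \sum_i glue (tnth (in_tuple l) i).1 (tnth (in_tuple l) i).2 = aone (A s m).
  by rewrite -lE [RHS]big_tnth.
have e' : \sum_i glue (tnth (in_tuple l') i).1 (tnth (in_tuple l') i).2 = aone (A r n).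
  by rewrite -lE' [RHS]big_tnth.
by exists (@MoritaContext _ (A s m) (A r n) (T s r m n) (T r s n m)
  (tube_is_bimod s r m n) (tube_is_bimod r s n m)
  (@glue s r s m n m) (@glue r s r n m n) (@glue_bilin s r s m n m) (@glue_bilin r s r n m n)
  (fun a x y => esym (glueA a x y)) (fun x y a => glueA x y a)
  (fun x b y => esym (glueA x b y)) (fun b y x => esym (glueA b y x))
  (fun y x b => glueA y x b) (fun y a x => esym (glueA y a x))
  (fun x y x' => esym (glueA x y x')) (fun y x y' => esym (glueA y x y'))
  _ _ _ e _ _ _ e').
Qed.

End Tubes.

Theorem proposition10 (R : realType) (I J : finType)
    (Cs : I -> fuscat R) (Ds : J -> fuscat R) (C D : fuscat R)
    (PC : deligne Cs C) (PD : deligne Ds D) (M : bimodcat C D)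
    (dbC : forall (k : irr C) (x : C), dual_basis k x)
    (dbD : forall (k : irr D) (x : D), dual_basis k x) :
  indecomposable M ->
  let A s m := tube_alg PC PD M dbC dbD s m in
  let T s r m n := tube_bimod PC PD M dbC dbD s r m n in
  [/\ forall s m, is_alg (A s m),
      forall s r m n, is_bimod (T s r m n),
      forall s r m n,
        bimod_iso (btens (T s r m n) (T r s n m)) (regular (A s m)) /\
        bimod_iso (btens (T r s n m) (T s r m n)) (regular (A r n))
    & forall s r m n, morita (A s m) (A r n)].
Proof.
move=> _ A T; split=> [s m|s r m n|s r m n|s r m n].
- exact: tube_is_alg.
- exact: tube_is_bimod.
- have [X [XM XN]] := tube_context PC PD M dbC dbD s r m n; rewrite /T -XM -XN.
  split; first exact: (btens_regular X (tube_is_alg _ _ _ _ _ _ _)).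
  exact: (btens_regular (swap_context X) (tube_is_alg _ _ _ _ _ _ _)).
have [X _] := tube_context PC PD M dbC dbD s r m n.
exact: (context_morita X (tube_is_alg _ _ _ _ _ _ _) (tube_is_alg _ _ _ _ _ _ _)).
Qed.
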